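(* For any $w\in W$, the closure of the unstable manifold $\overline C^u(w)\subset M(\delta)$ is smooth (a smooth manifold). Moreover, $\overline C^u(w)$ is a twisted Tomei manifold for the Levi factor of the parabolic subgroup determined by $\Pi^u(w)$, with marked Dynkin diagram $\delta_{\Pi^u(w)}$.
   Context: $\mathfrak g$ is a real split semisimple Lie algebra of rank $l$ with split Cartan subalgebra $\mathfrak h$, simple roots $\Pi=\{\alpha_1,\dots,\alpha_l\}$, and Weyl group $W$ generated by the simple reflections $s_{\alpha_i}$, with length function $\ell$. For $B\subset\Pi$ let $W_B=\langle s_{\alpha_i}:\alpha_i\in B\rangle$. Put $\mathcal E=\{\pm1\}^l$. Twisted sign action: an action of $W$ on $\mathcal E$ for which there is an integer matrix $(a_{i,j})$ with $a_{i,i}$ even, and $a_{i,j}$ even if $i\ne j$ and $\alpha_i,\alpha_j$ are not joined in the Dynkin diagram, such that $s_{\alpha_i}$ sends $(\epsilon_j)_j$ to $(\epsilon_j\epsilon_i^{a_{j,i}})_j$. A marked Dynkin diagram is the Dynkin diagram with signs $s_{ij},s_{ji}$ attached to each edge joining $\alpha_i,\alpha_j$ (equal for single edges; $(+,+),(+,-)$ or $(-,+)$ for double edges; arbitrary for triple edges); it specifies the action with $(-1)^{a_{j,i}}=s_{ij}$ for adjacent $\alpha_i,\alpha_j$. Here $\delta$ is a marked Dynkin diagram giving rise to a twisted sign action of $W$ on $\mathcal E$, written $\epsilon\mapsto w\epsilon$. For $B\subset\Pi$, $\delta_B$ is the marked subdiagram with vertex set $B$; it corresponds to the action of $W_B$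 on $\{\pm1\}^B$ given by the same exponents $a_{j,i}$, $\alpha_i,\alpha_j\in B$. Polytope: fix $x_o$ in the open dominant chamber of $\mathfrak h$ and let $\Gamma\subset\mathfrak h$ be the convex hull of $Wx_o$. Let $\overline{C'}_e$ be the intersection of $\Gamma$ with the closed dominant chamber, $\overline{C'}_w=w(\overline{C'}_e)$, and $\overline C_w=\{w\}\times\overline{C'}_w$. The internal wall $C'^{\alpha_i,IN}_w$ is $w(\overline{C'}_e\cap\ker\alpha_i)$. The external wall $C'^{\alpha_i,OUT}_w$ is the facet of $\overline{C'}_w$ contained in the boundary of $\Gamma$ that meets all internal walls of $\overline{C'}_w$ except $C'^{\alpha_i,IN}_w$; explicitly it is $w\{x\in\overline{C'}_e:\omega_i(x)=\omega_i(x_o)\}$ with $\omega_i$ the $i$-th fundamental weight. For $A\subset\Pi$ put $C'^{A,OUT}_w=\bigcap_{\alpha_i\in A}C'^{\alpha_i,OUT}_w$ if $A\neq\emptyset$, $C'^{\emptyset,OUT}_w=\overline{C'}_w$, and $C^{A,OUT}_w=\{w\}\times C'^{A,OUT}_w$. Manifold: $\tilde M(\delta)=\bigsqcup_{w\in W,\epsilon\in\mathcal E}\{\epsilon\}\times\overline C_w$, with points $(\epsilon,w,x)$, $x\in\overline{C'}_w$. The twisted Tomei manifold $M(\delta)$ is the quotient of $\tilde M(\delta)$ under the equivalence relation generated by $(\epsilon,w,x)\sim(s_{\alpha_i}\epsilon,ws_{\alpha_i},x)$ for $x\in C'^{\alpha_i,IN}_w$, and $(\epsilon,w,x)\sim(\epsilon^{(i)},w,x)$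 for $x\in C'^{\alpha_i,OUT}_w$, where $\epsilon^{(i)}$ is $\epsilon$ with its $i$-th component negated; $z:\tilde M(\delta)\to M(\delta)$ is the quotient map. The twisted Tomei manifold for the Levi factor determined by $B\subset\Pi$ with marked diagram $\delta_B$ is the space obtained by the same construction from $W_B$, the simple roots $B$, the signs $\{\pm1\}^B$ with the action given by $\delta_B$, and the convex hull of a $W_B$-orbit of a regular dominant point (a point if $B=\emptyset$). Unstable manifolds: for $w\in W$ let $\Pi^u(w)=\{\alpha_i\in\Pi:\ell(s_{\alpha_i}w)>\ell(w)\}$, $\Pi^s(w)=\Pi\setminus\Pi^u(w)$, $W^u(w)=W_{\Pi^u(w)}$. The closure of the unstable manifold of the Toda flow on $M(\delta)$ associated with the critical point $w^{-1}x_o$ is the subset $$\overline C^u(w)=\bigcup_{\sigma\in W^u(w),\ B\supset\Pi^s(w)} z\bigl(\mathcal E\times C^{B,OUT}_{(\sigma w)^{-1}}\bigr)\subset M(\delta).$$ *)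

(* Defs.v *)
From HB Require Import structures.
From Stdlib Require Import Relation_Operators.
From mathcomp Require Import all_boot all_order all_algebra.
From mathcomp Require Import all_classical all_reals all_analysis.

Set Implicit Arguments.
Unset Strict Implicit.
Unset Printing Implicit Defensive.
Import Order.TTheory GRing.Theory Num.Theory.
Import numFieldNormedType.Exports.

Local Open Scope classical_set_scope.
Local Open Scope ring_scope.

(* Topological and smooth manifolds *)

Definition homeomorphic (X Y : topologicalType) : Prop :=
  exists (f : X -> Y) (g : Y -> X),
    [/\ continuous f, continuous g, cancel f g & cancel g f].

(* f is C^k on the open set O iff f is continuous on O and, when k > 0, all its
   directional derivatives exist and are C^(k-1) on O. *)
Fixpoint Ck_on (R : realType) (V W : normedModType R) (k : nat) (O : set V)
    (f : V -> W) : Prop :=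
  (forall x, O x -> {for x, continuous f}) /\
  match k with
  | 0%N => True
  | k'.+1 => forall v : V,
      (forall x, O x -> derivable f x v) /\ Ck_on k' O ('D_v f)
  end.

Definition smooth_on (R : realType) (V W : normedModType R) (O : set V)
    (f : V -> W) : Prop :=
  forall k, Ck_on k O f.

(* The j-th chart is phi j : U j -> R^d, with inverse psi j; the values of
   phi j outside U j and of psi j outside phi j @` U j are irrelevant. *)
Definition smooth_atlas (R : realType) (d : nat) (X : topologicalType)
    (J : Type) (U : J -> set X) (phi : J -> X -> 'rV[R]_d)
    (psi : J -> 'rV[R]_d -> X) : Prop :=
  [/\ \bigcup_j U j = [set: X],
      (forall j, open (U j) /\ open (phi j @` U j)),
      (forall j x, U j x -> psi j (phi j x) = x),
      (forall j, {within U j, continuous (phi j)} /\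
                 {within phi j @` U j, continuous (psi j)})
    & (forall j k, smooth_on (phi j @` (U j `&` U k)) (phi k \o psi j))].

Definition smooth_manifold (R : realType) (d : nat) (X : topologicalType) :
    Prop :=
  [/\ hausdorff_space X, @second_countable X
    & exists (J : Type) (U : J -> set X) (phi : J -> X -> 'rV[R]_d)
        (psi : J -> 'rV[R]_d -> X), smooth_atlas U phi psi].

(* Split semisimple real Lie algebras *)

Section LieAlgebra.
Context {R : realType} {g : vectType R}.
Variable br : {bilinear g -> g -> g}.

Definition lie_bracket : Prop :=
  (forall x, br x x = 0) /\
  (forall x y z, br x (br y z) + br y (br z x) + br z (br x y) = 0).

Definition ad (x : g) : 'End(g) := linfun (br x).

Definition killing (x y : g) : R :=
  \tr (passmx.mxof (vbasis {:g}) (vbasis {:g}) (ad x \o ad y)%VF).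

Definition semisimple : Prop :=
  forall x, (forall y, killing x y = 0) -> x = 0.

(* The subalgebra h of g, of dimension l, is the image of iota; its elements
   are identified with column vectors, and its linear forms with row vectors. *)
Variables (l : nat) (iota : {linear 'cV[R]_l -> g}).

Definition pairing (a : 'rV[R]_l) (x : 'cV[R]_l) : R := (a *m x) 0 0.

Definition root_space (a : 'rV[R]_l) : set g :=
  [set e | forall x, br (iota x) e = pairing a x *: e].

Definition split_cartan : Prop :=
  [/\ injective iota,
      (forall x y, br (iota x) (iota y) = 0),
      (forall e, (forall x, br (iota x) e = 0) -> exists y, e = iota y)
    & (exists2 X : seq g, basis_of fullv X &
         forall e, e \in X -> exists a, root_space a e)].

Definition is_root (a : 'rV[R]_l) : Prop :=
  a != 0 /\ exists2 e, root_space a e & e != 0.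

Definition simple_roots (alpha : 'I_l -> 'rV[R]_l) : Prop :=
  [/\ row_free (\matrix_i alpha i),
      (forall i, is_root (alpha i))
    & (forall a, is_root a -> exists c : 'I_l -> nat,
         a = \sum_i alpha i *+ c i \/ a = - \sum_i alpha i *+ c i)].

(* x - a(x) h is the reflection of h in the hyperplane ker a that is
   orthogonal for the Killing form. *)
Definition is_coroot (a : 'rV[R]_l) (h : 'cV[R]_l) : Prop :=
  pairing a h = 2 /\
  (forall x, pairing a x = 0 -> killing (iota h) (iota x) = 0).

Definition coroot (a : 'rV[R]_l) : 'cV[R]_l := xget 0 [set h | is_coroot a h].

End LieAlgebra.

(* The data from which a twisted Tomei manifold is built: simple roots, simple
   coroots, fundamental weights and marks, indexed by the vertices of the
   Dynkin diagram.  Signs are booleans, true standing for -1, so that they are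
   multiplied by addb; mark i j is the sign s_ij. *)
Record tomei_data (R : realType) (l : nat) (I : finType) := TomeiData {
  sroot : I -> 'rV[R]_l;
  scoroot : I -> 'cV[R]_l;
  fweight : I -> 'rV[R]_l;
  mark : I -> I -> bool }.

Section TomeiData.
Context {R : realType} {l : nat} {I : finType}.
Variable D : tomei_data R l I.

Definition cartan_entry (i j : I) : R := pairing (sroot D i) (scoroot D j).

Definition joined (i j : I) : bool := (i != j) && (cartan_entry i j != 0).

(* The number of lines joining i and j in the Dynkin diagram. *)
Definition edge_mult (i j : I) : R := cartan_entry i j * cartan_entry j i.

(* Only edges are marked: mark is + off the edges. *)
Definition marked_dynkin : Prop :=
  [/\ (forall i j, ~~ joined i j -> mark D i j = false),
      (forall i j, joined i j -> edge_mult i j = 1 -> mark D i j = mark D j i)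
    & (forall i j, joined i j -> edge_mult i j = 2 ->
         ~~ (mark D i j && mark D j i))].

Definition refl (i : I) : 'M[R]_l := 1%:M - scoroot D i *m sroot D i.

Definition weyl : set 'M[R]_l :=
  [set \prod_(i <- s) refl i | s in [set: seq I]].

Definition length (w : 'M[R]_l) : nat :=
  xget 0%N [set k | (exists2 s, size s = k & \prod_(i <- s) refl i = w) /\
    forall s, \prod_(i <- s) refl i = w -> (k <= size s)%N].

Definition signs := {ffun I -> bool}.

Definition sign_pow (b : bool) (a : int) : bool := b && odd `|a|%N.

Definition twisted_sign_action (a : I -> I -> int)
    (act : 'M[R]_l -> signs -> signs) : Prop :=
  [/\ (forall i, (2 %| a i i)%Z),
      (forall i j, i != j -> ~~ joined i j -> (2 %| a i j)%Z),
      (forall e, act 1 e = e),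
      (forall v w e, weyl v -> weyl w -> act (v * w) e = act v (act w e))
    & (forall i e,
         act (refl i) e = [ffun j => e j (+) sign_pow (e i) (a j i)])].

(* The marks give rise to a twisted sign action of W, with
   (-1)^(a_ji) = s_ij on the edges. *)
Definition marks_act : Prop :=
  exists a act, twisted_sign_action a act /\
    forall i j, joined i j -> odd `|a j i|%N = mark D i j.

(* The action of the i-th simple reflection on signs determined by the
   marks. *)
Definition twist (i : I) (e : signs) : signs :=
  [ffun j => e j (+) (e i && mark D i j)].

Definition flip (i : I) (e : signs) : signs :=
  [ffun j => if j == i then ~~ e j else e j].

Definition dominant : set 'cV[R]_l :=
  [set x | forall i, 0 <= pairing (sroot D i) x].

Definition regular_dominant (x : 'cV[R]_l) : Prop :=
  forall i, 0 < pairing (sroot D i) x.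

Variable xo : 'cV[R]_l.

Definition polytope : set 'cV[R]_l :=
  smallest (@convex_set R 'cV[R]_l) [set w *m xo | w in weyl].

Definition cell0 : set 'cV[R]_l := polytope `&` dominant.

Definition cell (w : 'M[R]_l) : set 'cV[R]_l := mulmx w @` cell0.

Definition wall_in (i : I) (w : 'M[R]_l) : set 'cV[R]_l :=
  mulmx w @` (cell0 `&` [set x | pairing (sroot D i) x = 0]).

Definition wall_out (i : I) (w : 'M[R]_l) : set 'cV[R]_l :=
  mulmx w @` (cell0 `&`
    [set x | pairing (fweight D i) x = pairing (fweight D i) xo]).

(* The intersection with cell w only matters when A is empty. *)
Definition walls_out (A : {set I}) (w : 'M[R]_l) : set 'cV[R]_l :=
  cell w `&` [set x | forall i, i \in A -> wall_out i w x].

(* The disjoint union of the {e} x {w} x cell w, where w ranges over W. *)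
Definition pieces : topologicalType :=
  {ew : signs * set_type weyl & set_type (cell (val ew.2))}.

Definition piece_sign (p : pieces) : signs := (projT1 p).1.
Definition piece_weyl (p : pieces) : 'M[R]_l := val (projT1 p).2.
Definition piece_pt (p : pieces) : 'cV[R]_l := val (projT2 p).

Definition glue_in (i : I) (p q : pieces) : Prop :=
  [/\ wall_in i (piece_weyl p) (piece_pt p),
      piece_sign q = twist i (piece_sign p),
      piece_weyl q = piece_weyl p * refl i & piece_pt q = piece_pt p].

Definition glue_out (i : I) (p q : pieces) : Prop :=
  [/\ wall_out i (piece_weyl p) (piece_pt p),
      piece_sign q = flip i (piece_sign p),
      piece_weyl q = piece_weyl p & piece_pt q = piece_pt p].

Definition glue : pieces -> pieces -> Prop :=
  clos_refl_sym_trans pieces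
    (fun p q => exists i, glue_in i p q \/ glue_out i p q).

Definition glueb (p q : pieces) : bool := `[< glue p q >].

Lemma glueb_refl : reflexive glueb.
Proof. by move=> p; apply/asboolP; exact: rst_refl. Qed.

Lemma glueb_sym : symmetric glueb.
Proof. by move=> p q; apply/asboolP/asboolP => h; exact: rst_sym. Qed.

Lemma glueb_trans : transitive glueb.
Proof.
move=> q p r /asboolP pq /asboolP qr; apply/asboolP; exact: rst_trans pq qr.
Qed.

Definition glue_equiv : equiv_rel pieces :=
  EquivRel glueb glueb_refl glueb_sym glueb_trans.

Definition tomei : topologicalType := quotient_topology {eq_quot glue_equiv}%qT.

Definition to_tomei (p : pieces) : tomei := (\pi_{eq_quot glue_equiv} p)%qT.

End TomeiData.

Arguments to_tomei {R l I D xo} p.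

(* The same data for the Levi factor determined by B: the restriction of a
   fundamental weight of g indexed by B to the span of the coroots indexed by B
   is the corresponding fundamental weight of the Levi factor.  The polytope of
   tomei (levi B D) y is the convex hull of the W_B-orbit of a point y of h
   that is regular dominant for the roots indexed by B; y may, but need not, lie
   in the span of the coroots indexed by B. *)
Definition levi (R : realType) (l : nat) (I : finType) (B : {set I})
    (D : tomei_data R l I) : tomei_data R l {i : I | i \in B} :=
  {| sroot := fun i => sroot D (val i);
     scoroot := fun i => scoroot D (val i);
     fweight := fun i => fweight D (val i);
     mark := fun i j => mark D (val i) (val j) |}.

(* The fundamental weights are the basis of the dual of h that is dual to the
   basis of simple coroots. *)
Definition lie_data (R : realType) (g : vectType R)
    (br : {bilinear g -> g -> g}) (l : nat) (iota : {linear 'cV[R]_l -> g})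
    (alpha : 'I_l -> 'rV[R]_l) (delta : 'I_l -> 'I_l -> bool) :
    tomei_data R l 'I_l :=
  {| sroot := alpha;
     scoroot := fun i => coroot br iota (alpha i);
     fweight := fun i =>
       row i (invmx (\matrix_(a, b) coroot br iota (alpha b) a 0));
     mark := delta |}.

Section Unstable.
Context {R : realType} {l : nat} {I : finType}.
Variables (D : tomei_data R l I) (xo : 'cV[R]_l) (w : 'M[R]_l).

Definition Pi_u : {set I} :=
  [set i | (length D w < length D (refl D i * w)%R)%N]%SET.

Definition Pi_s : {set I} := (~: Pi_u)%SET.

Definition weyl_u : set 'M[R]_l := weyl (levi Pi_u D).

Definition unstable_closure : set (tomei D xo) :=
  \bigcup_(sigma in weyl_u) \bigcup_(B in [set B : {set I} | Pi_s \subset B])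
    [set to_tomei p | p in [set p : pieces D xo |
       piece_weyl p = invmx (sigma *m w) /\
       walls_out D xo B (piece_weyl p) (piece_pt p)]].

End Unstable.

Arguments unstable_closure {R l I} D xo w _.

(* Main.v *)
Require Import Defs.
From mathcomp Require Import all_boot all_order all_algebra.
From mathcomp Require Import all_classical all_reals all_analysis.
From mathcomp Require Import ring lra.

(** The points of the fundamental cell are the dominant z for which xo - z is a
    nonnegative combination of the simple coroots (cell0P). So the cell is cut
    out by the values of the simple roots on z, which vanish on the internal
    walls, and by the coordinates of xo - z with respect to the coroots, which
    vanish on the external walls. Two opposite walls are disjoint (cell_facet):
    the cell is a combinatorial cube. The stabilizer of z in the Weyl group is
    generated by the reflections in the internal walls through z
    (dominant_stab), and therefore the equivalence relation generated by the
    gluing has a closed form (glueP): two points are identified when they lie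
    over the same point of the polytope and their signs correspond under the
    Weyl group at all vertices whose external wall avoids z.

    This makes the glued space a manifold. Near a point, let J be the set of
    vertices whose external wall avoids it. The simple roots in J are smooth
    functions across the internal walls in J, and the remaining coordinates of
    xo - z become smooth across the external walls once they are replaced by
    their square roots with the sign of the piece (cmap). A coordinate change
    is composed of linear maps, squares, square roots of positive functions and
    signs that are locally constant (transition_smooth).

    Let B be the set of simple roots that increase the length of w. The
    closure of the unstable manifold lies over the faces of the polytope on
    which the coordinates outside B vanish. For the fundamental cell this face
    is the fundamental cell of the Levi factor of B with the same xo
    (levi_cell0), because simple roots are nonpositive on the coroots of other
    indices. On the face the signs outside B are forgotten, and the subgroup of
    B acts on the others as in the Levi factor. What remains is to
    replace xo by another point y that is regular for the Levi factor: the
    cells of y and xo are homeomorphic by matching the points for which the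
    ratios of the distances to opposite walls agree. These ratios determine a
    point through a linear system, which is solvable and has its solution in
    the cell by positive definiteness of the invariant form and because
    distinct simple roots and coroots pair nonpositively (match_cell). The
    closure of the unstable manifold is thus a quotient of the same compact
    space of pieces, by the same relation, as the Tomei manifold of the Levi
    factor (levi_face_param); this gives both the smooth structure and the
    homeomorphism.

    All this needs of the Lie algebra only a finite system of roots with an
    invariant scalar product and dual weights, and an action on signs by the
    marks (root_datum). The Killing form is positive definite on a split Cartan
    subalgebra, and sl2 strings show that reflections permute the roots
    (lie_root_datum). *)

Set Implicit Arguments.
Unset Strict Implicit.
Unset Printing Implicit Defensive.
Import Order.TTheory GRing.Theory Num.Theory.
Import numFieldNormedType.Exports.

Local Open Scope classical_set_scope.
Local Open Scope ring_scope.

(** * Root data, parabolic subgroups and dominance *)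

Section Pairing.
Context {R : realType} {l : nat}.
Implicit Types (a b : 'rV[R]_l) (x y : 'cV[R]_l).

Lemma pairingDl a b x : pairing (a + b) x = pairing a x + pairing b x.
Proof. by rewrite /pairing mulmxDl mxE. Qed.

Lemma pairingDr a x y : pairing a (x + y) = pairing a x + pairing a y.
Proof. by rewrite /pairing mulmxDr mxE. Qed.

Lemma pairingNl a x : pairing (- a) x = - pairing a x.
Proof. by rewrite /pairing mulNmx mxE. Qed.

Lemma pairingNr a x : pairing a (- x) = - pairing a x.
Proof. by rewrite /pairing mulmxN mxE. Qed.

Lemma pairingBr a x y : pairing a (x - y) = pairing a x - pairing a y.
Proof. by rewrite pairingDr pairingNr. Qed.

Lemma pairingZl c a x : pairing (c *: a) x = c * pairing a x.
Proof. by rewrite /pairing -scalemxAl mxE. Qed.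

Lemma pairingZr c a x : pairing a (c *: x) = c * pairing a x.
Proof. by rewrite /pairing -scalemxAr mxE. Qed.

Lemma pairing0l x : pairing 0 x = 0.
Proof. by rewrite /pairing mul0mx mxE. Qed.

Lemma pairing0r a : pairing a 0 = 0.
Proof. by rewrite /pairing mulmx0 mxE. Qed.

Lemma pairing_suml (J : Type) (s : seq J) (P : pred J) (f : J -> 'rV[R]_l) x :
  pairing (\sum_(i <- s | P i) f i) x = \sum_(i <- s | P i) pairing (f i) x.
Proof. by rewrite /pairing mulmx_suml summxE. Qed.

Lemma pairing_sumr (J : Type) (s : seq J) (P : pred J) (f : J -> 'cV[R]_l) a :
  pairing a (\sum_(i <- s | P i) f i) = \sum_(i <- s | P i) pairing a (f i).
Proof. by rewrite /pairing mulmx_sumr summxE. Qed.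

Lemma trmx_scale (c : R) x : (c *: x)^T = c *: x^T.
Proof. by apply/matrixP => i j; rewrite !mxE. Qed.

Lemma pairing_mul a (w : 'M[R]_l) x : pairing a (w *m x) = pairing (a *m w) x.
Proof. by rewrite /pairing mulmxA. Qed.

End Pairing.

Section RootDatumDef.
Context {R : realType} {l : nat} {I : finType} (D : tomei_data R l I).

(** What the construction of a Tomei manifold uses of a root system. Both a
    split semisimple Lie algebra and each of its Levi factors provide one, so
    that everything below applies to both. The form gram is invariant under
    the Weyl group, because it makes each simple root a positive multiple of
    the dual of its coroot; the roots are kept as a finite sequence that the
    simple reflections preserve and in which every element is positive or
    negative. *)
Record root_datum := RootDatum {
  gram : 'M[R]_l;
  rscale : I -> R;
  roots : seq 'rV[R]_l;
  sact : 'M[R]_l -> @signs I -> @signs I;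
  gram_sym : gram^T = gram;
  gram_gt0 : forall x : 'cV[R]_l, x != 0 -> 0 < (x^T *m gram *m x) 0 0;
  rscale_gt0 : forall i, 0 < rscale i;
  sroot_gram : forall i, sroot D i = rscale i *: ((scoroot D i)^T *m gram);
  pairing_coroot : forall i, pairing (sroot D i) (scoroot D i) = 2;
  fweight_coroot : forall i j,
    pairing (fweight D i) (scoroot D j) = (i == j)%:R;
  sroot_roots : forall i, sroot D i \in roots;
  refl_roots : forall i a, a \in roots -> a *m refl D i \in roots;
  roots_comb : forall a, a \in roots -> exists c : I -> R,
    (forall i, 0 <= c i) /\
    (a = \sum_i c i *: sroot D i \/ a = - \sum_i c i *: sroot D i);
  sact1 : forall e, sact 1 e = e;
  sactM : forall v w e, weyl D v -> weyl D w ->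
    sact (v * w) e = sact v (sact w e);
  sact_refl : forall i e, sact (refl D i) e = twist D i e }.

Definition wordprod (s : seq I) : 'M[R]_l := \prod_(i <- s) refl D i.

Definition parabolic (J : {set I}) : set 'M[R]_l :=
  [set w | exists2 s, all (mem J) s & w = wordprod s].

End RootDatumDef.

Section RootDatum.
Context {R : realType} {l : nat} {I : finType} {D : tomei_data R l I}.
Variable H : root_datum D.

Local Notation al := (sroot D).
Local Notation h := (scoroot D).
Local Notation om := (fweight D).
Local Notation G := (gram H).
Local Notation prodw := (wordprod D).
Implicit Types (i j k : I) (x y z : 'cV[R]_l) (a : 'rV[R]_l) (w v u : 'M[R]_l).
Implicit Types (s t : seq I) (J : {set I}) (e f : @signs I).

Definition ip x y : R := (x^T *m G *m y) 0 0.

Lemma ip_eq0 x : ip x x <= 0 -> x = 0.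
Proof.
move=> h0; apply/eqP; apply: contraTT h0 => x0; rewrite -ltNge.
exact: gram_gt0.
Qed.

Lemma pairing_ip i x : pairing (al i) x = rscale H i * ip (h i) x.
Proof. by rewrite /pairing (sroot_gram H) -scalemxAl mxE. Qed.

Lemma ip_pairing i x : ip (h i) x = pairing (al i) x / rscale H i.
Proof. by rewrite pairing_ip mulrC mulKf // gt_eqF // rscale_gt0. Qed.

Lemma ip_suml (c : I -> R) (P : pred I) x :
  ip (\sum_(i | P i) c i *: h i) x = \sum_(i | P i) c i * ip (h i) x.
Proof.
rewrite /ip raddf_sum /= !mulmx_suml summxE; apply: eq_bigr => i _.
by rewrite linearZ /= -!scalemxAl mxE.
Qed.

(** Positive definiteness in the form used for uniqueness and positivity of
    coordinates: the square length of the vector is the sum of the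
    nonpositive products below, up to positive factors. *)
Lemma comb_eq0 (p : I -> R) :
  (forall i, p i * pairing (al i) (\sum_i p i *: h i) <= 0) ->
  \sum_i p i *: h i = 0.
Proof.
move=> hp; apply: ip_eq0; rewrite ip_suml; apply: sumr_le0 => i _.
have r0 : 0 <= (rscale H i)^-1 by rewrite invr_ge0 ltW // rscale_gt0.
by rewrite ip_pairing mulrA (mulr_le0_ge0 (hp i) r0).
Qed.

Lemma fweight_comb i (p : I -> R) : pairing (om i) (\sum_j p j *: h j) = p i.
Proof.
rewrite pairing_sumr (bigD1 i) //= pairingZr (fweight_coroot H) eqxx mulr1.
rewrite big1 ?addr0 // => j ji.
by rewrite pairingZr (fweight_coroot H) eq_sym (negPf ji) mulr0.
Qed.

Lemma comb0 (p : I -> R) : \sum_j p j *: h j = 0 -> forall i, p i = 0.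
Proof. by move=> p0 i; rewrite -(fweight_comb i) p0 pairing0r. Qed.

Lemma gram_inj x : x^T *m G = 0 -> x = 0.
Proof. by move=> x0; apply: ip_eq0; rewrite /ip x0 mul0mx mxE. Qed.

Lemma sroot_comb_gram (c : I -> R) : \sum_i c i *: al i =
  (\sum_i (c i * rscale H i) *: h i)^T *m G.
Proof.
rewrite raddf_sum /= mulmx_suml; apply: eq_bigr => i _.
by rewrite (sroot_gram H) trmx_scale -[RHS]scalemxAl scalerA.
Qed.

Lemma sroot_indep (c d : I -> R) :
  \sum_i c i *: al i = \sum_i d i *: al i -> forall i, c i = d i.
Proof.
move=> cd i.
have e0 : \sum_i ((c i - d i) * rscale H i) *: h i = 0.
  apply: gram_inj; rewrite -sroot_comb_gram.
  under eq_bigr do rewrite scalerBl; rewrite sumrB cd; exact: subrr.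
apply/eqP; rewrite -subr_eq0; move: (comb0 e0 i) => /eqP.
by rewrite mulf_eq0 (gt_eqF (rscale_gt0 H i)) orbF.
Qed.

Lemma sroot_indep_opp (c d : I -> R) : (forall i, 0 <= d i) ->
  \sum_i c i *: al i = - (\sum_i d i *: al i) -> forall i, c i <= 0.
Proof.
move=> d0; rewrite -sumrN; under [X in _ = X]eq_bigr do rewrite -scaleNr.
by move=> /sroot_indep e i; rewrite e oppr_le0.
Qed.

Lemma sroot_delta i : al i = \sum_k (k == i)%:R *: al k.
Proof.
rewrite (bigD1 i) //= eqxx scale1r big1 ?addr0 // => k /negPf ->.
by rewrite scale0r.
Qed.

Lemma refl_mulr i x : refl D i *m x = x - pairing (al i) x *: h i.
Proof.
rewrite /refl mulmxBl mul1mx -mulmxA; congr (_ - _).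
by rewrite [al i *m x]mx11_scalar mul_mx_scalar.
Qed.

Lemma refl_mull i a : a *m refl D i = a - pairing a (h i) *: al i.
Proof.
rewrite /refl mulmxBr mulmx1 mulmxA; congr (_ - _).
by rewrite [a *m h i]mx11_scalar mul_scalar_mx.
Qed.

Lemma refl_sroot i : al i *m refl D i = - al i.
Proof.
by rewrite refl_mull (pairing_coroot H) scaler_nat mulr2n opprD addrA subrr sub0r.
Qed.

Lemma reflK i : refl D i * refl D i = 1.
Proof.
rewrite {1}/refl mulrBl mul1r -!mulmxE -mulmxA refl_sroot mulmxN opprK.
by rewrite /refl subrK.
Qed.

Lemma refl_fix i x : pairing (al i) x = 0 -> refl D i *m x = x.
Proof. by move=> x0; rewrite refl_mulr x0 scale0r subr0. Qed.

Lemma refl_fweight i j : i != j -> om i *m refl D j = om i.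
Proof.
by move=> ij; rewrite refl_mull (fweight_coroot H) (negPf ij) scale0r subr0.
Qed.

(** The reflection of a simple root in another one is a root in which the
    first simple root has coefficient 1, hence all coefficients are
    nonnegative. *)
Lemma cartan_le0 i j : i != j -> pairing (al i) (h j) <= 0.
Proof.
move=> ij; have := refl_roots j (sroot_roots H i); rewrite refl_mull.
have -> : al i - pairing (al i) (h j) *: al j =
    \sum_k ((k == i)%:R - pairing (al i) (h j) * (k == j)%:R) *: al k.
  under eq_bigr do rewrite scalerBl -scalerA.
  by rewrite sumrB -scaler_sumr -!sroot_delta.
case/roots_comb => c [c0 [/sroot_indep/(_ j)|/(sroot_indep_opp c0)/(_ i)]].
  by rewrite eq_sym (negPf ij) eqxx mulr1 sub0r => /eqP; rewrite -oppr_ge0 => /eqP ->.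
by rewrite eqxx (negPf ij) mulr0 subr0 ler10.
Qed.

Lemma prodw_nil : prodw [::] = 1. Proof. by rewrite /wordprod big_nil. Qed.

Lemma prodw_cons i s : prodw (i :: s) = refl D i * prodw s.
Proof. by rewrite /wordprod big_cons. Qed.

Lemma prodw_cat s t : prodw (s ++ t) = prodw s * prodw t.
Proof. by rewrite /wordprod big_cat. Qed.

Lemma prodw1 i : prodw [:: i] = refl D i.
Proof. by rewrite /wordprod big_seq1. Qed.

Lemma prodw_rcons s i : prodw (rcons s i) = prodw s * refl D i.
Proof. by rewrite -cats1 prodw_cat prodw1. Qed.

Lemma prodw_rev s : prodw (rev s) * prodw s = 1.
Proof.
elim: s => [|i s IH]; first by rewrite prodw_nil mulr1.
rewrite rev_cons prodw_rcons prodw_cons -mulrA [refl D i * _]mulrA reflK.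
by rewrite mul1r.
Qed.

Lemma prodw_unit s : prodw s \in unitmx.
Proof. by case: (mulmx1_unit (prodw_rev s)). Qed.

Lemma prodw_inv s : invmx (prodw s) = prodw (rev s).
Proof.
rewrite -[LHS](mul1mx (invmx _)) -[1%:M](prodw_rev s) -mulmxE -mulmxA.
by rewrite mulmxV ?mulmx1 // prodw_unit.
Qed.

Lemma weylP w : weyl D w <-> exists s, w = prodw s.
Proof. by split => [[s _ <-]|[s ->]]; exists s. Qed.

Lemma weyl_prodw s : weyl D (prodw s). Proof. by exists s. Qed.

Lemma weyl1 : weyl D 1. Proof. by rewrite -prodw_nil; exact: weyl_prodw. Qed.

Lemma weyl_refl i : weyl D (refl D i).
Proof. by rewrite -prodw1; exact: weyl_prodw. Qed.

Lemma weylM v w : weyl D v -> weyl D w -> weyl D (v * w).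
Proof.
by move=> /weylP[s ->] /weylP[t ->]; rewrite -prodw_cat; exact: weyl_prodw.
Qed.

Lemma weylV w : weyl D w -> weyl D (invmx w).
Proof. by move=> /weylP[s ->]; rewrite prodw_inv; exact: weyl_prodw. Qed.

Lemma weyl_unit w : weyl D w -> w \in unitmx.
Proof. by move=> /weylP[s ->]; exact: prodw_unit. Qed.

Lemma parabolic1 J : parabolic D J 1.
Proof. by exists [::]; rewrite ?prodw_nil. Qed.

Lemma parabolic_refl J i : i \in J -> parabolic D J (refl D i).
Proof. by move=> iJ; exists [:: i]; rewrite ?prodw1 //= iJ. Qed.

Lemma parabolicM J v w :
  parabolic D J v -> parabolic D J w -> parabolic D J (v * w).
Proof.
move=> [s sJ ->] [t tJ ->]; exists (s ++ t); last by rewrite prodw_cat.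
by rewrite all_cat sJ tJ.
Qed.

Lemma parabolicV J w : parabolic D J w -> parabolic D J (invmx w).
Proof.
by move=> [s sJ ->]; exists (rev s); rewrite ?all_rev // prodw_inv.
Qed.

Lemma parabolic_weyl J w : parabolic D J w -> weyl D w.
Proof. by move=> [s _ ->]; exact: weyl_prodw. Qed.

Lemma parabolicT w : weyl D w -> parabolic D [set: I]%SET w.
Proof.
by move=> /weylP[s ->]; exists s => //; apply/allP => i _; exact: finset.in_setT.
Qed.

Lemma parabolicS J (K : {set I}) w : J \subset K -> parabolic D J w -> parabolic D K w.
Proof.
move=> /fintype.subsetP JK [s /allP sJ ->]; exists s => //.
by apply/allP => i /sJ /=; exact: JK.
Qed.

Lemma parabolic_unit J w : parabolic D J w -> w \in unitmx.
Proof. by move=> /parabolic_weyl /weyl_unit. Qed.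

(** A fundamental weight is fixed by all simple reflections but its own. *)
Lemma parabolic_fweight J w i : parabolic D J w -> i \notin J -> om i *m w = om i.
Proof.
move=> [s + ->] iJ; elim: s => [|j s IH] /=; first by rewrite prodw_nil mulmx1.
case/andP=> jJ sJ; rewrite prodw_cons -mulmxE mulmxA refl_fweight ?IH //.
by apply: contraNneq iJ => ->.
Qed.

Lemma parabolic_fix J w x : parabolic D J w ->
  (forall i, i \in J -> pairing (al i) x = 0) -> w *m x = x.
Proof.
move=> [s + ->] x0; elim: s => [|j s IH] /=; first by rewrite prodw_nil mul1mx.
by case/andP=> jJ sJ; rewrite prodw_cons -mulmxE -mulmxA IH // refl_fix ?x0.
Qed.

Lemma weyl_gram w : weyl D w -> w^T *m G *m w = G.
Proof.
move=> /weylP[s ->]; elim: s => [|i s IH].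
  by rewrite prodw_nil trmx1 mul1mx mulmx1.
rewrite prodw_cons -mulmxE trmx_mul -!mulmxA.
suff e : (refl D i)^T *m (G *m refl D i) = G.
  by rewrite (mulmxA G) (mulmxA _^T (G *m _)) e mulmxA.
have hG : (h i)^T *m G = (rscale H i)^-1 *: al i.
  by rewrite (sroot_gram H) scalerA mulVf ?scale1r // gt_eqF // rscale_gt0.
have Gh : G *m h i = (rscale H i)^-1 *: (al i)^T.
  by rewrite -linearZ /= -hG trmx_mul trmxK gram_sym.
have rT : (refl D i)^T *m (G *m h i) = - (G *m h i).
  rewrite Gh -scalemxAr -trmx_mul refl_sroot; first by rewrite linearN /= scalerN.
rewrite {2}/refl mulmxBr mulmx1 mulmxBr (mulmxA G) (mulmxA _^T (G *m _)) rT.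
rewrite mulNmx opprK Gh -scalemxAl /refl linearB /= trmx1 mulmxBl mul1mx.
by rewrite trmx_mul -mulmxA hG -scalemxAr subrK.
Qed.

Definition reduced J s := all (mem J) s /\
  forall t, all (mem J) t -> prodw t = prodw s -> (size s <= size t)%N.

Lemma ex_reduced J w : parabolic D J w -> exists2 s, reduced J s & w = prodw s.
Proof.
move=> [s sJ ->].
have [n] := ubnP (size s); elim: n s sJ => // n IH s sJ sn.
have [s_red|] := pselect (reduced J s); first by exists s.
move=> /not_andP[//|/existsNP[t /not_implyP[tJ /not_implyP[ts]]]].
move=> /negP; rewrite -ltnNge => lt_ts.
have [|r r_red e] := IH t tJ; first exact: leq_trans lt_ts _.
by exists r => //; rewrite -ts.
Qed.

Lemma reduced_tail J i s : reduced J (i :: s) -> reduced J s.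
Proof.
move=> [/= /andP[iJ sJ] smin]; split => // t tJ ts.
have := smin (i :: t); rewrite /= iJ tJ !prodw_cons ts ltnS; exact.
Qed.

Definition pos_comb a := exists2 c : I -> R,
  forall i, 0 <= c i & a = \sum_i c i *: al i.

Lemma roots_prodw s a : a \in roots H -> a *m prodw s \in roots H.
Proof.
elim: s a => [|i s IH] a ar; first by rewrite prodw_nil mulmx1.
by rewrite prodw_cons -mulmxE mulmxA; apply: IH; exact: refl_roots.
Qed.

(** A simple reflection changes the coefficient of its own root only, so a
    positive root that it makes negative is a multiple of that root. *)
Lemma pos_comb_refl a k : a \in roots H -> pos_comb a ->
  ~ pos_comb (a *m refl D k) -> exists c, a = c *: al k.
Proof.
move=> ar [c c0 ea] npos; exists (c k).
have := refl_roots k ar => /roots_comb[d [d0 []]] ed.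
  by case: npos; exists d.
have ck i : i != k -> c i = 0.
  move=> ik; apply/eqP; rewrite eq_le c0 andbT.
  have e : \sum_i (c i - pairing a (h k) * (i == k)%:R) *: al i =
      - \sum_i d i *: al i.
    rewrite -ed refl_mull ea; under eq_bigr do rewrite scalerBl -scalerA.
    by rewrite sumrB -scaler_sumr -sroot_delta -ea.
  by have := sroot_indep_opp d0 e i; rewrite (negPf ik) mulr0 subr0.
rewrite ea (bigD1 k) //= big1 ?addr0 // => i ik.
by rewrite ck ?scale0r.
Qed.

(** An isometry that maps one simple root to a multiple of another one
    conjugates their reflections. *)
Lemma refl_conj i k u c : weyl D u -> al i *m u = c *: al k ->
  refl D i * u = u * refl D k.
Proof.
move=> Wu e; have uu := weyl_unit Wu.
have uh : rscale H i *: (invmx u *m h i) = (c * rscale H k) *: h k.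
  apply/eqP; rewrite -subr_eq0; apply/eqP/gram_inj.
  rewrite linearB /= !trmx_scale mulmxBl -!scalemxAl -[(c * _) *: _]scalerA.
  rewrite -(sroot_gram H) -e (sroot_gram H) -!scalemxAl.
  have -> : (invmx u *m h i)^T *m G = (h i)^T *m G *m u; last exact: subrr.
  by rewrite -{1}(weyl_gram Wu) !mulmxA -trmx_mul mulKVmx.
have uh' : invmx u *m h i = (c * rscale H k / rscale H i) *: h k.
  apply: (@scalerI _ _ (rscale H i)); first by rewrite gt_eqF // rscale_gt0.
  by rewrite uh scalerA [X in _ = X *: _]mulrC divfK // gt_eqF // rscale_gt0.
have hu : h i = (c * rscale H k / rscale H i) *: (u *m h k).
  by rewrite scalemxAr -uh' mulKVmx.
have sc : c * (c * rscale H k / rscale H i) = 1.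
  have := pairing_coroot H i; rewrite {1}hu pairingZr pairing_mul e pairingZl.
  rewrite (pairing_coroot H) mulrA [_ * c]mulrC => /eqP.
  by rewrite -subr_eq0 -{2}[2]mul1r -mulrBl mulf_eq0 pnatr_eq0 orbF subr_eq0 => /eqP.
rewrite /refl mulrBl mulrBr mul1r mulr1; congr (_ - _).
rewrite -mulmxE -mulmxA e hu -scalemxAl -scalemxAr scalerA mulrC sc scale1r.
by rewrite mulmxA.
Qed.

(** If the image were negative, then the images of the root under the initial
    subwords would change sign at some letter; the exchange condition would
    then delete two letters from the word. *)
Lemma reduced_pos J i s : reduced J (i :: s) -> pos_comb (al i *m prodw s).
Proof.
move=> [sJ smin]; apply: contrapT => neg.
suff [s1 [k [s2 [es e]]]] : exists s1 k s2,
    s = s1 ++ k :: s2 /\ refl D i * prodw s1 = prodw s1 * refl D k.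
  have := smin (s1 ++ s2); rewrite es /= !size_cat /= addnS => hm.
  suff : ((size s1 + size s2).+1 < size s1 + size s2)%N by rewrite ltnNge leqnSn.
  apply: hm; first by move: sJ; rewrite es /= !all_cat /= => /and4P[_ -> _ ->].
  rewrite prodw_cons !prodw_cat prodw_cons [refl D i * _]mulrA e -!mulrA.
  by rewrite [refl D k * (_ * _)]mulrA reflK mul1r.
have pos0 : pos_comb (al i *m prodw [::]).
  rewrite prodw_nil mulmx1; exists (fun k => (k == i)%:R); last exact: sroot_delta.
  by move=> k; rewrite ler0n.
rewrite -[s]cat0s in neg *; move: pos0 neg.
elim: s [::] {sJ smin} => [|k s IH] s1 pos1; first by rewrite cats0.
have [pos2|npos _] := pselect (pos_comb (al i *m prodw (rcons s1 k))).
  rewrite -cat_rcons => /(IH _ pos2)[t1 [k' [t2 [e1 e2]]]].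
  by exists t1, k', t2.
rewrite prodw_rcons -mulmxE mulmxA in npos.
have [c e] := pos_comb_refl (roots_prodw s1 (sroot_roots H i)) pos1 npos.
by exists s1, k, s; split => //; apply: refl_conj e; exact: weyl_prodw.
Qed.

Lemma prodw_span J s i : all (mem J) s -> i \in J -> exists2 c : I -> R,
  forall k, k \notin J -> c k = 0 & al i *m prodw s = \sum_k c k *: al k.
Proof.
move=> + iJ; elim/last_ind: s => [_|s j IH].
  rewrite prodw_nil mulmx1; exists (fun k => (k == i)%:R); last exact: sroot_delta.
  by move=> k kJ; case: eqP kJ => // ->; rewrite iJ.
rewrite all_rcons => /andP[jJ /IH[c c0 e]].
exists (fun k => c k - pairing (al i *m prodw s) (h j) * (k == j)%:R).
  move=> k kJ; rewrite c0 //; case: eqP kJ => [->|_ _]; last by rewrite mulr0 subr0.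
  by move: jJ => /= ->.
rewrite prodw_rcons -mulmxE mulmxA refl_mull; under eq_bigr do rewrite scalerBl -scalerA.
by rewrite sumrB -scaler_sumr -sroot_delta -e.
Qed.

(** The image is positive by the exchange condition, and its coefficients
    outside J are those of a simple root in J, because reflections in J only
    change coefficients in J. *)
Lemma reduced_pos_span J i s : reduced J (i :: s) -> exists c : I -> R,
  [/\ forall k, 0 <= c k, forall k, k \notin J -> c k = 0
    & al i *m prodw s = \sum_k c k *: al k].
Proof.
move=> rs; have [/= /andP[iJ sJ] _] := rs.
have [c c0 e] := reduced_pos rs; have [d d0 e'] := prodw_span sJ iJ.
by exists c; split => // k kJ; rewrite -(d0 _ kJ); apply: sroot_indep; rewrite -e -e'.
Qed.

Definition dominantJ J x := forall i, i \in J -> 0 <= pairing (al i) x.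

Lemma reduced_pairing J i s x : reduced J (i :: s) -> dominantJ J x ->
  0 <= pairing (al i) (prodw s *m x).
Proof.
move=> /reduced_pos_span[c [c0 cJ e]] xJ; rewrite pairing_mul e pairing_suml.
apply: sumr_ge0 => k _; rewrite pairingZl.
have [kJ|/cJ ->] := boolP (k \in J); last by rewrite mul0r.
by rewrite mulr_ge0 // xJ.
Qed.

(** Each letter of a reduced word lowers the vector by a nonnegative multiple
    of a coroot. *)
Lemma parabolic_dominant_ge J w x k : parabolic D J w -> dominantJ J x ->
  0 <= pairing (om k) (x - w *m x).
Proof.
move=> /ex_reduced[s + ->] xJ; elim: s => [_|i s IH rs].
  by rewrite prodw_nil mul1mx subrr pairing0r.
have {}IH := IH (reduced_tail rs).
rewrite prodw_cons -mulmxE -mulmxA refl_mulr opprB addrCA pairingDr.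
rewrite addr_ge0 // pairingZr mulr_ge0 ?(reduced_pairing rs) //.
by rewrite (fweight_coroot H) ler0n.
Qed.

(** A dominant vector that is moved to a dominant vector is fixed, and the
    first letter of a reduced word of the element fixes it already. *)
Lemma dominant_stab x w : weyl D w ->
  dominant D x -> dominant D (w *m x) ->
  w *m x = x /\ parabolic D [set i | pairing (al i) x == 0]%SET w.
Proof.
move=> /parabolicT/ex_reduced[s + ->] xd.
elim: s => [|i s IH] rs wxd.
  by rewrite prodw_nil mul1mx; split => //; exact: parabolic1.
have xi : pairing (al i) (prodw s *m x) = 0.
  apply/eqP; rewrite eq_le (reduced_pairing rs) ?andbT => [|k _]; last exact: xd.
  have := wxd i; rewrite prodw_cons -mulmxE -mulmxA pairing_mul refl_sroot.
  by rewrite pairingNl oppr_ge0.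
have sx : prodw (i :: s) *m x = prodw s *m x.
  by rewrite prodw_cons -mulmxE -mulmxA refl_fix.
rewrite sx in wxd *; have [e sJ] := IH (reduced_tail rs) wxd.
split => //; rewrite prodw_cons; apply: parabolicM => //.
by apply: parabolic_refl; rewrite inE -[x]e xi.
Qed.

(** The first letter of a nonempty reduced word would have its simple root
    mapped to a negative one. *)
Lemma weyl_sroot_inj w : weyl D w -> (forall i, al i *m w = al i) -> w = 1.
Proof.
move=> /parabolicT/ex_reduced[[|i s] rs ->] e; first by rewrite prodw_nil.
have := e i; rewrite prodw_cons -mulmxE mulmxA refl_sroot mulNmx.
have [c c0 ->] := reduced_pos rs.
rewrite [RHS]sroot_delta => /esym /(sroot_indep_opp c0) /(_ i).
by rewrite eqxx ler10.
Qed.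
End RootDatum.

(** * The fundamental cell as a set of inequalities *)

Section Convexity.
Context {R : realType} {V : lmodType R}.

Lemma convex_setP (K : set V) : @convex_set R V K <->
  forall x y (t : R), 0 <= t -> t <= 1 -> K x -> K y ->
    K (t *: x + (1 - t) *: y).
Proof.
split=> [cK x y t t0 t1 Kx Ky|cK x y t].
  have := cK x y (Itv01 t0 t1); rewrite !inE; exact.
rewrite !inE => Kx Ky; exact: cK.
Qed.

Lemma convex_mean (K : set V) (T : Type) (f : T -> V) (x : T) (s : seq T) :
  @convex_set R V K -> (forall y, K (f y)) ->
  K ((size s).+1%:R^-1 *: \sum_(y <- x :: s) f y).
Proof.
move=> /convex_setP cK Kf; elim: s x => [|y s IH] x.
  by rewrite big_seq1 invr1 scale1r; exact: Kf.
rewrite big_cons /=.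
have n0 : ((size s).+2%:R : R) != 0 by rewrite pnatr_eq0.
have n1 : ((size s).+1%:R : R) != 0 by rewrite pnatr_eq0.
have -> : (size s).+2%:R^-1 *: (f x + \sum_(j <- y :: s) f j) =
    (size s).+2%:R^-1 *: f x + (1 - (size s).+2%:R^-1) *:
      ((size s).+1%:R^-1 *: \sum_(j <- y :: s) f j).
  rewrite scalerDr scalerA; congr (_ + _ *: _).
  have gen (a b : R) : a != 0 -> b != 0 -> b = a + 1 -> b^-1 = (1 - b^-1) / a.
    by move=> a0 + e; rewrite e => b0; field; rewrite a0 b0.
  by apply: gen => //; rewrite -natr1.
apply: cK; rewrite ?invr_ge0 ?ler0n ?invf_le1 ?ltr0n ?ler1n //; exact: IH.
Qed.

End Convexity.

Lemma seq_max (R : realType) (T : eqType) (f : T -> R) (s : seq T) x :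
  x \in s -> exists2 y, y \in s & forall z, z \in s -> f z <= f y.
Proof.
elim: s x => // x s IH _ _; case: s IH => [|y s] IH.
  by exists x; rewrite ?mem_head // => z; rewrite inE => /eqP ->.
have [m ms mmax] := IH y (mem_head _ _).
have [xm|mx] := leP (f x) (f m).
  exists m; first by rewrite inE ms orbT.
  by move=> z; rewrite inE => /predU1P[->//|]; exact: mmax.
exists x; first exact: mem_head.
move=> z; rewrite inE => /predU1P[->//|/mmax zm].
exact: le_trans zm (ltW mx).
Qed.

Section Cell.
Context {R : realType} {l : nat} {I : finType} {D : tomei_data R l I}.
Variable H : root_datum D.

Local Notation al := (sroot D).
Local Notation h := (scoroot D).
Local Notation om := (fweight D).
Implicit Types (i j k : I) (x y z : 'cV[R]_l) (w v u : 'M[R]_l).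
Implicit Types (J : {set I}) (K : set 'cV[R]_l).

(** An element of the Weyl group is determined by the images of the simple
    roots, which are roots. *)
Lemma finite_weyl : finite_set (weyl D).
Proof.
pose T := {ffun I -> seq_sub (roots H)}.
pose inv (g : T) : 'M[R]_l :=
  xget 1 [set w | weyl D w /\ forall i, al i *m w = val (g i)].
apply: (@sub_finite_set _ _ (inv @` [set: T])); last first.
  apply: finite_image; exact: finite_finset.
move=> w Ww; have [s ws] := iffLR (weylP w) Ww.
have Hr i : al i *m w \in roots H.
  by rewrite ws; apply: roots_prodw; exact: sroot_roots.
pose g : T := [ffun i => SeqSub (Hr i)].
exists g => //; rewrite /inv; case: xgetP => [w' _ [Ww' e]|/(_ w)[]]; last first.
  by split => // i; rewrite ffunE.
have uw := weyl_unit H Ww.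
have w1 : w' * invmx w = 1.
  apply: (weyl_sroot_inj H); first by apply: weylM => //; apply: (weylV H).
  by move=> i; rewrite -mulmxE mulmxA e ffunE /= -mulmxA mulmxV ?mulmx1.
by rewrite -[LHS]mulmx1 -(mulVmx uw) mulmxA [X in X *m _]w1 mul1mx.
Qed.

Lemma parabolic_enum J : exists2 ws : seq 'M[R]_l, uniq ws &
  forall w, w \in ws <-> parabolic D J w.
Proof.
have /finite_seqP[ws e] : finite_set (parabolic D J).
  apply: sub_finite_set finite_weyl; exact: parabolic_weyl.
exists (undup ws); first exact: undup_uniq.
by move=> w; rewrite mem_undup e.
Qed.

(** Membership in the span of the coroots, which can be proper for a Levi factor;
    the fundamental weights then give the coordinates. *)
Definition hspan z := z = \sum_k pairing (om k) z *: h k.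

Lemma hspan0 : hspan 0.
Proof. by rewrite /hspan big1 // => k _; rewrite pairing0r scale0r. Qed.

Lemma hspanD x y : hspan x -> hspan y -> hspan (x + y).
Proof.
rewrite /hspan => ex ey; under eq_bigr do rewrite pairingDr scalerDl.
by rewrite big_split /= -ex -ey.
Qed.

Lemma hspanZ c x : hspan x -> hspan (c *: x).
Proof.
rewrite /hspan => ex; under eq_bigr do rewrite pairingZr -scalerA.
by rewrite -scaler_sumr -ex.
Qed.

Lemma hspan_comb (c : I -> R) : hspan (\sum_k c k *: h k).
Proof. by rewrite /hspan; apply: eq_bigr => k _; rewrite (fweight_comb H). Qed.

Lemma hspan_coroot i : hspan (h i).
Proof.
have -> : h i = \sum_k (k == i)%:R *: h k; last exact: hspan_comb.
by rewrite (bigD1 i) //= eqxx scale1r big1 ?addr0 // => k /negPf ->; rewrite scale0r.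
Qed.

Lemma hspanB x y : hspan x -> hspan y -> hspan (x - y).
Proof. by move=> hx hy; rewrite -scaleN1r; apply: hspanD => //; apply: hspanZ. Qed.

Lemma hspan_sum (T : eqType) (s : seq T) (f : T -> 'cV[R]_l) :
  (forall t, t \in s -> hspan (f t)) -> hspan (\sum_(t <- s) f t).
Proof.
move=> hf; rewrite big_seq; elim/big_rec: _ => [|t x ts hx]; first exact: hspan0.
by apply: hspanD => //; exact: hf.
Qed.

Lemma hspan_weyl w x : weyl D w -> hspan (x - w *m x).
Proof.
move=> /weylP[s ->]; elim: s => [|i s IH].
  by rewrite prodw_nil mul1mx subrr; exact: hspan0.
rewrite prodw_cons -mulmxE -mulmxA refl_mulr opprB addrCA addrC.
by apply: hspanD => //; apply: hspanZ; exact: hspan_coroot.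
Qed.

Lemma parabolic_fweightE J w x k : parabolic D J w -> k \notin J ->
  pairing (om k) (w *m x) = pairing (om k) x.
Proof. by move=> wJ kJ; rewrite pairing_mul (parabolic_fweight H wJ). Qed.

(** The mean over the orbit of a parabolic subgroup is invariant under its
    simple reflections, so it lies on their walls. *)
Lemma parabolic_mean J K x : @convex_set R 'cV[R]_l K ->
  (forall w, parabolic D J w -> K (w *m x)) ->
  exists v : 'cV[R]_l, [/\ K v, forall i, i \in J -> pairing (al i) v = 0,
    hspan (x - v) & forall k, k \notin J -> pairing (om k) (x - v) = 0].
Proof.
move=> cK Kx; have [ws uws wsP] := parabolic_enum J.
have ws1 : 1 \in ws by apply/wsP; exact: parabolic1.
have [w0 [t ews]] : exists w0 t, ws = w0 :: t.
  by case: (ws) ws1 => // w0 t _; exists w0, t.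
pose n : R := (size ws)%:R; have n0 : n != 0 by rewrite /n ews pnatr_eq0.
pose v := n^-1 *: \sum_(w <- ws) w *m x.
have xv : x - v = n^-1 *: \sum_(w <- ws) (x - w *m x).
  rewrite sumrB big_const_seq count_predT iter_addr_0 scalerBr -scaler_nat.
  by rewrite scalerA mulVf // scale1r.
exists v; split.
- rewrite /v /n ews /=.
  pose f w := if w \in ws then w *m x else x.
  have -> : \sum_(w <- w0 :: t) w *m x = \sum_(w <- w0 :: t) f w.
    by rewrite -ews; apply: eq_big_seq => w; rewrite /f => ->.
  apply: convex_mean => // w; rewrite /f; case: ifP => [/wsP|_]; first exact: Kx.
  by rewrite -[x]mul1mx; apply: Kx; exact: parabolic1.
- move=> i iJ; have vi : refl D i *m v = v.
    rewrite /v -scalemxAr; congr (_ *: _).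
    have -> : refl D i *m (\sum_(w <- ws) w *m x) =
        \sum_(w <- [seq refl D i * w | w <- ws]) w *m x.
      by rewrite big_map mulmx_sumr; apply: eq_bigr => w _; rewrite mulmxA.
    apply: perm_big; apply: uniq_perm => //.
      by rewrite map_inj_uniq // => w1 w2 /(congr1 ( *%R (refl D i))); rewrite !mulrA !(reflK H) !mul1r.
    move=> w; apply/mapP/idP => [[w1 /wsP w1J ->]|/wsP wJ].
      by apply/wsP; apply: parabolicM => //; exact: parabolic_refl.
    exists (refl D i * w); last by rewrite mulrA (reflK H) mul1r.
    by apply/wsP; apply: parabolicM => //; exact: parabolic_refl.
  have : pairing (al i) (refl D i *m v) = pairing (al i) v by rewrite vi.
  rewrite pairing_mul (refl_sroot H) pairingNl => /eqP.
  by rewrite eq_sym -addr_eq0 -mulr2n mulrn_eq0 => /eqP.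
- rewrite xv; apply: hspanZ; apply: hspan_sum => w /wsP wJ.
  exact/hspan_weyl/(parabolic_weyl wJ).
- move=> k kJ; rewrite xv pairingZr pairing_sumr big_seq big1 ?mulr0 // => w /wsP wJ.
  by rewrite pairingBr (parabolic_fweightE _ wJ) // subrr.
Qed.

(** Every orbit of a parabolic subgroup meets the dominant cone: reflecting a
    vector in a root on which it is negative increases the sum of its
    fundamental weights, which is bounded on the finite orbit. *)
Lemma ex_dominantJ J x : exists2 v, parabolic D J v & dominantJ (D := D) J (v *m x).
Proof.
have [ws uws wsP] := parabolic_enum J.
have /wsP ws1 : parabolic D J 1 := parabolic1 J.
have [v /wsP vJ vmax] := seq_max (fun w => pairing (\sum_k om k) (w *m x)) ws1.
exists v => // i iJ; rewrite leNgt; apply/negP => neg.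
have /wsP/vmax : parabolic D J (refl D i * v).
  by apply: parabolicM => //; exact: parabolic_refl.
rewrite -mulmxE -mulmxA refl_mulr pairingBr pairingZr.
have -> : pairing (\sum_k om k) (h i) = 1.
  rewrite pairing_suml (bigD1 i) //= (fweight_coroot H) eqxx big1 ?addr0 // => k ki.
  by rewrite (fweight_coroot H) (negPf ki).
by rewrite mulr1 gerBl leNgt neg.
Qed.

Lemma coroot_comb_eq0 (q : I -> R) J :
  (forall k, k \notin J -> q k = 0) -> (forall k, q k <= 0) ->
  dominantJ (D := D) J (\sum_k q k *: h k) -> \sum_k q k *: h k = 0.
Proof.
move=> qJ q0 dJ; apply: (comb_eq0 H) => k.
have [kJ|/qJ ->] := boolP (k \in J); last by rewrite mul0r.
by rewrite mulr_le0_ge0 // dJ.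
Qed.

(** By induction on the parabolic subgroup: a point below the top vertex lies
    on the segment from the mean of the orbit, through the point, to the
    place where one more coordinate vanishes. *)
Lemma parabolic_hull J K x (c : I -> R) z : @convex_set R 'cV[R]_l K ->
  (forall w, parabolic D J w -> K (w *m x)) ->
  (forall k, 0 <= c k) -> (forall k, k \notin J -> c k = 0) ->
  z = x - \sum_k c k *: h k -> dominantJ (D := D) J z -> K z.
Proof.
move=> cK; have [n] := ubnP #|J|; elim: n J c z => // n IH J c z Jn Kx c0 cJ ez dz.
have [v [Kv vJ /esym xv omv]] := parabolic_mean cK Kx.
pose p k := pairing (om k) (x - v).
pose q k := p k - c k.
have ezv : z = v + \sum_k q k *: h k.
  under eq_bigr do rewrite scalerBl; rewrite sumrB xv ez.
  by rewrite addrA [v + _]addrC subrK.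
have qJ k : k \notin J -> q k = 0 by move=> kJ; rewrite /q /p omv // cJ // subr0.
have [q0|] := pselect (forall k, q k <= 0).
  suff q00 : \sum_k q k *: h k = 0 by rewrite ezv q00 addr0.
  apply: coroot_comb_eq0 qJ q0 _ => i iJ.
  by have := dz i iJ; rewrite ezv pairingDr vJ // add0r.
move=> /existsNP[i0 /negP]; rewrite -ltNge => qi0.
have [|i qi imin] := @seq_max R I (fun k => - (p k / q k)) [seq k <- enum I | 0 < q k] i0.
  by rewrite mem_filter qi0 mem_enum.
move: qi; rewrite mem_filter => /andP[qi _].
have {}imin k : 0 < q k -> p i / q i <= p k / q k.
  by move=> qk; rewrite -lerN2 imin // mem_filter qk mem_enum.
(* The point z is the value at s = 1 of v + s q, where q stands for the
   combination of coroots; t is the largest s at which this point is still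
   below x, and there the coordinate i vanishes. *)
pose t := p i / q i.
have t1 : 1 <= t by rewrite ler_pdivlMr // mul1r /q gerBl.
have t0 : 0 < t by exact: lt_le_trans ltr01 t1.
have iJ : i \in J by apply: contraTT qi => /qJ ->; rewrite ltxx.
have Kt : K (v + t *: \sum_k q k *: h k).
  apply: (IH (J :\ i)%SET (fun k => p k - t * q k)).
  - by move: Jn; rewrite (cardsD1 i) iJ ltnS.
  - by move=> w /(parabolicS (subD1set J i)); exact: Kx.
  - move=> k; rewrite subr_ge0; have [qk|qk] := ltP 0 (q k).
      by rewrite -ler_pdivlMr // imin.
    apply: (@le_trans _ _ (q k)); last by rewrite /q gerBl.
    by rewrite -[leRHS]mul1r ler_wnM2r.
  - move=> k; rewrite in_setD1 negb_and negbK => /predU1P[->|kJ].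
      by rewrite /t divfK ?gt_eqF // subrr.
    by rewrite /p omv // qJ // mulr0 subr0.
  - under [in RHS]eq_bigr do rewrite scalerBl -scalerA.
    by rewrite sumrB -scaler_sumr xv; apply/colP => m; rewrite !mxE; ring.
  - move=> k; rewrite in_setD1 => /andP[_ kJ].
    have := dz k kJ; rewrite ezv !pairingDr pairingZr vJ // !add0r => dk.
    by rewrite mulr_ge0 // ltW.
move/convex_setP : cK => cK.
have -> : z = t^-1 *: (v + t *: \sum_k q k *: h k) + (1 - t^-1) *: v.
  rewrite scalerDr scalerA mulVf ?gt_eqF // scale1r scalerBl scale1r.
  by rewrite addrC addrA subrK ezv.
apply: cK => //; first by rewrite invr_ge0 ltW.
by rewrite invf_le1.
Qed.

(** The inequalities hold on the convex hull because a dominant vector is the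
    highest one of its orbit; conversely they place a dominant vector in the
    hull. In these terms the cell is cut out by two families of inequalities,
    one for the internal and one for the external walls. *)
Lemma cell0P xo z : dominant D xo -> cell0 D xo z <->
  [/\ dominant D z, hspan (xo - z) & forall k, 0 <= pairing (om k) (xo - z)].
Proof.
move=> dxo; split=> [[pz dz]|[dz hz oz]]; last first.
  split=> // K [cK Ko].
  apply: (parabolic_hull (J := [set: I]%SET) (x := xo)
    (c := fun k => pairing (om k) (xo - z)) cK) => //.
  - by move=> w /parabolic_weyl Ww; apply: Ko; exists w.
  - by move=> k; rewrite finset.in_setT.
  - by rewrite -hz opprB addrC subrK.
suff : [set z | hspan (xo - z) /\ forall k, 0 <= pairing (om k) (xo - z)] z by case.
move: pz; apply: smallest_sub.
  apply/convex_setP => x y t t0 t1 /= [hx ox] [hy oy].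
  have -> : xo - (t *: x + (1 - t) *: y) = t *: (xo - x) + (1 - t) *: (xo - y).
    by rewrite !scalerBr !scalerBl !scale1r; apply/colP => i; rewrite !mxE; ring.
  split; first by apply: hspanD; apply: hspanZ.
  move=> k; rewrite pairingDr !pairingZr addr_ge0 // mulr_ge0 //.
  by rewrite subr_ge0.
move=> _ [w Ww <-]; split; first exact: hspan_weyl.
move=> k; apply: (parabolic_dominant_ge H (J := [set: I]%SET)).
  exact: parabolicT.
by move=> i _; exact: dxo.
Qed.

End Cell.

(** * The twisted action on signs *)

Section SignAction.
Context {R : realType} {l : nat} {I : finType} {D : tomei_data R l I}.
Variable H : root_datum D.
Implicit Types (e f : @signs I) (i j : I) (w v : 'M[R]_l) (J : {set I}).

Definition sadd e f : @signs I := [ffun j => e j (+) f j].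

Lemma twist_add i e f : twist D i (sadd e f) = sadd (twist D i e) (twist D i f).
Proof.
by apply/ffunP => j; rewrite !ffunE; case: (e i); case: (f i);
  case: (e j); case: (f j); case: (mark D i j).
Qed.

Lemma twist_fix i e : e i = false -> twist D i e = e.
Proof. by move=> e0; apply/ffunP => j; rewrite ffunE e0 addbF. Qed.

Lemma sact_cons i s e :
  sact H (wordprod D (i :: s)) e = twist D i (sact H (wordprod D s) e).
Proof.
rewrite prodw_cons (sactM H) ?sact_refl //; first exact: weyl_refl.
exact: weyl_prodw.
Qed.

Lemma sact_add w e f : weyl D w -> sact H w (sadd e f) = sadd (sact H w e) (sact H w f).
Proof.
move=> /weylP[s ->]; elim: s => [|i s IH]; first by rewrite prodw_nil !sact1.
by rewrite !sact_cons IH twist_add.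
Qed.

Lemma sactK w e : weyl D w -> sact H (invmx w) (sact H w e) = e.
Proof.
move=> Ww; rewrite -(sactM H) //; last exact: (weylV H).
by rewrite -mulmxE mulVmx ?(weyl_unit H) // sact1.
Qed.

(** A product of simple reflections in J only reads the signs in J. *)
Lemma sact_fix J w f : parabolic D J w ->
  (forall i, i \in J -> f i = false) -> sact H w f = f.
Proof.
move=> [s + ->] f0; elim: s => [|i s IH] /=; first by rewrite prodw_nil sact1.
by case/andP=> iJ sJ; rewrite sact_cons IH // twist_fix // f0.
Qed.

(** By linearity over the field with two elements: the difference of the two
    sign vectors vanishes on J, hence is fixed. *)
Lemma sact_off J (K : pred I) w e f : parabolic D J w ->
  (forall j, j \in J -> ~~ K j) ->
  (forall j, ~~ K j -> e j = f j) ->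
  forall j, ~~ K j -> sact H w e j = sact H w f j.
Proof.
move=> wJ JK ef j Kj.
have : sact H w (sadd e f) = sadd e f.
  by apply: sact_fix wJ _ => i iJ; rewrite ffunE ef ?addbb // JK.
rewrite (sact_add _ _ (parabolic_weyl wJ)) => /ffunP /(_ j); rewrite !ffunE.
by rewrite (ef _ Kj) addbb; case: (sact H w e j); case: (sact H w f j).
Qed.

End SignAction.

(** * Continuous and smooth functions *)

Section MatrixContinuity.
Context {R : realType} {T : topologicalType}.
Implicit Types x : T.

Lemma mx_continuous m n (F : T -> 'M[R]_(m, n)) x :
  (forall i j, {for x, continuous (fun y => F y i j)}) ->
  {for x, continuous F}.
Proof.
move=> cF; apply/cvg_ballP => e e0.
near=> y; split=> // i j; move: i j; near: y.
apply: filter_forall => i; apply: filter_forall => j.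
by apply/cvg_ballP : e e0; exact: cF.
Unshelve. all: by end_near. Qed.

Lemma fun_scale_continuous (V : normedModType R) (f : T -> R) (v : V) x :
  {for x, continuous f} -> {for x, continuous (fun y => f y *: v)}.
Proof. by move=> cf; apply: cvgZ => //; exact: cvg_cst. Qed.

Lemma fun_sub_continuous (V : normedModType R) (f g : T -> V) x :
  {for x, continuous f} -> {for x, continuous g} ->
  {for x, continuous (fun y => f y - g y)}.
Proof. by move=> cf cg; exact: cvgB. Qed.

Lemma sum_continuous (I : Type) (s : seq I) (P : pred I) (V : normedModType R)
    (F : I -> T -> V) x :
  (forall i, {for x, continuous (F i)}) ->
  {for x, continuous (fun y => \sum_(i <- s | P i) F i y)}.
Proof.
move=> cF; elim: s => [|i s IH].
  rewrite (_ : (fun _ => _) = cst 0); first exact: cst_continuous.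
  by apply/funext => y; rewrite big_nil.
rewrite (_ : (fun _ => _) = (fun y => if P i then F i y + \sum_(i <- s | P i) F i y
    else \sum_(i <- s | P i) F i y)); last by apply/funext => y; rewrite big_cons.
by case: (P i) => //; apply: continuousD => //; exact: cF.
Qed.

Lemma prod_continuous (I : Type) (s : seq I) (P : pred I) (F : I -> T -> R) x :
  (forall i, {for x, continuous (F i)}) ->
  {for x, continuous (fun y => \prod_(i <- s | P i) F i y)}.
Proof.
move=> cF; elim: s => [|i s IH].
  rewrite (_ : (fun _ => _) = cst 1); first exact: cst_continuous.
  by apply/funext => y; rewrite big_nil.
rewrite (_ : (fun _ => _) = (fun y => if P i then F i y * \prod_(i <- s | P i) F i y
    else \prod_(i <- s | P i) F i y)); last by apply/funext => y; rewrite big_cons.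
by case: (P i) => //; apply: continuousM => //; exact: cF.
Qed.

End MatrixContinuity.

Section SmoothFunctions.
Context {R : realType} {V : normedModType R}.
Implicit Types (O : set V) (f g : V -> R) (k : nat) (x v : V).

Lemma Ck_on_sub (W : normedModType R) k O O' (f : V -> W) :
  O' `<=` O -> Ck_on k O f -> Ck_on k O' f.
Proof.
move=> OO; elim: k f => [|k IH] f /= [cf df]; first by split=> // x /OO; exact: cf.
split=> [x /OO|v]; first exact: cf.
by have [dfv kf] := df v; split=> [x /OO|]; [exact: dfv|exact: IH].
Qed.

(** Differentiability is a pointwise condition, so the sets on which it is
    known need not be open. *)
Lemma Ck_on_local (W : normedModType R) k O (f : V -> W) :
  (forall x, O x -> exists2 B, B x & Ck_on k B f) -> Ck_on k O f.
Proof.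
elim: k f => [|k IH] f loc /=.
  by split=> // x /loc[B Bx [cf _]]; exact: cf.
split=> [x /loc[B Bx [cf _]]|v]; first exact: cf.
split=> [x /loc[B Bx [_ /(_ v)[df _]]]|]; first exact: df.
by apply: IH => x /loc[B Bx [_ /(_ v)[_ kf]]]; exists B.
Qed.

Lemma Ck_on_eq (W : normedModType R) k O (f g : V -> W) : open O ->
  (forall x, O x -> f x = g x) -> Ck_on k O f -> Ck_on k O g.
Proof.
move=> oO; have nO x : O x -> nbhs x O by move=> Ox; exact: open_nbhs_nbhs.
elim: k f g => [|k IH] f g fg /= [cf df].
  split=> // x Ox W' /=; rewrite -fg // => /(cf x Ox) /=.
  by apply: filterS2 (nO x Ox) => y Oy /=; rewrite fg.
have near_fg x : O x -> \near x, f x = g x.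
  by move=> Ox; apply: filterS (nO x Ox) => y; exact: fg.
split=> [x Ox W' /=|v].
  rewrite -fg // => /(cf x Ox) /=.
  by apply: filterS2 (nO x Ox) => y Oy /=; rewrite fg.
have [dfv kf] := df v; split=> [x Ox|].
  by apply: near_eq_derivable (dfv x Ox); exact: near_fg.
by apply: IH kf => x Ox; apply: near_eq_derive; exact: near_fg.
Qed.

Lemma Ck_onW (W : normedModType R) k O (f : V -> W) : Ck_on k.+1 O f -> Ck_on k O f.
Proof.
elim: k f => [|k IH] f; first by case.
move=> [cf df]; split=> // v; have [dfv kf] := df v.
by split=> //; exact: IH.
Qed.

Lemma Ck_on_cst (W : normedModType R) k O (a : W) : Ck_on k O (fun=> a).
Proof.
elim: k a => [|k IH] a /=.
  by split=> // x _; exact: cst_continuous.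
split=> [x _|v]; first exact: cst_continuous.
split=> [x _|]; first exact: derivable_cst.
rewrite (_ : 'D_v _ = fun=> 0) //; apply/funext => x; exact: derive_cst.
Qed.

Lemma Ck_on_add k O f g : open O -> Ck_on k O f -> Ck_on k O g ->
  Ck_on k O (fun x => f x + g x).
Proof.
move=> oO; elim: k f g => [|k IH] f g /= [cf df] [cg dg].
  by split=> // x Ox; apply: continuousD; [exact: cf|exact: cg].
split=> [x Ox|v]; first by apply: continuousD; [exact: cf|exact: cg].
have [dfv kf] := df v; have [dgv kg] := dg v; split=> [x Ox|].
  by apply: derivableD; [exact: dfv|exact: dgv].
apply: (@Ck_on_eq _ _ _ (fun x => 'D_v f x + 'D_v g x)) => // [x Ox|].
  by rewrite -deriveD //; [exact: dfv|exact: dgv].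
exact: IH.
Qed.

Lemma Ck_on_mul k O f g : open O -> Ck_on k O f -> Ck_on k O g ->
  Ck_on k O (fun x => f x * g x).
Proof.
move=> oO; elim: k f g => [|k IH] f g Hf Hg.
  case: Hf Hg => [cf df] [cg dg].
  by split=> // x Ox; apply: continuousM; [exact: cf|exact: cg].
have Hf' := Ck_onW Hf; have Hg' := Ck_onW Hg.
case: Hf Hg => [cf df] [cg dg].
split=> [x Ox|v]; first by apply: continuousM; [exact: cf|exact: cg].
have [dfv kf] := df v; have [dgv kg] := dg v; split=> [x Ox|].
  by apply: derivableM; [exact: dfv|exact: dgv].
apply: (@Ck_on_eq _ _ _ (fun x => f x * 'D_v g x + g x * 'D_v f x)) => // [x Ox|].
  by rewrite -[RHS]/('D_v (f * g) x) deriveM //; [exact: dfv|exact: dgv].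
by apply: Ck_on_add => //; exact: IH.
Qed.

Lemma Ck_on_inv k O f : open O -> (forall x, O x -> f x != 0) ->
  Ck_on k O f -> Ck_on k O (fun x => (f x)^-1).
Proof.
move=> oO f0; elim: k => [|k IH] Hf.
  by case: Hf => [cf _]; split=> // x Ox; apply: cvgV; [exact: f0|exact: cf].
have {}IH := IH (Ck_onW Hf); case: Hf => [cf df].
split=> [x Ox|v]; first by apply: cvgV; [exact: f0|exact: cf].
have [dfv kf] := df v; split=> [x Ox|].
  by apply: derivableV; [exact: f0|exact: dfv].
apply: (@Ck_on_eq _ _ _ (fun x => -1 * ((f x)^-1 * (f x)^-1 * 'D_v f x))) => //.
  move=> x Ox; rewrite deriveV //; [|exact: f0|exact: dfv].
  by rewrite mulN1r scaleNr -exprVn expr2.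
apply: Ck_on_mul => //; first exact: Ck_on_cst.
by apply: Ck_on_mul => //; apply: Ck_on_mul.
Qed.

(** Restriction to a line reduces the chain rule for directional derivatives
    to the one for functions of a real variable. *)
Lemma is_derive_line (f : V -> R) x v (a : R) :
  is_derive x v f a <-> is_derive (0 : R) 1 (fun h : R => f (h *: v + x)) a.
Proof.
have e : (fun h : R => h^-1 *: ((fun h : R => f (h *: v + x)) (h *: 1 + 0) -
    f (0 *: v + x))) = (fun h => h^-1 *: (f (h *: v + x) - f x)).
  by apply/funext => h /=; rewrite addr0 scale0r add0r [h *: 1]mulr1.
split=> -[d da]; constructor.
- by rewrite /derivable /= e.
- by rewrite -da /derive /= e.
- by move: d; rewrite /derivable /= e.
- by rewrite -da /derive /= e.
Qed.

Lemma is_derive_sqrt f x v : 0 < f x -> derivable f x v ->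
  is_derive x v (fun y => Num.sqrt (f y)) ((2 * Num.sqrt (f x))^-1 * 'D_v f x).
Proof.
move=> fx df; apply/is_derive_line.
have /is_derive_line df' : is_derive x v f ('D_v f x) by exact: derivableP.
have fx0 : f (0 *: v + x) = f x by rewrite scale0r add0r.
have ds : is_derive (f (0 *: v + x)) 1 Num.sqrt (2 * Num.sqrt (f x))^-1.
  by rewrite fx0; exact: is_derive1_sqrt.
exact: (is_derive1_comp ds df').
Qed.

(** The derivative of the square root is written with the square root itself,
    so that regularity of order k + 1 follows from that of order k. *)
Lemma Ck_on_sqrt k O f : open O -> (forall x, O x -> 0 < f x) ->
  Ck_on k O f -> Ck_on k O (fun x => Num.sqrt (f x)).
Proof.
move=> oO f0; elim: k => [|k IH] Hf.
  case: Hf => [cf _]; split=> // x Ox.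
  apply: (@continuous_comp _ _ _ f Num.sqrt); [exact: cf|exact: sqrt_continuous].
have Hf' := Ck_onW Hf; have {}IH := IH Hf'; case: Hf => [cf df].
split=> [x Ox|v].
  apply: (@continuous_comp _ _ _ f Num.sqrt); [exact: cf|exact: sqrt_continuous].
have [dfv kf] := df v; split=> [x Ox|].
  by have [] := is_derive_sqrt (f0 x Ox) (dfv x Ox).
apply: (@Ck_on_eq _ _ _
    (fun x => 2^-1 * (Num.sqrt (f x) * (f x)^-1 * 'D_v f x))) => //.
  move=> x Ox; have [_ ->] := is_derive_sqrt (f0 x Ox) (dfv x Ox).
  rewrite mulrA invfM; congr (_ * _); congr (_ * _).
  have s0 : Num.sqrt (f x) != 0 by rewrite gt_eqF // sqrtr_gt0 f0.
  rewrite -{2}(sqr_sqrtr (ltW (f0 x Ox))) expr2 invfM mulrA divff // mul1r.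
  by [].
apply: Ck_on_mul => //; first exact: Ck_on_cst.
apply: Ck_on_mul => //; apply: Ck_on_mul => //.
by apply: Ck_on_inv => // x /f0; exact: lt0r_neq0.
Qed.

Lemma Ck_on_sum k O (I : Type) (s : seq I) (F : I -> V -> R) : open O ->
  (forall i, Ck_on k O (F i)) -> Ck_on k O (fun x => \sum_(i <- s) F i x).
Proof.
move=> oO kF; elim: s => [|i s IH].
  rewrite (_ : (fun _ => _) = fun=> 0); first exact: Ck_on_cst.
  by apply/funext => y; rewrite big_nil.
rewrite (_ : (fun _ => _) = (fun y => F i y + \sum_(i <- s) F i y)).
  exact: Ck_on_add.
by apply/funext => y; rewrite big_cons.
Qed.

Lemma Ck_on_row k n O (F : V -> 'rV[R]_n) : open O ->
  (forall j, Ck_on k O (fun x => F x 0 j)) -> Ck_on k O F.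
Proof.
move=> oO; elim: k F => [|k IH] F kF.
  by split=> // x Ox; apply: mx_continuous => i j; rewrite ord1; case: (kF j) => + _; exact.
split=> [x Ox|v].
  by apply: mx_continuous => i j; rewrite ord1; case: (kF j) => + _; exact.
have dF x : O x -> derivable F x v.
  move=> Ox; apply/derivable_mxP => i j; rewrite ord1.
  by case: (kF j) => _ /(_ v)[+ _]; exact.
split=> //; apply: IH => j.
have [_ /(_ v)[_]] := kF j; apply: Ck_on_eq => // x Ox.
by rewrite derive_mx ?mxE //; exact: dF.
Qed.

End SmoothFunctions.

Lemma Ck_on_coord (R : realType) n k (O : set 'rV[R]_n) (j : 'I_n) :
  Ck_on k O (fun y => y 0 j).
Proof.
have lin (x v : 'rV[R]_n) : is_derive x v (fun y : 'rV[R]_n => y 0 j) (v 0 j).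
  have e : (fun h : R => h^-1 *: ((h *: v + x) 0 j - x 0 j)) @ 0^' --> v 0 j.
    apply: (@cvg_trans _ (cst (v 0 j) @ (0 : R)^')); last exact: cvg_cst.
    apply: near_eq_cvg; near=> h.
    rewrite !mxE addrK [_ *: _]mulrA mulVf ?mul1r //.
    by near: h; exact: nbhs_dnbhs_neq.
  by constructor; [apply/cvg_ex; exists (v 0 j)|apply: cvg_lim].
case: k => [|k]; first by split=> // x _; exact: coord_continuous.
split=> [x _|v]; first exact: coord_continuous.
split=> [x _|]; first by case: (lin x v).
rewrite (_ : 'D_v _ = fun=> v 0 j); first exact: Ck_on_cst.
by apply/funext => x; case: (lin x v).
Unshelve. all: by end_near. Qed.

(** * Quotient maps and charts on quotients *)

Section QuotientMaps.
Context {P M : topologicalType}.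
Implicit Types (pr : P -> M).

Definition quotient_map pr :=
  (forall m, exists p, pr p = m) /\
  (forall U : set M, open U <-> open (pr @^-1` U)).

Lemma quotient_map_continuous pr : quotient_map pr -> continuous pr.
Proof. by move=> [_ prO]; apply/continuousP => A /prO. Qed.

(** A continuous map from a compact space to a Hausdorff space is closed. *)
Lemma compact_quotient_map pr : compact [set: P] -> hausdorff_space M ->
  continuous pr -> (forall m, exists p, pr p = m) -> quotient_map pr.
Proof.
move=> cP hM cpr spr; split=> // U; split=> [|oU].
  by move/continuousP : cpr; apply.
rewrite -(setCK U) openC; apply: compact_closed => //.
have -> : ~` U = pr @` (~` (pr @^-1` U)).
  apply/seteqP; split=> [m nU|_ [p np <-] //].
  by move: nU; have [p <-] := spr m => nU; exists p.
apply: continuous_compact.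
  exact: continuous_subspaceT.
by apply: (subclosed_compact _ cP) => //; exact: open_closedC.
Qed.

End QuotientMaps.

Lemma quotient_homeomorphic (P M N : topologicalType) (f : P -> M) (g : P -> N) :
  quotient_map f -> quotient_map g -> (forall p q, f p = f q <-> g p = g q) ->
  homeomorphic M N.
Proof.
move=> [sf qf] [sg qg] fg.
have [rf rfP] := choice sf; have [rg rgP] := choice sg.
exists (g \o rf), (f \o rg); split.
- apply/continuousP => A oA; apply/qf.
  have -> : f @^-1` ((g \o rf) @^-1` A) = g @^-1` A; last exact/qg.
  apply/seteqP; split=> p /=; have -> // : g (rf (f p)) = g p;
    by apply/fg; rewrite rfP.
- apply/continuousP => A oA; apply/qg.
  have -> : g @^-1` ((f \o rg) @^-1` A) = f @^-1` A; last exact/qf.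
  apply/seteqP; split=> p /=; have -> // : f (rg (g p)) = f p;
    by apply/fg; rewrite rgP.
- by move=> m /=; rewrite -[RHS]rfP; apply/fg; rewrite rgP.
- by move=> n /=; rewrite -[RHS]rgP; apply/fg; rewrite rfP.
Qed.

Section Charts.
Context {P M V : topologicalType} (pr : P -> M) (J : Type).
Context (Dom : J -> set P) (phi : J -> P -> V).
Hypothesis compactP : compact [set: P].
Hypothesis pr_quot : quotient_map pr.
Hypothesis hV : hausdorff_space V.

Definition saturated (S : set P) := forall p q, pr p = pr q -> S p -> S q.

(** Closed, hence compact, saturated sets inside the chart domains whose images
    are neighbourhoods. They make the inverse charts continuous and separate
    the points of the quotient. *)
Definition chart_nbhs := forall j p, Dom j p -> exists K : set P,
  [/\ closed K, K `<=` Dom j, saturated K & nbhs (phi j p) (phi j @` K)].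

Hypothesis dom_cover : forall p, exists j, Dom j p.
Hypothesis dom_open : forall j, open (Dom j).
Hypothesis dom_sat : forall j, saturated (Dom j).
Hypothesis phi_cont : forall j, continuous (phi j).
Hypothesis phi_inj : forall j p q, Dom j p -> Dom j q ->
  (phi j p = phi j q <-> pr p = pr q).
Hypothesis phi_nbhs : chart_nbhs.

Lemma open_quotient (S : set P) : open S -> saturated S -> open (pr @` S).
Proof.
move=> oS sS; apply/(pr_quot.2).
suff -> : pr @^-1` (pr @` S) = S by [].
by apply/seteqP; split=> [p [q Sq /sS]|p Sp]; [exact|exists p].
Qed.

(** Points of one chart are separated in the model space; a point outside the
    chart is separated from a point of it by the complement of the compact
    neighbourhood. *)
Lemma charts_hausdorff : hausdorff_space M.
Proof.
rewrite open_hausdorff => m n /eqP mn.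
have [p pm] := pr_quot.1 m; have [q qn] := pr_quot.1 n.
have [j Djp] := dom_cover p.
suff [A [B [[oA sA Ap] [oB sB Bq] AB]]] : exists A B : set P,
    [/\ [/\ open A, saturated A & A p], [/\ open B, saturated B & B q]
      & forall r, A r -> ~ B r].
  exists (pr @` A, pr @` B); first by split; rewrite inE; [exists p|exists q].
  split; [exact: open_quotient|exact: open_quotient|].
  apply/eqP; rewrite -subset0 => _ [[r Ar <-] [s Bs sr]].
  by case: (AB r Ar); exact: sB sr Bs.
have satI W : saturated (Dom j `&` phi j @^-1` W).
  move=> r s rs [Dr Wr]; have Ds := dom_sat rs Dr; split=> //=.
  by rewrite -((phi_inj Dr Ds).2 rs).
have openI W : open W -> open (Dom j `&` phi j @^-1` W).
  by move=> oW; apply: openI => //; move/continuousP : (@phi_cont j); apply.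
have [Djq|nDq] := pselect (Dom j q).
  have : phi j p != phi j q.
    by apply/eqP => /(phi_inj Djp Djq); rewrite pm qn.
  move: hV; rewrite open_hausdorff => h /h[[A B] /= [Ap Bq] [oA oB /eqP AB]].
  exists (Dom j `&` phi j @^-1` A), (Dom j `&` phi j @^-1` B); split.
  - by split; [exact: openI|exact: satI|split=> //; exact: set_mem].
  - by split; [exact: openI|exact: satI|split=> //; exact: set_mem].
  - move=> r [_ Ar] [_ Br]; have : (A `&` B) (phi j r) by [].
    by rewrite AB.
have [K [cK KD sK nK]] := phi_nbhs Djp.
exists (Dom j `&` phi j @^-1` (phi j @` K)°), (~` K); split.
- split; [apply: openI; exact: open_interior|exact: satI|by split].
- split; [exact: closed_openC| |by move=> /KD].
  by move=> r s rs nr Ks; apply: nr; apply: sK Ks.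
- move=> r [Dr /interior_subset[k Kk kr]]; apply; apply: (sK k) => //.
  by apply/(phi_inj (KD _ Kk) Dr).
Qed.

Section Inverse.
Variables (rep : M -> P) (m0 : M).
Hypothesis repK : forall m, pr (rep m) = m.

Definition chart_dom j := pr @` Dom j.
Definition chart j (m : M) : V := phi j (rep m).
Definition chart_inv j (y : V) : M :=
  xget m0 [set m | chart_dom j m /\ chart j m = y].

Lemma dom_rep j p : Dom j p -> Dom j (rep (pr p)).
Proof. by move=> Dp; apply: dom_sat Dp; rewrite repK. Qed.

Lemma chart_pr j p : Dom j p -> chart j (pr p) = phi j p.
Proof.
by move=> Dp; apply/(phi_inj (dom_rep Dp) Dp); rewrite repK.
Qed.

Lemma chart_image j : chart j @` chart_dom j = phi j @` Dom j.
Proof.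
apply/seteqP; split=> [_ [_ [p Dp <-] <-]|_ [p Dp <-]].
  by exists p => //; rewrite chart_pr.
by exists (pr p); [exists p|rewrite chart_pr].
Qed.

Lemma chart_inv_phi j p : Dom j p -> chart_inv j (phi j p) = pr p.
Proof.
move=> Dp; rewrite /chart_inv; case: xgetP => [_ -> [[q Dq <-]]|/(_ (pr p))[]].
  by rewrite chart_pr // => /(phi_inj Dq Dp).
by split; [exists p|rewrite chart_pr].
Qed.

Lemma phi_dom_open j : open (phi j @` Dom j).
Proof.
rewrite openE => _ [p Dp <-]; have [K [_ KD _ nK]] := phi_nbhs Dp.
by apply: filterS nK; exact: image_subset.
Qed.

Lemma chart_continuous j m : chart_dom j m -> {for m, continuous (chart j)}.
Proof.
move=> [p Dp <-] W /=; rewrite chart_pr // nbhsE => -[B [oB Bp] BW].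
have oD : open (Dom j `&` phi j @^-1` B).
  by apply: openI => //; move/continuousP : (@phi_cont j); apply.
have sD : saturated (Dom j `&` phi j @^-1` B).
  move=> r s rs [Dr Wr]; have Ds := dom_sat rs Dr; split=> //=.
  by rewrite -((phi_inj Dr Ds).2 rs).
rewrite /= nbhsE; exists (pr @` (Dom j `&` phi j @^-1` B)).
  by split; [exact: open_quotient|exists p].
by move=> _ [q [Dq Bq] <-] /=; rewrite chart_pr //; exact: BW.
Qed.

(** The image of the part of the compact neighbourhood that lies outside a
    given open set is closed. *)
Lemma chart_inv_continuous j y : (phi j @` Dom j) y ->
  {for y, continuous (chart_inv j)}.
Proof.
move=> [p Dp <-] W /=; rewrite chart_inv_phi // nbhsE => -[B [oB Bp] BW].
have [K [cK KD sK nK]] := phi_nbhs Dp.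
have cC : closed (phi j @` (K `&` ~` (pr @^-1` B))).
  apply: compact_closed => //; apply: continuous_compact.
    exact: continuous_subspaceT.
  apply: (subclosed_compact _ compactP) => //; apply: closedI => //.
  by apply: open_closedC; apply/(pr_quot.2).
have : nbhs (phi j p) (~` (phi j @` (K `&` ~` (pr @^-1` B)))).
  apply: open_nbhs_nbhs; split; first exact: closed_openC.
  by move=> [q [Kq nBq]] /(phi_inj (KD _ Kq) Dp) e; apply: nBq; rewrite /= e.
apply: filterS2 nK => _ [k Kk <-] nC; apply: BW.
rewrite chart_inv_phi; last exact: KD.
by apply: contrapT => nB; apply: nC; exists k.
Qed.

Lemma phi_image_open j (S : set P) : open S -> saturated S -> S `<=` Dom j ->
  open (phi j @` S).
Proof.
move=> oS sS SD; rewrite openE => _ [p Sp <-].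
have : nbhs (phi j p) (chart_inv j @^-1` (pr @` S)).
  apply: chart_inv_continuous; first by exists p => //; exact: SD.
  rewrite chart_inv_phi; last exact: SD.
  apply: open_nbhs_nbhs; split; [exact: open_quotient|by exists p].
have : nbhs (phi j p) (phi j @` Dom j).
  by apply: open_nbhs_nbhs; split; [exact: phi_dom_open|exists p => //; exact: SD].
apply: filterS2 => _ [q Dq <-]; rewrite /= chart_inv_phi // => -[s Ss sq].
by exists s => //; apply/(phi_inj (SD _ Ss) Dq).
Qed.

Lemma charts_second_countable : countable [set: J] -> @second_countable V ->
  @second_countable M.
Proof.
move=> cJ [B cB [oB bB]].
pose nb (jb : J * set V) := pr @` (Dom jb.1 `&` phi jb.1 @^-1` jb.2).
have satI j W : saturated (Dom j `&` phi j @^-1` W).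
  move=> r s rs [Dr Wr]; have Ds := dom_sat rs Dr; split=> //=.
  by rewrite -((phi_inj Dr Ds).2 rs).
exists (nb @` ([set: J] `*` B)).
  apply: sub_countable (card_image_le _ _) _; exact: countableX.
split=> [_ [[j b] [_ Bb] <-]|m].
  apply: open_quotient; last exact: satI.
  apply: openI; first exact: dom_open.
  by move/continuousP : (@phi_cont j); apply; exact: oB.
have [p <-] := pr_quot.1 m; have [j Dp] := dom_cover p.
move=> N nN; have /= : nbhs (phi j p) (phi j @` Dom j `&` chart_inv j @^-1` N).
  apply: filterI.
    by apply: open_nbhs_nbhs; split; [exact: phi_dom_open|exists p].
  apply: chart_inv_continuous; first by exists p.
  by rewrite chart_inv_phi.
move=> /bB[b [Bb bp] bN]; exists (nb (j, b)) => /=.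
  by split; [exists (j, b)|exists p].
by move=> _ [q [Dq bq] <-]; have [_] := bN _ bq; rewrite /= chart_inv_phi.
Qed.

End Inverse.
End Charts.

Lemma second_countable_row (R : realType) d : @second_countable 'rV[R]_d.
Proof.
pose c (q : 'rV[rat]_d) : 'rV[R]_d := \row_j ratr (q 0 j).
pose b (qn : 'rV[rat]_d * nat) : set 'rV[R]_d := ball (c qn.1) (qn.2.+1%:R^-1).
exists (b @` setT).
  apply: sub_countable (card_image_le _ _) _; exact: countableP.
split=> [_ [qn _ <-]|x N /nbhs_ballP[e /= e0 eN]].
  exact: ball_open.
have [n ne] : exists n : nat, n.+1%:R^-1 < e / 2.
  exists (Num.truncn (2 / e)).
  rewrite invf_plt ?posrE ?divr_gt0 // invf_div; exact: truncnS_gt.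
have n0 : 0 < n.+1%:R^-1 :> R by rewrite invr_gt0.
have xq (j : 'I_d) : exists q : rat, `|x 0 j - ratr q| < n.+1%:R^-1.
  have : x 0 j - n.+1%:R^-1 < x 0 j + n.+1%:R^-1.
    by rewrite ltrD2l gt0_cp.
  move=> /rat_in_itvoo[q]; rewrite in_itv /= => /andP[q1 q2].
  exists q; rewrite ltr_norml; apply/andP; split.
    by rewrite ltrNl opprB ltrBlDl.
  by rewrite ltrBlDl -ltrBlDr.
have [q qx] := choice xq.
have bx : b (\row_j q j, n) x.
  split=> // i j; rewrite ord1 !mxE /ball /= distrC; exact: qx.
exists (b (\row_j q j, n)); first by split => //; exists (\row_j q j, n).
move=> y qy; apply: eN; apply: (@ball_splitr _ _ (c (\row_j q j))).
  exact: le_ball (ltW ne) _ bx.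
exact: le_ball (ltW ne) _ qy.
Qed.

Section ManifoldFromCharts.
Context {R : realType} {d : nat} {P M : topologicalType} (pr : P -> M).
Context (J : Type) (Dom : J -> set P) (phi : J -> P -> 'rV[R]_d).

(** Only local formulas for the coordinate changes are required, because the
    sign vectors that enter them are only locally constant. *)
Definition smooth_transitions := forall j k p, Dom j p -> Dom k p ->
  exists (S : set P) (F : 'rV[R]_d -> 'rV[R]_d),
  [/\ open S, saturated pr S, S p, S `<=` Dom j `&` Dom k
    & smooth_on (phi j @` S) F /\ forall q, S q -> phi k q = F (phi j q)].

Lemma charts_smooth_manifold (p0 : P) :
  compact [set: P] -> quotient_map pr ->
  (forall p, exists j, Dom j p) -> (forall j, open (Dom j)) ->
  (forall j, saturated pr (Dom j)) -> (forall j, continuous (phi j)) ->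
  (forall j p q, Dom j p -> Dom j q -> (phi j p = phi j q <-> pr p = pr q)) ->
  chart_nbhs pr Dom phi -> smooth_transitions -> countable [set: J] ->
  smooth_manifold R d M.
Proof.
move=> cP qpr cov oD sD cphi iphi nphi tr cJ.
have hV : hausdorff_space 'rV[R]_d by exact: norm_hausdorff.
have [rep repK] := choice qpr.1.
pose m0 := pr p0.
split.
- exact: (charts_hausdorff qpr hV cov oD sD cphi iphi nphi).
- apply: (charts_second_countable cP qpr hV cov oD sD cphi iphi nphi m0 repK cJ).
  exact: second_countable_row.
exists J, (chart_dom pr Dom), (chart phi rep), (chart_inv pr Dom phi rep m0).
have pdo := phi_dom_open nphi.
have cp := chart_pr sD iphi repK.
have cip := chart_inv_phi sD iphi m0 repK.
have cim := chart_image sD iphi repK.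
split.
- apply/seteqP; split=> // m _; have [p <-] := qpr.1 m.
  by have [j Dp] := cov p; exists j => //; exists p.
- move=> j; split; first exact: open_quotient.
  by rewrite cim; exact: pdo.
- by move=> j m [p Dp <-]; rewrite cp // cip.
- move=> j; split.
    rewrite continuous_open_subspace; last exact: open_quotient.
    move=> m; rewrite inE => mD.
    exact: (chart_continuous qpr oD sD cphi iphi repK).
  rewrite cim continuous_open_subspace; last exact: pdo.
  move=> y; rewrite inE => yD.
  exact: (chart_inv_continuous cP qpr hV sD cphi iphi nphi repK yD).
move=> j k n; apply: Ck_on_local => _ [m [[p Dp <-] [q Dq qp]] <-].
have Dkp : Dom k p by apply: sD Dq.
have [S [F [oS sS Sp SD [kF eF]]]] := tr j k p Dp Dkp.
have SDj : S `<=` Dom j by move=> r /SD[].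
exists (phi j @` S); first by rewrite cp //; exists p.
apply: (@Ck_on_eq _ _ _ _ _ F _ _ _ (kF n)).
  exact: (phi_image_open cP qpr hV sD cphi iphi nphi m0 repK).
move=> _ [r Sr <-] /=; have [Dj Dk] := SD _ Sr.
by rewrite -eF // cip // cp.
Qed.

End ManifoldFromCharts.

(** * The gluing relation in closed form *)

Section Pieces.
Context {R : realType} {l : nat} {I : finType} {D : tomei_data R l I}.
Variable H : root_datum D.
Context {xo : 'cV[R]_l}.
Hypothesis xo_reg : regular_dominant D xo.

Local Notation al := (sroot D).
Local Notation h := (scoroot D).
Local Notation om := (fweight D).
Local Notation piece := (pieces D xo).
Implicit Types (i j k : I) (x y z : 'cV[R]_l) (w v u : 'M[R]_l).
Implicit Types (e f : @signs I) (p q r : piece) (J : {set I}).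

(** The point of the fundamental cell of which a point of a piece is the
    translate. *)
Definition local_pt p := invmx (piece_weyl p) *m piece_pt p.

Lemma xo_dominant : dominant D xo.
Proof. by move=> i; exact/ltW/xo_reg. Qed.

Lemma piece_weylP p : weyl D (piece_weyl p).
Proof. exact: set_valP. Qed.

Lemma piece_ptE p : piece_pt p = piece_weyl p *m local_pt p.
Proof. by rewrite /local_pt mulKVmx // (weyl_unit H (piece_weylP p)). Qed.

Lemma local_cell p : cell0 D xo (local_pt p).
Proof.
have [z cz zE] : cell D xo (piece_weyl p) (piece_pt p) by exact: set_valP.
by rewrite /local_pt -zE mulKmx // (weyl_unit H (piece_weylP p)).
Qed.

Lemma local_dominant p : dominant D (local_pt p).
Proof. by have /(cell0P H _ xo_dominant)[] := local_cell p. Qed.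

Lemma local_hspan p : hspan (D := D) (xo - local_pt p).
Proof. by have /(cell0P H _ xo_dominant)[] := local_cell p. Qed.

Lemma local_fweight p i : 0 <= pairing (om i) (xo - local_pt p).
Proof. by have /(cell0P H _ xo_dominant)[] := local_cell p. Qed.

Lemma ex_piece e w z : weyl D w -> cell0 D xo z -> exists p : piece,
  [/\ piece_sign p = e, piece_weyl p = w, piece_pt p = w *m z
    & local_pt p = z].
Proof.
move=> Ww cz; have cw : cell D xo w (w *m z) by exists z.
pose sw : set_type (weyl D) := exist _ w (mem_set Ww).
pose sp : set_type (cell D xo (val sw)) := exist _ (w *m z) (mem_set cw).
exists (existT _ (e, sw) sp); split => //.
by rewrite /local_pt /piece_weyl /piece_pt /= mulKmx // (weyl_unit H Ww).
Qed.

Lemma piece_eq p q : piece_sign p = piece_sign q ->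
  piece_weyl p = piece_weyl q -> piece_pt p = piece_pt q -> p = q.
Proof.
case: p q => [[e w] x] [[e' w'] x']; rewrite /piece_sign /piece_weyl /piece_pt /=.
move=> <- /val_inj ww; move: x'; rewrite -ww => x' /val_inj <-; by [].
Qed.

Lemma wall_inE p i : wall_in D xo i (piece_weyl p) (piece_pt p) <->
  pairing (al i) (local_pt p) = 0.
Proof.
split=> [[z [cz z0] zE]|p0].
  by rewrite /local_pt -zE mulKmx // (weyl_unit H (piece_weylP p)).
exists (local_pt p); last by rewrite -piece_ptE.
by split => //; exact: local_cell.
Qed.

Lemma wall_outE p i : wall_out D xo i (piece_weyl p) (piece_pt p) <->
  pairing (om i) (xo - local_pt p) = 0.
Proof.
split=> [[z [cz /= z0] zE]|].
  rewrite /local_pt -zE mulKmx; last exact: (weyl_unit H (piece_weylP p)).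
  by rewrite pairingBr z0 subrr.
rewrite pairingBr => /eqP; rewrite subr_eq0 => /eqP p0.
exists (local_pt p); last by rewrite -piece_ptE.
by split => //; exact: local_cell.
Qed.

(** If the coordinate of index i vanishes, the other coordinates can only
    raise the value of the simple root i above its value at xo. So opposite
    facets of the cell are disjoint: it is a combinatorial cube. *)
Lemma cell_facet z i : cell0 D xo z -> pairing (om i) (xo - z) = 0 ->
  0 < pairing (al i) z.
Proof.
move=> /(cell0P H _ xo_dominant)[dz hz oz] zi.
have -> : z = xo - (xo - z) by rewrite opprB addrC subrK.
rewrite [X in xo - X]hz pairingBr pairing_sumr subr_gt0.
apply: le_lt_trans (xo_reg i); apply: sumr_le0 => k _; rewrite pairingZr.
have [->|ki] := eqVneq k i; first by rewrite zi mul0r.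
by rewrite mulr_ge0_le0 // (cartan_le0 H) // eq_sym.
Qed.

(** The local points are dominant and in the same orbit. *)
Lemma same_pt p q : piece_pt p = piece_pt q ->
  local_pt p = local_pt q /\
  parabolic D [set i | pairing (al i) (local_pt p) == 0]%SET
    (invmx (piece_weyl q) * piece_weyl p).
Proof.
move=> Epq; have Wp := piece_weylP p; have Wq := piece_weylP q.
have E : (invmx (piece_weyl q) * piece_weyl p) *m local_pt p = local_pt q.
  by rewrite -mulmxE -mulmxA -piece_ptE Epq.
have W : weyl D (invmx (piece_weyl q) * piece_weyl p).
  by apply: weylM => //; exact: (weylV H).
have := dominant_stab H W (local_dominant p).
rewrite E => /(_ (local_dominant q))[e par]; split => //.
Qed.

Lemma weyl_mulV w : weyl D w -> w * invmx w = 1.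
Proof. by move=> Ww; rewrite -mulmxE mulmxV // (weyl_unit H Ww). Qed.

Lemma weyl_Vmul w : weyl D w -> invmx w * w = 1.
Proof. by move=> Ww; rewrite -mulmxE mulVmx // (weyl_unit H Ww). Qed.

(** The closed form of the relation generated by the gluing: a sign is
    forgotten on the external wall of its index, and otherwise transported by
    the Weyl group element that relates the two pieces. *)
Definition glued p q := piece_pt p = piece_pt q /\
  forall j, pairing (om j) (xo - local_pt p) != 0 ->
    piece_sign q j = sact H (invmx (piece_weyl q) * piece_weyl p) (piece_sign p) j.

Lemma weyl_cancel w v : weyl D w -> weyl D v ->
  invmx (invmx w * v) = invmx v * w.
Proof.
move=> /(weyl_unit H) uw /(weyl_unit H) uv.
have wv : invmx w * v \in unitmx by rewrite -mulmxE unitmx_mul unitmx_inv uw uv.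
rewrite -[RHS]mulmx1 -[X in _ *m X](mulmxV wv) mulmxA -!mulmxE -!mulmxA.
by rewrite (mulmxA w) (mulmxV uw) mul1mx (mulmxA _ v) mulVmx // mul1mx.
Qed.

Lemma glued_refl p : glued p p.
Proof.
split=> // j _; rewrite -mulmxE mulVmx ?(sact1 H) //.
exact: (weyl_unit H (piece_weylP p)).
Qed.

Lemma stab_out p i : i \in [set i | pairing (al i) (local_pt p) == 0]%SET ->
  pairing (om i) (xo - local_pt p) != 0.
Proof.
rewrite inE => /eqP ai; apply/eqP => /(cell_facet (local_cell p)).
by rewrite ai ltxx.
Qed.

Lemma glued_sym p q : glued p q -> glued q p.
Proof.
move=> [Epq es]; split=> // j.
have [elo par] := same_pt Epq; rewrite -elo => cj.
have Wp := piece_weylP p; have Wq := piece_weylP q.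
rewrite -(weyl_cancel Wq Wp).
rewrite (sact_off H (parabolicV H par) (K := fun j => pairing (om j) (xo - local_pt p) == 0)
  (f := sact H (invmx (piece_weyl q) * piece_weyl p) (piece_sign p))) //.
- by rewrite sactK //; exact: parabolic_weyl par.
- by move=> i /stab_out.
Qed.

Lemma glued_trans p q r : glued p q -> glued q r -> glued p r.
Proof.
move=> [Epq es] [Eqr et]; split=> [|j cj]; first by rewrite Epq.
have [elo par] := same_pt Epq; have [elo' par'] := same_pt Eqr.
have Wp := piece_weylP p; have Wq := piece_weylP q; have Wr := piece_weylP r.
rewrite -elo in et elo' par'.
rewrite et // (sact_off H par' (K := fun j => pairing (om j) (xo - local_pt p) == 0)
  (f := sact H (invmx (piece_weyl q) * piece_weyl p) (piece_sign p))) //; last first.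
  by move=> i /stab_out.
rewrite -(sactM H); [|exact: parabolic_weyl par'|exact: parabolic_weyl par].
by congr (sact H _ _ _); rewrite -mulrA (mulrA (piece_weyl q)) (weyl_mulV Wq) mul1r.
Qed.

Lemma glue_glued p q : Defs.glue p q -> glued p q.
Proof.
elim=> {p q} [p q [i [[wi es ew ep]|[wo es ew ep]]]|p|p q _|p q r _ ? _].
- split=> // j _; rewrite ew es.
  have W : weyl D (refl D i) := weyl_refl i; have Wp := piece_weylP p.
  have -> : invmx (piece_weyl p * refl D i) * piece_weyl p = refl D i.
    have := weyl_cancel Wp (weylM Wp W).
    rewrite mulrA (weyl_Vmul Wp) mul1r.
    by move=> <-; rewrite -prodw1 (prodw_inv H).
  by rewrite (sact_refl H).
- split=> // j cj; rewrite ew es -mulmxE mulVmx; last exact: (weyl_unit H (piece_weylP p)).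
  rewrite (sact1 H) ffunE; have [eji|//] := eqVneq j i.
  by move/wall_outE: wo cj => <-; rewrite eji eqxx.
- exact: glued_refl.
- exact: glued_sym.
- exact: glued_trans.
Qed.

Lemma glue_step p q i : glue_in i p q \/ glue_out i p q -> Defs.glue p q.
Proof. by move=> g; apply: Relation_Operators.rst_step; exists i. Qed.

Lemma glue_word p s :
  all (mem [set i | pairing (al i) (local_pt p) == 0]%SET) s ->
  exists q, [/\ piece_pt q = piece_pt p, piece_weyl q = piece_weyl p * wordprod D s,
    piece_sign q = sact H (invmx (wordprod D s)) (piece_sign p) & Defs.glue p q].
Proof.
elim/last_ind: s => [_|s i IH].
  exists p; rewrite prodw_nil mulr1; split => //; last exact: Relation_Operators.rst_refl.
  by rewrite -[1]/(1%:M) invmx1 (sact1 H).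
rewrite all_rcons => /andP[si /IH[q [ep ew es g]]].
have [elo _] := same_pt ep.
have ai : pairing (al i) (local_pt q) = 0 by move: si; rewrite /= inE elo => /eqP.
have [r [er1 er2 er3 er4]] := ex_piece (twist D i (piece_sign q))
  (weylM (piece_weylP q) (weyl_refl i)) (local_cell q).
have eqr : piece_pt r = piece_pt q.
  by rewrite er3 -mulmxE -mulmxA refl_fix // -piece_ptE.
exists r; split.
- by rewrite eqr.
- by rewrite er2 ew prodw_rcons mulrA.
- by rewrite er1 es !(prodw_inv H) rev_rcons (sact_cons H).
- apply: Relation_Operators.rst_trans g _; apply: (@glue_step _ _ i); left.
  by split => //; apply/wall_inE.
Qed.

Lemma glue_flips p q : piece_pt p = piece_pt q -> piece_weyl p = piece_weyl q ->
  (forall j, pairing (om j) (xo - local_pt p) != 0 -> piece_sign p j = piece_sign q j) ->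
  Defs.glue p q.
Proof.
have [n] := ubnP #|[set j | piece_sign p j != piece_sign q j]%SET|.
elim: n p => // n IH p pn ep ew es.
have [e0|[j]] := set_0Vmem [set j | piece_sign p j != piece_sign q j]%SET.
  suff -> : p = q by exact: Relation_Operators.rst_refl.
  apply: piece_eq => //; apply/ffunP => j; apply/eqP; apply: contraT => jn.
  have : j \in [set j | piece_sign p j != piece_sign q j]%SET by rewrite inE.
  by rewrite e0 inE.
rewrite inE => jn.
have cj : pairing (om j) (xo - local_pt p) = 0.
  by apply/eqP; apply: contraNT jn => /es ->.
have [r [er1 er2 er3 er4]] := ex_piece (flip j (piece_sign p)) (piece_weylP p) (local_cell p).
have er3' : piece_pt r = piece_pt p by rewrite er3 -piece_ptE.
apply: (@Relation_Operators.rst_trans _ _ _ r).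
  by apply: (@glue_step _ _ j); right; split => //; apply/wall_outE.
apply: IH; rewrite ?er3' ?er2 //.
  rewrite -ltnS; apply: leq_trans pn; rewrite ltnS [leqRHS](cardsD1 j) inE jn ltnS.
  apply: subset_leq_card; apply/fintype.subsetP => k.
  rewrite !inE er1 ffunE; have [->|kj //] := eqVneq k j.
  by move: jn; case: (piece_sign p j); case: (piece_sign q j).
move=> k; rewrite er4 => ck; rewrite er1 ffunE.
have [ekj|kj] := eqVneq k j; last exact: es.
by move: ck; rewrite ekj cj eqxx.
Qed.

(** Gluing along internal walls acts by the stabilizer of the local point, and
    gluing along external walls changes the signs on which this stabilizer
    does not depend. *)
Lemma glueP p q : Defs.glue p q <-> glued p q.
Proof.
split=> [|[ep es]]; first exact: glue_glued.
have [elo /(parabolicV H)] := same_pt ep.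
have Wp := piece_weylP p; have Wq := piece_weylP q.
rewrite (weyl_cancel Wq Wp) => -[s sJ eS].
have [r [e1 e2 e3 g]] := glue_word sJ.
apply: Relation_Operators.rst_trans g _; apply: glue_flips.
- by rewrite e1.
- by rewrite e2 -eS mulrA (weyl_mulV Wp) mul1r.
- have [elo' _] := same_pt e1; rewrite elo' => j cj.
  by rewrite e3 es // -eS (weyl_cancel Wp Wq).
Qed.

End Pieces.

(** * Topology of the disjoint union of the pieces *)

Lemma compact_set_type (T : topologicalType) (A : set T) :
  compact A -> compact [set: set_type A].
Proof.
move=> cA F FF _; pose G : set_system T := set_val @ F.
have GA : G A.
  by apply: (@filterS _ F _ setT) => [x _|]; [exact: set_valP|exact: filterT].
have [x [Ax clx]] := cA G _ GA.
exists (exist _ x (mem_set Ax)); split => // B C FB [_ [/= [W oW <-] /= Wx] WC].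
have GB : G (set_val @` B).
  by change (F (set_val @^-1` (set_val @` B))); apply: filterS FB => b Bb; exists b.
have nW : nbhs x W by apply: open_nbhs_nbhs.
have [_ [[b Bb <-] Wb]] := clx _ _ GB nW.
by exists b; split => //; exact: WC.
Qed.

Lemma sum_enum (V : nmodType) (I : finType) (F : I -> V) :
  \sum_i F i = \sum_(r < #|I|) F (enum_val r).
Proof. by rewrite (reindex _ (onW_bij _ (enum_val_bij I))). Qed.

Section LinearContinuity.
Context {R : realType} {l : nat}.

Lemma mulmx_continuous m (w : 'M[R]_(m, l)) : continuous (mulmx w : 'cV_l -> 'cV_m).
Proof.
move=> x; apply: mx_continuous => i j; rewrite ord1.
rewrite (_ : (fun _ => _) = fun y : 'cV[R]_l => \sum_k w i k * y k 0); last first.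
  by apply/funext => y; rewrite mxE.
apply: sum_continuous => k; apply: continuousM; first exact: cst_continuous.
exact: coord_continuous.
Qed.

Lemma pairing_continuous (a : 'rV[R]_l) : continuous (pairing a).
Proof.
move=> x; apply: (@continuous_comp _ _ _ (mulmx a) (fun M : 'M[R]_1 => M 0 0)).
  exact: mulmx_continuous.
exact: coord_continuous.
Qed.

Lemma closed_ge0 (a : 'rV[R]_l) : closed [set x | 0 <= pairing a x].
Proof.
apply: (@preimage_closed _ _ (pairing a) [set t | 0 <= t]); last exact: closed_ge.
by move=> x _; exact: pairing_continuous.
Qed.

End LinearContinuity.

Section PieceTopology.
Context {R : realType} {l : nat} {I : finType} {D : tomei_data R l I}.
Variable H : root_datum D.
Context {xo : 'cV[R]_l}.
Hypothesis xo_reg : regular_dominant D xo.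
Local Notation al := (sroot D).
Local Notation h := (scoroot D).
Local Notation om := (fweight D).
Local Notation piece := (pieces D xo).

Lemma cell0_bound k : exists M, forall z, cell0 D xo z ->
  pairing (om k) (xo - z) <= M.
Proof.
have [ws _ wsP] := parabolic_enum H [set: I]%SET.
have /wsP ws1 : parabolic D [set: I]%SET 1 := parabolic1 _.
have [w _ wmax] := seq_max (fun w => pairing (om k) (xo - w *m xo)) ws1.
exists (pairing (om k) (xo - w *m xo)) => z [pz _].
suff : [set z | pairing (om k) (xo - z) <= pairing (om k) (xo - w *m xo)] z by [].
move: z pz; apply: smallest_sub.
  apply/convex_setP => x y t t0 t1 /= hx hy.
  have -> : xo - (t *: x + (1 - t) *: y) = t *: (xo - x) + (1 - t) *: (xo - y).
    by rewrite !scalerBr !scalerBl !scale1r; apply/colP => i; rewrite !mxE; ring.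
  rewrite (pairingDr _ (t *: _)) !pairingZr.
  have -> : pairing (om k) (xo - w *m xo) = t * pairing (om k) (xo - w *m xo) +
      (1 - t) * pairing (om k) (xo - w *m xo) by ring.
  by rewrite lerD // ler_wpM2l // subr_ge0.
by move=> _ [v /parabolicT/wsP vW <-]; exact: wmax.
Qed.

(** The coordinates with respect to the coroots embed the cell as a closed
    subset of a box. *)
Lemma cell0_compact : compact (cell0 D xo).
Proof.
have [M hM] := choice cell0_bound.
pose K : set 'rV[R]_#|I| := [set v | forall r, `[0, M (enum_val r)]%classic (v 0 r)].
have cK : compact K.
  by apply: (@rV_compact _ _ (fun r => `[0, M (enum_val r)]%classic)) => r; exact: segment_compact.
pose f (v : 'rV[R]_#|I|) := xo - \sum_(r < #|I|) v 0 r *: h (enum_val r).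
have cf : continuous f.
  move=> v; apply: fun_sub_continuous; first exact: cst_continuous.
  apply: sum_continuous => r; apply: fun_scale_continuous; exact: coord_continuous.
have -> : cell0 D xo = f @` (K `&` f @^-1` dominant D).
  apply/seteqP; split=> [z cz|_ [v [Kv dv] <-]].
    have /(cell0P H _ (xo_dominant xo_reg))[dz hz oz] := cz.
    have fz : f (\row_r pairing (om (enum_val r)) (xo - z)) = z.
      rewrite /f; under eq_bigr do rewrite mxE.
      rewrite -(sum_enum (fun k => pairing (om k) (xo - z) *: h k)) -hz.
      by rewrite opprB addrC subrK.
    exists (\row_r pairing (om (enum_val r)) (xo - z)) => //; split; last by rewrite /= fz.
    by move=> r; rewrite mxE /= in_itv /= oz hM.
  apply/(cell0P H _ (xo_dominant xo_reg)); split => //.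
    rewrite /f opprB addrC subrK.
    by apply: hspan_sum => r _; apply: hspanZ; exact: (hspan_coroot H).
  move=> k; rewrite /f opprB addrC subrK.
  have -> : \sum_(r < #|I|) v 0 r *: h (enum_val r) =
      \sum_k v 0 (enum_rank k) *: h k.
    by rewrite [RHS]sum_enum; apply: eq_bigr => r _; rewrite enum_valK.
  rewrite (fweight_comb H); have := Kv (enum_rank k).
  by rewrite /= in_itv /= => /andP[].
apply: continuous_compact; first exact: continuous_subspaceT.
apply: (subclosed_compact _ cK) => //; apply: closedI; first exact: (compact_closed _ cK).
apply: preimage_closed; first by move=> x _; exact: cf.
have -> : dominant D = \bigcap_(i in [set: I]) [set x | 0 <= pairing (al i) x].
  by apply/seteqP; split=> x dx i; [move=> _; exact: dx|exact: dx].
by apply: closed_bigI => i _; exact: closed_ge0.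
Qed.

Lemma cell_compact w : compact (cell D xo w).
Proof.
apply: continuous_compact; last exact: cell0_compact.
apply: continuous_subspaceT; exact: mulmx_continuous.
Qed.

Lemma finite_set_type (T : Type) (A : set T) : finite_set A ->
  finite_set [set: set_type A].
Proof.
elim/Pchoice: T => T in A *.
move=> fA; apply: (@sub_finite_set _ _ (set_val @^-1` A)).
  by move=> x _; exact: set_valP.
by apply: finite_preimage fA => x y _ _; exact: val_inj.
Qed.

Lemma finite_piece_index : finite_set [set: @signs I * set_type (weyl D)].
Proof.
rewrite -setXTT; apply: finite_setX; first exact: finite_finset.
exact/finite_set_type/(finite_weyl H).
Qed.

Lemma pieces_compact : compact [set: piece].
Proof.
apply: sigT_compact; first exact: finite_piece_index.
by move=> ew; apply: compact_set_type; exact: cell_compact.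
Qed.

(** Each summand of the disjoint union is open. *)
Lemma open_index (Q : @signs I -> 'M[R]_l -> Prop) :
  open [set p : piece | Q (piece_sign p) (piece_weyl p)].
Proof.
apply/sigT_openP => ew.
have [Qew|nQ] := pselect (Q ew.1 (val ew.2)).
  by rewrite (_ : _ @^-1` _ = setT); [exact: openT|apply/seteqP; split].
by rewrite (_ : _ @^-1` _ = set0); [exact: open0|apply/seteqP; split].
Qed.

Lemma closed_index (Q : @signs I -> 'M[R]_l -> Prop) :
  closed [set p : piece | Q (piece_sign p) (piece_weyl p)].
Proof.
by rewrite -openC; exact: (@open_index (fun e w => ~ Q e w)).
Qed.

(** The sign and the Weyl group element are locally constant, so only the
    dependence on the point matters. *)
Lemma piece_fun_continuous (Z : topologicalType)
    (F : @signs I -> 'M[R]_l -> 'cV[R]_l -> Z) :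
  (forall p : piece,
    {for piece_pt p, continuous (F (piece_sign p) (piece_weyl p))}) ->
  continuous (fun p : piece => F (piece_sign p) (piece_weyl p) (piece_pt p)).
Proof.
move=> cF [ew x].
have := cF (existT _ ew x); rewrite /piece_sign /piece_weyl /piece_pt /= => cFx.
move=> U nU; rewrite /nbhs /= /sigT_nbhs /=.
have := @initial_continuous _ _ (set_val : set_type (cell D xo (val ew.2)) -> _) x.
move=> /(_ _ (cFx U nU)); exact.
Qed.

Lemma local_pairing_continuous (a : 'rV[R]_l) :
  continuous (fun p : piece => pairing a (local_pt p)).
Proof.
apply: (@piece_fun_continuous _ (fun _ w x => pairing a (invmx w *m x))) => p.
apply: (@continuous_comp _ _ _ (mulmx (invmx (piece_weyl p)))).
  exact: mulmx_continuous.
exact: pairing_continuous.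
Qed.

Lemma local_coord_continuous i :
  continuous (fun p : piece => pairing (om i) (xo - local_pt p)).
Proof.
apply: (@piece_fun_continuous _ (fun _ w x => pairing (om i) (xo - invmx w *m x))) => p.
apply: (@continuous_comp _ _ _ (fun x => xo - invmx (piece_weyl p) *m x)).
  apply: fun_sub_continuous; first exact: cst_continuous.
  exact: mulmx_continuous.
exact: pairing_continuous.
Qed.

End PieceTopology.

(** * Charts *)

Lemma near_forall (T : topologicalType) (I : finType) (x : T)
    (P : I -> T -> Prop) : (forall i, \near x, P i x) -> \near x, forall i, P i x.
Proof. by move=> Px; apply: filter_forall. Qed.

Lemma open_forall (T : topologicalType) (I : finType) (S : I -> set T) :
  (forall i, open (S i)) -> open [set x | forall i, S i x].
Proof.
move=> oS; rewrite openE => x Sx; apply: near_forall => i.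
exact: open_nbhs_nbhs.
Qed.

Lemma near_seq (T : topologicalType) (A : eqType) (x : T) (s : seq A)
    (P : A -> T -> Prop) : (forall a, a \in s -> \near x, P a x) ->
  \near x, forall a, a \in s -> P a x.
Proof.
elim: s => [|a s IH] Ps; first by apply: filterS filterT => y _ a.
have h1 := Ps a (mem_head _ _).
have : \near x, forall a, a \in s -> P a x.
  by apply: IH => b bs; apply: Ps; rewrite inE bs orbT.
apply: filterS2 h1 => y Pa Py b; rewrite inE => /predU1P[->//|]; exact: Py.
Qed.

Section NearOrder.
Context {R : realType} {T : topologicalType}.
Implicit Types (g : T -> R) (x : T).

Lemma near_lt g x t : {for x, continuous g} -> g x < t -> \near x, g x < t.
Proof. by move=> cg gt; apply: (cg [set s | s < t]); exact: (open_nbhs_nbhs (conj (@open_lt _ t) gt)). Qed.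

Lemma near_gt g x t : {for x, continuous g} -> t < g x -> \near x, t < g x.
Proof. by move=> cg gt; apply: (cg [set s | t < s]); exact: (open_nbhs_nbhs (conj (@open_gt _ t) gt)). Qed.

Lemma pos_lower_bound (I : finType) (f : I -> R) : (forall i, 0 < f i) ->
  exists2 t, 0 < t & forall i, t < f i.
Proof.
move=> f0; near (0 : R)^'+ => t; exists t; first by near: t; exact: nbhs_right_gt.
by near: t; apply: filter_forall => i; exact: nbhs_right_lt.
Unshelve. all: by end_near. Qed.

End NearOrder.

Section Rebuild.
Context {R : realType} {l : nat} {I : finType} {D : tomei_data R l I}.
Variable H : root_datum D.
Variables (xo : 'cV[R]_l) (J : {set I}).
Local Notation al := (sroot D).
Local Notation h := (scoroot D).
Local Notation om := (fweight D).
Local Notation d := #|I|.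
Implicit Types (y : 'rV[R]_d) (x : 'cV[R]_l) (i k : I).

(** The linear system that expresses the values of the simple roots in J and
    the coordinates outside J through all coordinates. *)
Definition sysmx : 'M[R]_d := \matrix_(s, r)
  if enum_val r \in J then pairing (al (enum_val r)) (h (enum_val s))
  else (s == r)%:R.

Lemma sysmxE (g : I -> R) r :
  ((\row_s g (enum_val s)) *m sysmx) 0 r =
  if enum_val r \in J then pairing (al (enum_val r)) (\sum_k g k *: h k)
  else g (enum_val r).
Proof.
rewrite mxE; case: ifP => rJ.
  rewrite [X in pairing _ X]sum_enum pairing_sumr; apply: eq_bigr => s _.
  by rewrite !mxE rJ pairingZr.
rewrite (bigD1 r) //= big1 ?addr0 => [|s sr]; first by rewrite !mxE rJ eqxx mulr1.
by rewrite !mxE rJ (negPf sr) mulr0.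
Qed.

Lemma row_enum (v : 'rV[R]_d) : v = \row_s v 0 (enum_rank (enum_val s)).
Proof. by apply/rowP => s; rewrite mxE enum_valK. Qed.

(** A vector of the kernel has no coordinates outside J and pairs to zero with
    the simple roots in J, so it is zero by positive definiteness. *)
Lemma sysmx_unit : sysmx \in unitmx.
Proof.
rewrite -row_free_unit -kermx_eq0; apply/eqP/row_matrixP => i.
rewrite row0; set v := row i _.
have vN : v *m sysmx = 0 by rewrite -row_mul mulmx_ker row0.
pose p k := v 0 (enum_rank k).
have pv : v = \row_s p (enum_val s) by exact: row_enum.
have sys r := sysmxE p r; rewrite -pv vN in sys.
have pJ k : k \notin J -> p k = 0.
  by move=> /negPf kJ; have := sys (enum_rank k); rewrite enum_rankK kJ mxE.
have aJ k : k \in J -> pairing (al k) (\sum_k p k *: h k) = 0.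
  by move=> kJ; have := sys (enum_rank k); rewrite enum_rankK kJ mxE.
have p0 : \sum_k p k *: h k = 0.
  apply: (comb_eq0 H) => k; have [kJ|/pJ ->] := boolP (k \in J).
    by rewrite aJ // mulr0.
  by rewrite mul0r.
by rewrite pv; apply/rowP => s; rewrite !mxE (comb0 H p0).
Qed.

Definition rhs y : 'rV[R]_d := \row_r
  if enum_val r \in J then pairing (al (enum_val r)) xo - y 0 r else y 0 r ^+ 2.

Definition gcoef y := rhs y *m invmx sysmx.

(** The point with given values of the simple roots in J and given square
    roots of the coordinates outside J: the inverse of a chart, before
    translation. *)
Definition rebuild y := xo - \sum_k gcoef y 0 (enum_rank k) *: h k.

Lemma rebuildK y : xo - rebuild y = \sum_k gcoef y 0 (enum_rank k) *: h k.
Proof. by rewrite /rebuild opprB addrC subrK. Qed.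

Lemma gcoef_sys y r : rhs y 0 r =
  if enum_val r \in J
  then pairing (al (enum_val r)) (\sum_k gcoef y 0 (enum_rank k) *: h k)
  else gcoef y 0 r.
Proof.
have := sysmxE (fun k => gcoef y 0 (enum_rank k)) r.
by rewrite -row_enum /gcoef mulmxKV ?sysmx_unit // enum_valK.
Qed.

Lemma rebuild_sroot y i : i \in J ->
  pairing (al i) (rebuild y) = y 0 (enum_rank i).
Proof.
move=> iJ; have := gcoef_sys y (enum_rank i); rewrite mxE enum_rankK iJ.
by rewrite /rebuild pairingBr => <-; rewrite opprB addrC subrK.
Qed.

Lemma rebuild_fweight y i : i \notin J ->
  pairing (om i) (xo - rebuild y) = y 0 (enum_rank i) ^+ 2.
Proof.
move=> /negPf iJ; have := gcoef_sys y (enum_rank i); rewrite mxE enum_rankK iJ.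
by move=> ->; rewrite rebuildK (fweight_comb H).
Qed.

Lemma rebuild_hspan y : hspan (D := D) (xo - rebuild y).
Proof. by rewrite rebuildK; exact: (hspan_comb H). Qed.

Lemma rebuild_uniq y x : hspan (D := D) (xo - x) ->
  (forall i, i \in J -> pairing (al i) x = y 0 (enum_rank i)) ->
  (forall i, i \notin J -> pairing (om i) (xo - x) = y 0 (enum_rank i) ^+ 2) ->
  x = rebuild y.
Proof.
move=> hx xa xc.
suff e : \row_s pairing (om (enum_val s)) (xo - x) = gcoef y.
  have -> : x = xo - (xo - x) by rewrite opprB addrC subrK.
  rewrite /rebuild -e [X in _ - X]hx; congr (_ - _); apply: eq_bigr => k _.
  by rewrite mxE enum_rankK.
rewrite -[LHS](mulmxK sysmx_unit); congr (_ *m _); apply/rowP => r.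
rewrite (sysmxE (fun k => pairing (om k) (xo - x))) -hx mxE; case: ifP => rJ.
  by rewrite pairingBr xa // enum_valK.
by rewrite xc ?rJ // enum_valK.
Qed.

Lemma rebuild_Ck n (b : 'rV[R]_l) :
  Ck_on n setT (fun y => pairing b (rebuild y)).
Proof.
have oT : open [set: 'rV[R]_d] by exact: openT.
have kg s : Ck_on n setT (fun y => gcoef y 0 s).
  rewrite (_ : (fun _ => _) = fun y => \sum_r (if enum_val r \in J
      then pairing (al (enum_val r)) xo + (-1) * y 0 r else y 0 r * y 0 r) *
      invmx sysmx r s); last first.
    apply/funext => y; rewrite mxE; apply: eq_bigr => r _; rewrite mxE.
    by case: ifP; rewrite ?mulN1r ?expr2.
  apply: Ck_on_sum => // r; apply: Ck_on_mul => //; last exact: Ck_on_cst.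
  case: (enum_val r \in J).
    apply: Ck_on_add => //; first exact: Ck_on_cst.
    apply: Ck_on_mul => //; [exact: Ck_on_cst|exact: Ck_on_coord].
  by apply: Ck_on_mul => //; exact: Ck_on_coord.
rewrite (_ : (fun _ => _) = fun y => pairing b xo + \sum_k gcoef y 0 (enum_rank k) *
    (- pairing b (h k))); last first.
  apply/funext => y; rewrite /rebuild pairingBr pairing_sumr -sumrN.
  by congr (_ + _); apply: eq_bigr => k _; rewrite pairingZr mulrN.
apply: Ck_on_add => //; first exact: Ck_on_cst.
apply: Ck_on_sum => // k; apply: Ck_on_mul => //; exact: Ck_on_cst.
Qed.

Lemma rebuild_continuous (b : 'rV[R]_l) : continuous (fun y => pairing b (rebuild y)).
Proof. by move=> y; have [c _] := rebuild_Ck 0 b; exact: c. Qed.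

End Rebuild.

Section ParabolicMonotone.
Context {R : realType} {l : nat} {I : finType} {D : tomei_data R l I}.
Variable H : root_datum D.

(** The difference of the two vectors is a nonnegative combination of the
    coroots in J, on which a simple root outside J is nonpositive. *)
Lemma parabolic_sroot_ge J w x j : parabolic D J w -> dominantJ (D := D) J x ->
  j \notin J -> pairing (sroot D j) x <= pairing (sroot D j) (w *m x).
Proof.
move=> wJ xJ jJ; rewrite -subr_le0 -pairingBr.
have -> := hspan_weyl H x (parabolic_weyl wJ).
rewrite pairing_sumr; apply: sumr_le0 => k _; rewrite pairingZr.
have [kJ|kJ] := boolP (k \in J).
  apply: mulr_ge0_le0; first exact: (parabolic_dominant_ge H _ wJ xJ).
  by apply: (cartan_le0 H); apply: contraNneq jJ => ->.
by rewrite pairingBr (parabolic_fweightE H _ wJ kJ) subrr mul0r.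
Qed.

End ParabolicMonotone.

Section Chart.
Context {R : realType} {l : nat} {I : finType} {D : tomei_data R l I}.
Variable H : root_datum D.
Context {xo : 'cV[R]_l}.
Hypothesis xo_reg : regular_dominant D xo.
Local Notation al := (sroot D).
Local Notation h := (scoroot D).
Local Notation om := (fweight D).
Local Notation piece := (pieces D xo).
Implicit Types (p q : piece) (i j k : I).

Definition lroot i p := pairing (al i) (local_pt p).
Definition lcoord i p := pairing (om i) (xo - local_pt p).

Section OneChart.
Variables (J : {set I}) (e0 : @signs I) (w0 : 'M[R]_l).
Hypothesis w0_weyl : weyl D w0.

(** The signs of a piece relative to the piece with signs e0 and Weyl group
    element w0 that serves as the origin of the chart. *)
Definition eta p := sadd (piece_sign p) (sact H (invmx (piece_weyl p) * w0) e0).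

(** The pieces that a chart covers are the translates of its origin by the
    parabolic subgroup of J, with the signs outside J flipped at will: they
    meet along the internal walls in J and the external walls outside J. *)
Definition orbit p := parabolic D J (invmx w0 * piece_weyl p) /\
  forall i, i \in J -> eta p i = false.

(** The points of these pieces away from all other walls. *)
Definition core p :=
  forall i, if i \in J then 0 < lcoord i p else 0 < lroot i p.

Definition cdom : set piece := [set p | orbit p /\ core p].

(** The simple roots in J are smooth across the internal walls. The coordinate
    of an external wall is nonnegative and the pieces on its two sides carry
    opposite signs, so its signed square root straightens the wall. *)
Definition cmap p : 'rV[R]_#|I| := \row_r
  if enum_val r \in J then pairing (al (enum_val r)) (invmx w0 *m piece_pt p)
  else (-1) ^+ eta p (enum_val r) * Num.sqrt (lcoord (enum_val r) p).

Lemma lcoord_ge0 i p : 0 <= lcoord i p.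
Proof. exact: (local_fweight H xo_reg). Qed.

Lemma lroot_ge0 i p : 0 <= lroot i p.
Proof. exact: (local_dominant H xo_reg). Qed.

Lemma chart_ptE p : invmx w0 *m piece_pt p =
  (invmx w0 * piece_weyl p) *m local_pt p.
Proof. by rewrite -mulmxE -mulmxA -(piece_ptE H). Qed.

Lemma orbit_coord p i : orbit p -> i \notin J ->
  pairing (om i) (xo - invmx w0 *m piece_pt p) = lcoord i p.
Proof.
move=> [pJ _] iJ; rewrite chart_ptE /lcoord !pairingBr.
by rewrite (parabolic_fweightE H _ pJ iJ).
Qed.

Lemma chart_hspan p : hspan (D := D) (xo - invmx w0 *m piece_pt p).
Proof.
rewrite chart_ptE.
have -> : xo - (invmx w0 * piece_weyl p) *m local_pt p = (xo - local_pt p) +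
    (local_pt p - (invmx w0 * piece_weyl p) *m local_pt p).
  by rewrite addrA subrK.
apply: hspanD; first exact: (local_hspan H xo_reg).
apply: (hspan_weyl H); apply: weylM; first exact: (weylV H).
exact: piece_weylP.
Qed.

Lemma cmap_rebuild p : orbit p -> invmx w0 *m piece_pt p = rebuild (D := D) xo J (cmap p).
Proof.
move=> op; apply: (rebuild_uniq H); first exact: chart_hspan.
  by move=> i iJ; rewrite mxE enum_rankK iJ.
move=> i iJ; rewrite mxE enum_rankK (negPf iJ) orbit_coord //.
rewrite exprMn sqrr_sign mul1r sqr_sqrtr //; exact: lcoord_ge0.
Qed.

Lemma core_stab p : core p -> [set i | lroot i p == 0]%SET \subset J.
Proof.
move=> cp; apply/fintype.subsetP => i; rewrite inE => /eqP ai.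
by have := cp i; case: ifP => // _; rewrite ai ltxx.
Qed.

(** The two pieces differ by an element of the stabilizer of the local point.
    It lies in the subgroup of J, and therefore fixes the relative signs,
    which vanish on J. *)
Lemma glued_orbit p q : glued H p q -> [set i | lroot i p == 0]%SET \subset J ->
  (forall i, i \in J -> 0 < lcoord i p) -> orbit p ->
  [/\ orbit q, local_pt q = local_pt p &
      forall i, lcoord i p != 0 -> eta q i = eta p i].
Proof.
move=> [Epq es] sJ cJ [pJ eJ].
have [elo par] := same_pt H xo_reg Epq.
have Wp := piece_weylP p; have Wq := piece_weylP q.
have etaq i : lcoord i p != 0 -> eta q i = eta p i.
  move=> ci; rewrite !ffunE es //.
  have -> : invmx (piece_weyl q) * w0 =
      (invmx (piece_weyl q) * piece_weyl p) * (invmx (piece_weyl p) * w0).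
    by rewrite -mulrA (mulrA (piece_weyl p)) (weyl_mulV H Wp) mul1r.
  have Wp0 : weyl D (invmx (piece_weyl p) * w0).
    by apply: weylM => //; exact: (weylV H).
  rewrite (sactM H e0 (parabolic_weyl par) Wp0).
  have := sact_add H (piece_sign p) (sact H (invmx (piece_weyl p) * w0) e0)
    (parabolic_weyl par).
  rewrite -/(eta p) (sact_fix H (parabolicS sJ par)) // => /ffunP/(_ i).
  by rewrite !ffunE.
split => //; split; last by move=> i iJ; rewrite etaq ?eJ // gt_eqF // cJ.
have -> : invmx w0 * piece_weyl q =
    (invmx w0 * piece_weyl p) * invmx (invmx (piece_weyl q) * piece_weyl p).
  rewrite (weyl_cancel H Wq Wp) -mulrA (mulrA (piece_weyl p)) (weyl_mulV H Wp).
  by rewrite mul1r.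
by apply: parabolicM => //; apply: (parabolicV H); exact: parabolicS par.
Qed.

Lemma glued_core p q : local_pt q = local_pt p -> core p -> core q.
Proof. by move=> e cp i; have := cp i; rewrite /lcoord /lroot e. Qed.

Lemma core_coord p : core p -> forall i, i \in J -> 0 < lcoord i p.
Proof. by move=> cp i iJ; have := cp i; rewrite iJ. Qed.

Lemma cdom_glued p q : glued H p q -> cdom p -> cdom q.
Proof.
move=> g [op cp]; have [oq e _] := glued_orbit g (core_stab cp) (core_coord cp) op.
by split => //; exact: glued_core cp.
Qed.

Lemma cmap_glued p q : glued H p q -> cdom p -> cmap p = cmap q.
Proof.
move=> g [op cp]; have [oq e eq] := glued_orbit g (core_stab cp) (core_coord cp) op.
have [ep _] := g.
apply/rowP => r; rewrite !mxE; case: ifP => rJ; first by rewrite ep.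
have -> : lcoord (enum_val r) q = lcoord (enum_val r) p by rewrite /lcoord e.
have [->|/eq ->//] := eqVneq (lcoord (enum_val r) p) 0.
by rewrite sqrtr0 !mulr0.
Qed.

Lemma sign_inj (b c : bool) (t : R) : t != 0 ->
  (-1) ^+ b * t = (-1) ^+ c * t -> b = c.
Proof.
move=> t0 /(mulIf t0); case: b; case: c => //; rewrite !expr1 !expr0 => /eqP.
  by rewrite -subr_eq0 -opprD oppr_eq0 -[1 + 1]/(2%:R) pnatr_eq0.
by rewrite eq_sym -subr_eq0 -opprD oppr_eq0 -[1 + 1]/(2%:R) pnatr_eq0.
Qed.

Lemma cmap_inj p q : cdom p -> cdom q -> cmap p = cmap q -> glued H p q.
Proof.
move=> [op cp] [oq cq] Ec.
have Wp := piece_weylP p; have Wq := piece_weylP q.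
have Ept : piece_pt p = piece_pt q.
  have := cmap_rebuild op; rewrite Ec -(cmap_rebuild oq).
  by move=> /(congr1 (mulmx w0)); rewrite !mulKVmx // (weyl_unit H w0_weyl).
split => // j cj; have [elo par] := same_pt H xo_reg Ept.
have etaE : eta q j = eta p j.
  have [jJ|jJ] := boolP (j \in J).
    by rewrite (proj2 op) // (proj2 oq).
  move/rowP: Ec => /(_ (enum_rank j)); rewrite !mxE enum_rankK (negPf jJ).
  have -> : lcoord j q = lcoord j p by rewrite /lcoord elo.
  move=> /esym/sign_inj -> //; rewrite sqrtr_eq0 -ltNge lt_neqAle eq_sym cj.
  exact: lcoord_ge0.
have -> : piece_sign q = sadd (eta q) (sact H (invmx (piece_weyl q) * w0) e0).
  by apply/ffunP => k; rewrite !ffunE -addbA addbb addbF.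
have -> : piece_sign p = sadd (eta p) (sact H (invmx (piece_weyl p) * w0) e0).
  by apply/ffunP => k; rewrite !ffunE -addbA addbb addbF.
rewrite (sact_add H _ _ (parabolic_weyl par)).
rewrite (sact_fix H (parabolicS (core_stab cp) par) (proj2 op)).
rewrite -(sactM H); [|exact: parabolic_weyl par|]; last first.
  by apply: weylM => //; exact: (weylV H).
rewrite -mulrA (mulrA (piece_weyl p)) (weyl_mulV H Wp) mul1r.
by rewrite [LHS]ffunE [RHS]ffunE etaE.
Qed.

Lemma cdom_open : open cdom.
Proof.
apply: openI.
  apply: (open_index (Q := fun e w => parabolic D J (invmx w0 * w) /\
    forall i, i \in J -> sadd e (sact H (invmx w * w0) e0) i = false)).
apply: open_forall => i; case: (i \in J).
  have /continuousP := @local_coord_continuous R l I D xo i.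
  move=> /(_ [set t | 0 < t]); apply; exact: open_gt.
have /continuousP := @local_pairing_continuous R l I D xo (al i).
move=> /(_ [set t | 0 < t]); apply; exact: open_gt.
Qed.

Lemma cmap_continuous : continuous cmap.
Proof.
apply: (@piece_fun_continuous _ _ _ D xo _ (fun e w x => \row_r
  if enum_val r \in J then pairing (al (enum_val r)) (invmx w0 *m x)
  else (-1) ^+ sadd e (sact H (invmx w * w0) e0) (enum_val r) *
    Num.sqrt (pairing (om (enum_val r)) (xo - invmx w *m x)))) => p.
apply: mx_continuous => i r.
rewrite (_ : (fun _ => _) = fun x : 'cV[R]_l =>
  if enum_val r \in J then pairing (al (enum_val r)) (invmx w0 *m x)
  else (-1) ^+ sadd (piece_sign p) (sact H (invmx (piece_weyl p) * w0) e0) (enum_val r) *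
    Num.sqrt (pairing (om (enum_val r)) (xo - invmx (piece_weyl p) *m x))); last first.
  by apply/funext => x; rewrite mxE.
case: (enum_val r \in J).
  apply: (@continuous_comp _ _ _ (mulmx (invmx w0))); first exact: mulmx_continuous.
  exact: pairing_continuous.
apply: continuousM; first exact: cst_continuous.
apply: (@continuous_comp _ _ _ (fun x => pairing (om (enum_val r))
    (xo - invmx (piece_weyl p) *m x)) Num.sqrt); last exact: sqrt_continuous.
apply: (@continuous_comp _ _ _ (fun x => xo - invmx (piece_weyl p) *m x)).
  apply: fun_sub_continuous; first exact: cst_continuous.
  exact: mulmx_continuous.
exact: pairing_continuous.
Qed.

(** The core with a margin t, which makes it closed. *)
Definition core_ge t p :=
  forall i, if i \in J then t <= lcoord i p else t <= lroot i p.

Definition ccore t : set piece := [set p | orbit p /\ core_ge t p].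

Lemma core_geW t p : 0 < t -> core_ge t p -> core p.
Proof.
by move=> t0 cp i; have := cp i; case: ifP => _; exact: lt_le_trans.
Qed.

Lemma ccore_closed t : closed (ccore t).
Proof.
apply: closedI.
  apply: (closed_index (Q := fun e w => parabolic D J (invmx w0 * w) /\
    forall i, i \in J -> sadd e (sact H (invmx w * w0) e0) i = false)).
have -> : core_ge t = \bigcap_(i in [set: I])
    [set p | if i \in J then t <= lcoord i p else t <= lroot i p].
  by apply/seteqP; split=> p cp i; [move=> _; exact: cp|exact: cp].
apply: closed_bigI => i _; case: (i \in J).
  apply: (@preimage_closed _ _ (lcoord i) [set s | t <= s]); last exact: closed_ge.
  by move=> p _; exact: local_coord_continuous.
apply: (@preimage_closed _ _ (lroot i) [set s | t <= s]); last exact: closed_ge.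
by move=> p _; exact: local_pairing_continuous.
Qed.

Lemma ccore_glued t p q : 0 < t -> glued H p q -> ccore t p -> ccore t q.
Proof.
move=> t0 g [op cp]; have cp' := core_geW t0 cp.
have [oq e _] := glued_orbit g (core_stab cp') (core_coord cp') op.
by split => // i; have := cp i; rewrite /lcoord /lroot e.
Qed.

(** A point of the model space comes from a piece as soon as the conditions of
    the core hold for all its translates: one of them is dominant. *)
Lemma ccore_surj t y : 0 < t ->
  (forall v, parabolic D J v -> forall i, if i \in J
    then t < pairing (om i) (xo - v *m rebuild (D := D) xo J y)
    else t < pairing (al i) (v *m rebuild (D := D) xo J y)) ->
  (cmap @` ccore t) y.
Proof.
move=> t0 hy; set Y := rebuild xo J y in hy.
have [v vJ dv] := ex_dominantJ H J Y.
pose z := v *m Y.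
have hYs : hspan (D := D) (xo - Y) by exact: rebuild_hspan.
have omz k : k \notin J -> pairing (om k) (xo - z) = y 0 (enum_rank k) ^+ 2.
  move=> kJ; rewrite pairingBr /z (parabolic_fweightE H _ vJ kJ) -pairingBr.
  exact: rebuild_fweight.
have cz : cell0 D xo z.
  apply/(cell0P H _ (xo_dominant xo_reg)); split.
  - move=> i; have [iJ|iJ] := boolP (i \in J); first exact: dv.
    by have := hy v vJ i; rewrite (negPf iJ) => /ltW; apply: le_trans; exact: ltW.
  - have -> : xo - z = (xo - Y) + (Y - z) by rewrite addrA subrK.
    by apply: hspanD => //; exact: (hspan_weyl H _ (parabolic_weyl vJ)).
  - move=> k; have [kJ|kJ] := boolP (k \in J); last by rewrite omz // sqr_ge0.
    by have := hy v vJ k; rewrite kJ => /ltW; apply: le_trans; exact: ltW.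
pose w := w0 * invmx v.
have Ww : weyl D w by apply: weylM => //; exact/(weylV H)/(parabolic_weyl vJ).
pose neg : @signs I := [ffun j => (j \notin J) && (y 0 (enum_rank j) < 0)].
have [p [ep wp xp lp]] := ex_piece H (xo := xo) (sadd neg (sact H (invmx w * w0) e0)) Ww cz.
have etap : eta p = neg.
  by apply/ffunP => j; rewrite /eta ep wp !ffunE -addbA addbb addbF.
have w0w : invmx w0 * w = invmx v by rewrite /w mulrA (weyl_Vmul H w0_weyl) mul1r.
exists p.
  split; first split.
  - by rewrite wp w0w; exact: (parabolicV H).
  - by move=> i iJ; rewrite etap ffunE iJ.
  - move=> i; rewrite /lcoord /lroot lp; have := hy v vJ i.
    by case: (i \in J) => /ltW.
apply/rowP => r; rewrite mxE; case: ifPn => rJ.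
  rewrite chart_ptE wp w0w lp /z mulKmx; last exact: (parabolic_unit H vJ).
  by rewrite (rebuild_sroot H) // enum_valK.
rewrite etap ffunE rJ /lcoord lp omz // enum_valK sqrtr_sqr.
have [y0|y0] := ltrP (y 0 r) 0; first by rewrite ltr0_norm // expr1 mulN1r opprK.
by rewrite ger0_norm // expr0 mul1r.
Qed.

(** The hypotheses of the previous lemma are finitely many strict inequalities
    that are continuous in the coordinates; they hold at the given point
    because its local point is dominant and hence extremal among its
    translates. *)
Lemma cdom_nbhs p : cdom p -> exists2 t, 0 < t & nbhs (cmap p) (cmap @` ccore t).
Proof.
move=> [op cp].
have [t t0 ht] : exists2 t : R, 0 < t & forall i,
    t < (if i \in J then lcoord i p else lroot i p).
  by apply: pos_lower_bound => i; have := cp i; case: ifP.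
exists t => //.
have [ws _ wsP] := parabolic_enum H J.
have Yp := cmap_rebuild op; have [pJ _] := op.
pose Q (v : 'M[R]_l) i (y : 'rV[R]_#|I|) : Prop := if i \in J
  then t < pairing (om i) (xo - v *m rebuild (D := D) xo J y)
  else t < pairing (al i) (v *m rebuild (D := D) xo J y).
have nr : \forall y \near cmap p, forall v, v \in ws -> forall i, Q v i y.
  apply: near_seq => v /wsP vJ; apply: (near_forall (P := Q v)) => i.
  have vpJ := parabolicM vJ pJ.
  have dp : dominantJ (D := D) J (local_pt p) by move=> j _; exact: lroot_ge0.
  rewrite /Q; have := ht i; have [iJ ti|iJ ti] := boolP (i \in J).
    have cg := @rebuild_continuous R l I D xo J (om i *m v) (cmap p).
    have : pairing (om i *m v) (rebuild (D := D) xo J (cmap p)) < pairing (om i) xo - t.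
      rewrite -pairing_mul -Yp chart_ptE mulmxA mulmxE ltrBrDl -ltrBrDr.
      rewrite -pairingBr; apply: lt_le_trans ti _.
      rewrite /lcoord !pairingBr lerD2l lerN2 -subr_ge0 -pairingBr.
      exact: (parabolic_dominant_ge H _ vpJ dp).
    move=> /(near_lt cg); apply: filterS => y.
    by rewrite (pairingBr _ xo (v *m _)) pairing_mul ltrBrDl -ltrBrDr.
  have cg := @rebuild_continuous R l I D xo J (al i *m v) (cmap p).
  have : t < pairing (al i *m v) (rebuild (D := D) xo J (cmap p)).
    rewrite -pairing_mul -Yp chart_ptE mulmxA mulmxE; apply: lt_le_trans ti _.
    exact: (parabolic_sroot_ge H vpJ dp iJ).
  by move=> /(near_gt cg); apply: filterS => y; rewrite pairing_mul.
apply: filterS nr => y hy; apply: ccore_surj => // v /wsP; exact: hy.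
Qed.

End OneChart.
End Chart.

(** * Transition maps and the manifold structure *)

Section Transition.
Context {R : realType} {l : nat} {I : finType} {D : tomei_data R l I}.
Variable H : root_datum D.
Context {xo : 'cV[R]_l}.
Hypothesis xo_reg : regular_dominant D xo.
Local Notation al := (sroot D).
Local Notation h := (scoroot D).
Local Notation om := (fweight D).
Local Notation piece := (pieces D xo).
Implicit Types (p q : piece) (i j k : I).

Section TwoCharts.
Variables (J J' : {set I}) (e0 e0' : @signs I) (w0 w0' : 'M[R]_l).
Hypotheses (w0_weyl : weyl D w0) (w0'_weyl : weyl D w0').

(** The relative sign of the origins of two charts, seen from a piece. *)
Definition sign_change p := sadd (eta H e0 w0 p) (eta H e0' w0' p).

Lemma sign_changeE p : sign_change p =
  sact H (invmx (piece_weyl p)) (sadd (sact H w0 e0) (sact H w0' e0')).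
Proof.
have Wp := weylV H (piece_weylP p).
rewrite (sact_add H _ _ Wp) -!(sactM H _ Wp) //.
by apply/ffunP => j; rewrite !ffunE addbACA addbb addFb.
Qed.

Definition overlap d : set piece := cdom H J e0 w0 `&` cdom H J' e0' w0' `&`
  [set q | sign_change q = d].

Lemma overlap_open d : open (overlap d).
Proof.
apply: openI; first by apply: openI; exact: cdom_open.
rewrite /sign_change /eta.
exact: (@open_index R l I D xo (fun e w => sadd (sadd e (sact H (invmx w * w0) e0))
  (sadd e (sact H (invmx w * w0') e0')) = d)).
Qed.

(** The sign change between two charts is an invariant of the gluing: it
    vanishes on the indices of both charts, among which are all internal walls
    through the point. *)
Lemma overlap_glued d p q : glued H p q -> overlap d p -> overlap d q.
Proof.
move=> g [[cp cp'] dp]; split; first by split; [exact: cdom_glued g cp|exact: cdom_glued g cp'].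
rewrite /= -dp !sign_changeE; have [Epq _] := g.
have [_ par] := same_pt H xo_reg Epq.
have Wp := piece_weylP p; have Wq := piece_weylP q.
have -> : invmx (piece_weyl q) =
    (invmx (piece_weyl q) * piece_weyl p) * invmx (piece_weyl p).
  by rewrite -mulrA (weyl_mulV H Wp) mulr1.
rewrite (sactM H _ (parabolic_weyl par) (weylV H Wp)) -sign_changeE.
apply: (sact_fix H par) => i iJ0; rewrite !ffunE.
have [[_ eJ] co] := cp; have [[_ eJ'] co'] := cp'.
have /fintype.subsetP sJ := core_stab co; have /fintype.subsetP sJ' := core_stab co'.
move: (eJ i (sJ _ iJ0)) (eJ' i (sJ' _ iJ0)); rewrite !ffunE => -> ->.
by [].
Qed.

(** Each new coordinate is, up to sign, a linear function of the rebuilt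
    point, the square root of one, or the old coordinate. A square root is
    only taken at an index in J, where the coordinate under it is positive on
    the overlap. *)
Definition transition (d : @signs I) (y : 'rV[R]_#|I|) : 'rV[R]_#|I| := \row_r
  let i := enum_val r in
  if i \in J' then pairing (al i *m (invmx w0' *m w0)) (rebuild (D := D) xo J y)
  else (-1) ^+ d i * (if i \in J
    then Num.sqrt (pairing (om i) xo +
      -1 * pairing (om i *m (invmx w0' *m w0)) (rebuild (D := D) xo J y))
    else y 0 r).

Lemma transitionE d q : overlap d q ->
  cmap H J' e0' w0' q = transition d (cmap H J e0 w0 q).
Proof.
move=> [[[oq cq] [oq' cq']] dq]; apply/rowP => r; rewrite [LHS]mxE [RHS]mxE /=.
have Y' : invmx w0' *m piece_pt q =
    (invmx w0' *m w0) *m rebuild (D := D) xo J (cmap H J e0 w0 q).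
  by rewrite -(cmap_rebuild xo_reg w0_weyl oq) -mulmxA mulKVmx // (weyl_unit H).
case: ifPn => rJ'; first by rewrite Y' pairing_mul.
have de : eta H e0' w0' q (enum_val r) = eta H e0 w0 q (enum_val r) (+) d (enum_val r).
  by rewrite -dq [sign_change q _]ffunE addbA addbb addFb.
case: ifPn => rJ.
  rewrite de (proj2 oq) // addFb; congr (_ * Num.sqrt _).
  by rewrite -(orbit_coord oq' rJ') Y' pairingBr pairing_mul mulN1r.
rewrite mxE (negPf rJ) de mulrA; congr (_ * _).
by rewrite signr_addb mulrC.
Qed.

Lemma transition_smooth d : smooth_on (cmap H J e0 w0 @` overlap d) (transition d).
Proof.
pose g i y := pairing (om i) xo +
  -1 * pairing (om i *m (invmx w0' *m w0)) (rebuild (D := D) xo J y).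
have kg n i O : Ck_on n O (g i).
  apply: (@Ck_on_sub _ _ _ _ setT) => //; have oT : open [set: 'rV[R]_#|I|] by exact: openT.
  apply: Ck_on_add => //; first exact: Ck_on_cst.
  by apply: Ck_on_mul => //; [exact: Ck_on_cst|exact: rebuild_Ck].
pose O : set 'rV[R]_#|I| := [set y | forall i, i \in J -> i \notin J' -> 0 < g i y].
have oO : open O.
  apply: (open_forall (S := fun i y => i \in J -> i \notin J' -> 0 < g i y)) => i.
  have [iJ|iJ] := boolP (i \in J); last first.
    by rewrite (_ : (fun _ => _) = setT); [exact: openT|apply/seteqP; split].
  have [iJ'|iJ'] := boolP (i \in J').
    by rewrite (_ : (fun _ => _) = setT); [exact: openT|apply/seteqP; split].
  rewrite (_ : (fun _ => _) = g i @^-1` [set t | 0 < t]); last first.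
    by apply/seteqP; split => y; [move/(_ isT isT)|move=> ? _ _].
  have cgi : continuous (g i) by move=> y; have [c _] := kg 0 i setT; exact: c.
  by move/continuousP : cgi; apply; exact: open_gt.
move=> n; apply: (@Ck_on_sub _ _ _ _ O).
  move=> _ [q [[[oq cq] [oq' cq']] _] <-] i iJ iJ'; rewrite /g.
  have Y' : invmx w0' *m piece_pt q =
      (invmx w0' *m w0) *m rebuild (D := D) xo J (cmap H J e0 w0 q).
    by rewrite -(cmap_rebuild xo_reg w0_weyl oq) -mulmxA mulKVmx // (weyl_unit H).
  rewrite mulN1r -pairing_mul -Y' -pairingBr.
  rewrite (orbit_coord oq' iJ').
  by have := cq i; rewrite iJ.
apply: Ck_on_row => // r.
rewrite (_ : (fun _ => _) = fun y => let i := enum_val r in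
  if i \in J' then pairing (al i *m (invmx w0' *m w0)) (rebuild (D := D) xo J y)
  else (-1) ^+ d i * (if i \in J then Num.sqrt (g i y) else y 0 r)); last first.
  by apply/funext => y; rewrite mxE.
rewrite /=; have [iJ'|iJ'] := boolP (enum_val r \in J').
  by apply: (@Ck_on_sub _ _ _ _ setT) => //; exact: rebuild_Ck.
apply: Ck_on_mul => //; first exact: Ck_on_cst.
have [iJ|iJ] := boolP (enum_val r \in J); last exact: Ck_on_coord.
by apply: Ck_on_sqrt => // y Oy; exact: Oy.
Qed.

End TwoCharts.

Definition chart_index := ({set I} * (@signs I * set_type (weyl D)))%type.
Implicit Types c : chart_index.

Definition chart_set c := cdom H (xo := xo) c.1 c.2.1 (val c.2.2).
Definition chart_map c := cmap H (xo := xo) c.1 c.2.1 (val c.2.2).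

Lemma chart_weyl c : weyl D (val c.2.2).
Proof. exact: set_valP. Qed.

(** The index set of a chart around a point consists of the vertices whose
    external wall avoids the point; the internal walls through the point are
    among them because opposite facets are disjoint. *)
Lemma chart_cover p : exists c, chart_set c p.
Proof.
exists ([set i | 0 < lcoord i p]%SET, projT1 p); split; first split.
- by rewrite /= (weyl_Vmul H (piece_weylP p)); exact: parabolic1.
- move=> i _; rewrite ffunE /= (weyl_Vmul H (piece_weylP p)) (sact1 H).
  by rewrite addbb.
move=> i; rewrite /= inE; case: ifPn => // ci.
apply: (cell_facet H xo_reg (local_cell H p)); apply/eqP; rewrite eq_le.
by rewrite leNgt ci (lcoord_ge0 H xo_reg).
Qed.

Lemma chart_index_countable : countable [set: chart_index].
Proof.
apply: finite_set_countable; rewrite -setXTT; apply: finite_setX; first exact: finite_finset.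
exact: (finite_piece_index H).
Qed.

Section Charts.
Context {M : topologicalType} (pr : piece -> M).
Hypothesis prP : forall p q, pr p = pr q <-> glued H p q.

Lemma chart_set_saturated c : saturated pr (chart_set c).
Proof. by move=> p q /prP g; exact: (cdom_glued xo_reg (chart_weyl c) g). Qed.

Lemma chart_map_inj c p q : chart_set c p -> chart_set c q ->
  (chart_map c p = chart_map c q <-> pr p = pr q).
Proof.
move=> cp cq; split=> [e|/prP g].
  by apply/prP; exact: (cmap_inj xo_reg (chart_weyl c) cp cq e).
exact: (cmap_glued xo_reg (chart_weyl c) g cp).
Qed.

Lemma chart_map_nbhs : chart_nbhs pr chart_set chart_map.
Proof.
move=> c p cp; have [t t0 nt] := cdom_nbhs xo_reg (chart_weyl c) cp.
exists (ccore H (xo := xo) c.1 c.2.1 (val c.2.2) t); split => //.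
- exact: ccore_closed.
- by move=> q [oq cq]; split => //; exact: core_geW t0 cq.
- by move=> q r /prP; exact: (ccore_glued xo_reg (chart_weyl c) t0).
Qed.

Lemma quotient_hausdorff : quotient_map pr -> hausdorff_space M.
Proof.
move=> qpr; apply: (charts_hausdorff qpr _ chart_cover _ chart_set_saturated _
  chart_map_inj chart_map_nbhs).
- exact: norm_hausdorff.
- by move=> c; exact: cdom_open.
- by move=> c; exact: cmap_continuous.
Qed.

Lemma quotient_smooth_manifold (p0 : piece) : quotient_map pr ->
  smooth_manifold R #|I| M.
Proof.
move=> qpr; apply: (charts_smooth_manifold p0 _ qpr chart_cover _
  chart_set_saturated _ chart_map_inj chart_map_nbhs).
- exact: (pieces_compact H xo_reg).
- by move=> c; exact: cdom_open.
- by move=> c; exact: cmap_continuous.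
- move=> c c' p cp cp'.
  pose d := sign_change c.2.1 c'.2.1 (val c.2.2) (val c'.2.2) p.
  exists (overlap c.1 c'.1 c.2.1 c'.2.1 (val c.2.2) (val c'.2.2) d).
  exists (transition c.1 c'.1 (val c.2.2) (val c'.2.2) d).
  have Wc := chart_weyl c; have Wc' := chart_weyl c'.
  split.
  + exact: overlap_open.
  + by move=> q r /prP; exact: overlap_glued.
  + by split.
  + by move=> q [[]].
  split; first exact: transition_smooth.
  by move=> q oq; exact: transitionE.
- exact: chart_index_countable.
Qed.

End Charts.

Lemma to_tomeiP p q : to_tomei p = to_tomei q <-> glued H p q.
Proof.
rewrite -(glueP H xo_reg); split=> [/eqmodP/asboolP //|g].
by apply/eqmodP/asboolP.
Qed.

Lemma to_tomei_quotient : quotient_map (to_tomei : piece -> tomei D xo).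
Proof.
split=> // m; exists (repr m); exact: reprK.
Qed.

Lemma tomei_hausdorff : hausdorff_space (tomei D xo).
Proof. exact: (quotient_hausdorff to_tomeiP to_tomei_quotient). Qed.

End Transition.

(** * The root datum of a Levi factor *)

Section Levi.
Context {R : realType} {l : nat} {I : finType} {D : tomei_data R l I}.
Variable H : root_datum D.
Variable B : {set I}.
Local Notation IB := {i : I | i \in B}.
Local Notation DB := (levi B D).
Local Notation al := (sroot D).
Local Notation h := (scoroot D).
Local Notation om := (fweight D).
Implicit Types (w v : 'M[R]_l) (e : @signs IB) (f : @signs I).

Lemma levi_sum (V : nmodType) (F : I -> V) :
  \sum_(i : IB) F (val i) = \sum_(k in B) F k.
Proof.
rewrite [RHS](reindex_omap (val : IB -> I) insub) /=.
  by apply: eq_bigl => i; rewrite (valP i) valK eqxx.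
by move=> k kB; rewrite insubT.
Qed.

Lemma levi_wordprod s : wordprod DB s = wordprod D (map val s).
Proof. by rewrite /wordprod big_map. Qed.

Lemma levi_weylP w : weyl DB w <-> parabolic D B w.
Proof.
split=> [/weylP[s ->]|[s sB ->]].
  exists (map val s); last exact: levi_wordprod.
  by apply/allP => _ /mapP[i _ ->]; exact: (valP i).
apply/weylP; exists (pmap insub s); rewrite levi_wordprod; congr wordprod.
elim: s sB => //= i s IH /andP[iB sB].
by rewrite insubT /= -IH.
Qed.

(** The default value false stands for the sign +1. *)
Definition sext e : @signs I :=
  [ffun k => if insub k is Some i then e i else false].

Definition sres f : @signs IB := [ffun i => f (val i)].

Lemma sext_val e i : sext e (val i) = e i.
Proof. by rewrite ffunE valK. Qed.

Lemma sextK e : sres (sext e) = e.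
Proof. by apply/ffunP => i; rewrite ffunE sext_val. Qed.

(** The parabolic subgroup only reads the signs at vertices of B, so it acts
    on them. *)
Lemma sact_res w f f' : parabolic D B w -> sres f = sres f' ->
  sres (sact H w f) = sres (sact H w f').
Proof.
move=> wB /ffunP ff; apply/ffunP => i; rewrite !ffunE.
apply: (sact_off H wB (K := fun j => j \notin B)); rewrite ?negbK //.
- by move=> j ->.
- by move=> j; rewrite negbK => jB; have := ff (exist _ j jB); rewrite !ffunE.
- exact: (valP i).
Qed.

Definition levi_sact w e := sres (sact H w (sext e)).

(** The simple roots are independent, so a combination that lies in the span
    of the simple roots in B has no other coefficients. *)
Lemma levi_support (c : IB -> R) (d : I -> R) :
  \sum_(i : IB) c i *: al (val i) = \sum_k d k *: al k ->
  \sum_k d k *: al k = \sum_(i : IB) d (val i) *: al (val i).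
Proof.
move=> cd; rewrite (levi_sum (fun k => d k *: al k)).
rewrite [LHS](bigID (mem B)) /= [X in _ + X]big1 ?addr0 // => k kB.
pose c' k := if insub k is Some i then c i else 0.
have : \sum_k c' k *: al k = \sum_k d k *: al k.
  rewrite -cd [LHS](bigID (mem B)) /= [X in _ + X]big1 ?addr0; last first.
    by move=> j jB; rewrite /c' insubN // scale0r.
  rewrite -(levi_sum (fun k => c' k *: al k)); apply: eq_bigr => i _.
  by rewrite /c' valK.
by move/(sroot_indep H)/(_ k); rewrite /c' insubN // => <-; rewrite scale0r.
Qed.

(** The Levi factor inherits the form, the roots in the span of its simple
    roots, and the sign action on the signs of its own vertices. The definition is transparent so that the sign action
    unfolds. *)
Definition levi_root_datum : root_datum DB.
Proof.
apply: (@RootDatum R l _ DB (gram H) (fun i => rscale H (val i))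
  [seq a <- roots H | `[< exists c : IB -> R, a = \sum_(i : IB) c i *: al (val i) >] ]
  levi_sact).
- exact: gram_sym.
- exact: gram_gt0.
- by move=> i; exact: rscale_gt0.
- by move=> i; exact: (sroot_gram H (val i)).
- by move=> i; exact: (pairing_coroot H).
- by move=> i j; rewrite /= (fweight_coroot H) val_eqE.
- move=> i; rewrite mem_filter (sroot_roots H (val i)) andbT; apply/asboolP.
  exists (fun j => (j == i)%:R); rewrite (bigD1 i) //= eqxx scale1r big1 ?addr0 //.
  by move=> j /negPf ->; rewrite scale0r.
- move=> i a; rewrite !mem_filter => /andP[/asboolP[c ac] ar].
  apply/andP; split; last exact: (refl_roots (val i) ar).
  apply/asboolP; exists (fun j => c j - pairing a (h (val i)) * (j == i)%:R).
  under eq_bigr do rewrite scalerBl -scalerA.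
  rewrite sumrB -scaler_sumr -ac -[a *m refl _ i]/(a *m refl D (val i)) refl_mull.
  congr (_ - _ *: _); rewrite (bigD1 i) //= eqxx scale1r big1 ?addr0 //.
  by move=> j /negPf ->; rewrite scale0r.
- move=> a; rewrite mem_filter => /andP[/asboolP[c ac] /roots_comb[d [d0 [ad|ad]]]].
    exists (fun i => d (val i)); split => [i|]; first exact: d0.
    by left; rewrite ad; apply: (levi_support (c := c)); rewrite -ac.
  exists (fun i => d (val i)); split => [i|]; first exact: d0.
  right; rewrite ad; congr (- _); apply: (levi_support (c := fun i => - c i)).
  under eq_bigr do rewrite scaleNr.
  by rewrite sumrN -ac ad opprK.
- by move=> e; rewrite /levi_sact (sact1 H) sextK.
- move=> v w e /levi_weylP vB /levi_weylP wB; rewrite /levi_sact.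
  rewrite (sactM H _ (parabolic_weyl vB) (parabolic_weyl wB)).
  by apply: sact_res => //; rewrite sextK.
- move=> i e; apply/ffunP => j.
  rewrite /levi_sact ffunE -[refl _ i]/(refl D (val i)) (sact_refl H) !ffunE.
  by rewrite !valK.
Defined.

End Levi.

(** * Homeomorphisms between cells *)

Section DeterminantContinuity.
Context {R : realType} {T : topologicalType}.

Lemma det_continuous n (F : T -> 'M[R]_n) x :
  (forall i j, {for x, continuous (fun y => F y i j)}) ->
  {for x, continuous (fun y => \det (F y))}.
Proof.
move=> cF; rewrite /determinant; apply: sum_continuous => s.
apply: continuousM; first exact: cst_continuous.
by apply: prod_continuous => i; exact: cF.
Qed.

Lemma adj_continuous n (F : T -> 'M[R]_n) x i j :
  (forall i j, {for x, continuous (fun y => F y i j)}) ->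
  {for x, continuous (fun y => (\adj (F y)) i j)}.
Proof.
move=> cF; rewrite (_ : (fun _ => _) = fun y => cofactor (F y) j i); last first.
  by apply/funext => y; rewrite mxE.
apply: continuousM; first exact: cst_continuous.
apply: det_continuous => a b.
rewrite (_ : (fun _ => _) = fun y => F y (lift j a) (lift i b)) //.
by apply/funext => y; rewrite !mxE.
Qed.

End DeterminantContinuity.

Section CellChange.
Context {R : realType} {l : nat} {I : finType} {D : tomei_data R l I}.
Variable H : root_datum D.
Local Notation al := (sroot D).
Local Notation h := (scoroot D).
Local Notation om := (fweight D).
Local Notation d := #|I|.
Implicit Types (x z : 'cV[R]_l) (i k : I).

(** Two points of the cells of x1 and x2 are matched when, for every i, their
    distances to the internal and to the external wall of index i are in the
    same ratio. For a given z this is a linear system for the matched point,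
    and it pairs each facet of one cell with the facet of the other cell of
    the same kind and index. *)
Definition matched x1 x2 z z' := forall i,
  pairing (om i) (x1 - z) * pairing (al i) z' =
  pairing (al i) z * pairing (om i) (x2 - z').

Lemma matched_sym x1 x2 z z' : matched x1 x2 z z' -> matched x2 x1 z' z.
Proof. by move=> m i; rewrite mulrC -m mulrC. Qed.

Section FacetMatching.
Variables x1 x2 : 'cV[R]_l.
Hypothesis x1_reg : regular_dominant D x1.

(** The hypothesis makes each product of a coordinate of v with the
    corresponding root value nonpositive: where the first factor on the left
    vanishes, the root value of z is positive and the coordinate of v
    vanishes. *)
Lemma matched_homog z v : cell0 D x1 z -> hspan (D := D) v ->
  (forall i, pairing (om i) (x1 - z) * pairing (al i) v =
             - (pairing (al i) z * pairing (om i) v)) -> v = 0.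
Proof.
move=> cz hv m; rewrite hv; apply: (comb_eq0 H) => i; rewrite -hv.
have /(cell0P H _ (xo_dominant x1_reg))[dz _ oz] := cz.
have [c0|c0] := eqVneq (pairing (om i) (x1 - z)) 0.
  have := m i; rewrite c0 mul0r => /esym/eqP; rewrite oppr_eq0 mulf_eq0.
  by rewrite (gt_eqF (cell_facet H x1_reg cz c0)) /= => /eqP ->; rewrite mul0r.
have {}c0 : 0 < pairing (om i) (x1 - z) by rewrite lt_neqAle eq_sym c0 oz.
rewrite -(pmulr_rle0 _ c0) mulrCA m mulrN oppr_le0 mulrCA mulr_ge0 ?dz //.
by rewrite -expr2 sqr_ge0.
Qed.

Lemma matched_uniq z z1 z2 : cell0 D x1 z ->
  hspan (D := D) (x2 - z1) -> hspan (D := D) (x2 - z2) ->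
  matched x1 x2 z z1 -> matched x1 x2 z z2 -> z1 = z2.
Proof.
move=> cz h1 h2 m1 m2; apply/eqP; rewrite -subr_eq0; apply/eqP.
have e : z1 - z2 = (x2 - z2) - (x2 - z1).
  by rewrite opprB [RHS]addrC addrA subrK.
apply: (matched_homog cz) => [|i]; first by rewrite e; exact: hspanB.
have := m1 i; have := m2 i; rewrite !pairingBr => e2 e1.
by rewrite mulrBr e1 e2; ring.
Qed.

Definition match_mx z : 'M[R]_d := \matrix_(s, r)
  (pairing (om (enum_val r)) (x1 - z) * pairing (al (enum_val r)) (h (enum_val s))
   + (s == r)%:R * pairing (al (enum_val r)) z).

Lemma match_mxE z (v : 'rV[R]_d) i : (v *m match_mx z) 0 (enum_rank i) =
  pairing (om i) (x1 - z) * pairing (al i) (\sum_k v 0 (enum_rank k) *: h k)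
  + pairing (al i) z * v 0 (enum_rank i).
Proof.
rewrite mxE; under eq_bigr do rewrite mxE enum_rankK mulrDr.
rewrite big_split /=; congr (_ + _); last first.
  rewrite (bigD1 (enum_rank i)) //= eqxx mul1r big1 ?addr0 1?mulrC // => s /negPf ->.
  by rewrite mul0r mulr0.
rewrite pairing_sumr [in RHS]sum_enum mulr_sumr; apply: eq_bigr => s _.
by rewrite pairingZr enum_valK mulrCA.
Qed.

Lemma match_mx_unit z : cell0 D x1 z -> match_mx z \in unitmx.
Proof.
move=> cz; rewrite -row_free_unit -kermx_eq0; apply/eqP/row_matrixP => i.
rewrite row0; set v := row i _.
have vN : v *m match_mx z = 0 by rewrite -row_mul mulmx_ker row0.
have v0 : \sum_k v 0 (enum_rank k) *: h k = 0.
  apply: (matched_homog cz) => [|k]; first exact: (hspan_comb H).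
  have := match_mxE z v k; rewrite vN mxE (fweight_comb H) => /esym/eqP.
  by rewrite addr_eq0 => /eqP.
apply/rowP => s; have := comb0 H v0 (enum_val s); rewrite enum_valK => ->.
by rewrite mxE.
Qed.

Definition match_rhs z : 'rV[R]_d := \row_r
  (pairing (om (enum_val r)) (x1 - z) * pairing (al (enum_val r)) x2).

(** The solution of the linear system by the rule of Cramer, which makes its
    continuity in z visible. *)
Definition match_coef z k :=
  (\det (match_mx z))^-1 * (match_rhs z *m \adj (match_mx z)) 0 (enum_rank k).

Definition match_pt z := x2 - \sum_k match_coef z k *: h k.

Lemma match_ptK z : x2 - match_pt z = \sum_k match_coef z k *: h k.
Proof. by rewrite /match_pt opprB addrC subrK. Qed.

Lemma match_ptP z : cell0 D x1 z -> matched x1 x2 z (match_pt z).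
Proof.
move=> cz i; pose v : 'rV[R]_d :=
  (\det (match_mx z))^-1 *: (match_rhs z *m \adj (match_mx z)).
have vQ : v *m match_mx z = match_rhs z.
  rewrite -scalemxAl -mulmxA mul_adj_mx mul_mx_scalar scalerA mulVf ?scale1r //.
  by rewrite -unitfE -unitmxE match_mx_unit.
have vE k : match_coef z k = v 0 (enum_rank k) by rewrite mxE.
have := match_mxE z v i; rewrite vQ mxE enum_rankK => e.
rewrite match_ptK (fweight_comb H) /match_pt (pairingBr _ x2) mulrBr e vE.
under [X in _ - _ * pairing _ X = _]eq_bigr do rewrite vE.
by rewrite addrAC subrr add0r.
Qed.

Hypothesis x2_reg : regular_dominant D x2.

(** Let n be the negative part of the coordinates. Where it is positive, the
    matching makes the root value of the matched point nonpositive; as x2 is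
    regular and simple roots pair nonpositively with the coroots of other
    indices, the root value of the vector with coordinates n is then
    nonpositive too, and positive definiteness forces this vector to vanish. *)
Lemma match_coef_ge0 z : cell0 D x1 z -> forall k, 0 <= match_coef z k.
Proof.
move=> cz; have m := match_ptP cz.
have /(cell0P H _ (xo_dominant x1_reg))[dz _ oz] := cz.
set g := match_coef z in m *; pose n k := Num.max 0 (- g k).
have n0 k : 0 <= n k by rewrite le_max lexx.
have gn k : 0 <= g k + n k.
  by rewrite -[g k]opprK -lerBlDl sub0r opprK le_max lexx orbT.
suff e : \sum_k n k *: h k = 0.
  by move=> k; have := gn k; rewrite (comb0 H e) addr0.
apply: (comb_eq0 H) => i; have [gi|gi] := leP 0 (g i).
  have -> : n i = 0 by apply/eqP; rewrite eq_le n0 andbT ge_max lexx oppr_le0.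
  by rewrite mul0r.
apply: mulr_ge0_le0 => //.
have := m i; rewrite match_ptK (fweight_comb H) -/g => mi.
have [c0|c0] := eqVneq (pairing (om i) (x1 - z)) 0.
  move: mi; rewrite c0 mul0r => /esym/eqP; rewrite mulf_eq0.
  by rewrite (gt_eqF (cell_facet H x1_reg cz c0)) (lt_eqF gi).
have {}c0 : 0 < pairing (om i) (x1 - z) by rewrite lt_neqAle eq_sym c0 oz.
have : pairing (al i) (match_pt z) <= 0.
  by rewrite -(pmulr_rle0 _ c0) mi mulr_ge0_le0 ?dz // ltW.
rewrite /match_pt pairingBr subr_le0 -/g => /(lt_le_trans (x2_reg i)) gpos.
have -> : \sum_k n k *: h k = \sum_k (g k + n k) *: h k - \sum_k g k *: h k.
  by rewrite -sumrB; apply: eq_bigr => k _; rewrite scalerDl addrC addKr.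
rewrite pairingBr subr_le0; apply: le_trans (ltW gpos).
rewrite pairing_sumr; apply: sumr_le0 => k _; rewrite pairingZr.
have [->|ki] := eqVneq k i.
  suff -> : n i = - g i by rewrite subrr mul0r.
  by apply/max_idPr; rewrite oppr_ge0 ltW.
by rewrite mulr_ge0_le0 // (cartan_le0 H) // eq_sym.
Qed.

Lemma match_cell z : cell0 D x1 z -> cell0 D x2 (match_pt z).
Proof.
move=> cz; apply/(cell0P H _ (xo_dominant x2_reg)); rewrite match_ptK.
have g0 := match_coef_ge0 cz; have m := match_ptP cz.
have /(cell0P H _ (xo_dominant x1_reg))[dz _ oz] := cz.
split; last by move=> k; rewrite (fweight_comb H).
  move=> i; have := m i; rewrite match_ptK (fweight_comb H) => mi.
  have [c0|c0] := eqVneq (pairing (om i) (x1 - z)) 0.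
    move: mi; rewrite c0 mul0r => /esym/eqP; rewrite mulf_eq0.
    rewrite (gt_eqF (cell_facet H x1_reg cz c0)) /= => /eqP gi.
    rewrite /match_pt pairingBr subr_ge0; apply: le_trans (ltW (x2_reg i)).
    rewrite pairing_sumr; apply: sumr_le0 => k _; rewrite pairingZr.
    have [->|ki] := eqVneq k i; first by rewrite gi mul0r.
    by rewrite mulr_ge0_le0 // (cartan_le0 H) // eq_sym.
  have {}c0 : 0 < pairing (om i) (x1 - z) by rewrite lt_neqAle eq_sym c0 oz.
  by rewrite -(pmulr_rge0 _ c0) mi mulr_ge0 // dz.
exact: (hspan_comb H).
Qed.

Lemma matched_in z z' i : cell0 D x1 z -> matched x1 x2 z z' ->
  pairing (al i) z = 0 -> pairing (al i) z' = 0.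
Proof.
move=> cz m ai; have := m i; rewrite ai mul0r => /eqP; rewrite mulf_eq0.
case/orP=> /eqP // c0.
by have := cell_facet H x1_reg cz c0; rewrite ai ltxx.
Qed.

Lemma matched_out z z' i : cell0 D x1 z -> matched x1 x2 z z' ->
  pairing (om i) (x1 - z) = 0 -> pairing (om i) (x2 - z') = 0.
Proof.
move=> cz m c0; have := m i; rewrite c0 mul0r => /esym/eqP; rewrite mulf_eq0.
by rewrite (gt_eqF (cell_facet H x1_reg cz c0)) => /eqP.
Qed.

(** The stabilizer of a point of the cell is generated by the simple
    reflections of the internal walls through it. *)
Lemma matched_stab z z' v : cell0 D x1 z -> matched x1 x2 z z' ->
  weyl D v -> v *m z = z -> v *m z' = z'.
Proof.
move=> cz m Wv vz; have /(cell0P H _ (xo_dominant x1_reg))[dz _ _] := cz.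
have := dominant_stab H Wv dz; rewrite vz => /(_ dz)[_ par].
apply: (parabolic_fix par) => i; rewrite inE => /eqP.
exact: matched_in.
Qed.

Lemma match_pt_continuous z : cell0 D x1 z -> {for z, continuous match_pt}.
Proof.
move=> cz; have pc (a : 'rV[R]_l) : {for z, continuous (pairing a)}.
  exact: pairing_continuous.
have oc k : {for z, continuous (fun y : 'cV[R]_l => pairing (om k) (x1 - y))}.
  rewrite (_ : (fun _ => _) = fun y => pairing (om k) x1 - pairing (om k) y).
    by apply: fun_sub_continuous; [exact: cst_continuous|exact: pc].
  by apply/funext => y; rewrite pairingBr.
have mc s r : {for z, continuous (fun y => match_mx y s r)}.
  rewrite (_ : (fun _ => _) = fun y => pairing (om (enum_val r)) (x1 - y) *
      pairing (al (enum_val r)) (h (enum_val s)) -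
      (- (s == r)%:R) * pairing (al (enum_val r)) y); last first.
    by apply/funext => y; rewrite mxE mulNr opprK.
  apply: fun_sub_continuous; apply: continuousM; do ?exact: cst_continuous.
    exact: oc.
  exact: pc.
apply: fun_sub_continuous; first exact: cst_continuous.
apply: sum_continuous => k; apply: fun_scale_continuous.
apply: continuousM.
  apply: continuousV; last exact: det_continuous.
  by rewrite -unitfE -unitmxE match_mx_unit.
rewrite (_ : (fun _ => _) = fun y =>
    \sum_r match_rhs y 0 r * (\adj (match_mx y)) r (enum_rank k)); last first.
  by apply/funext => y; rewrite mxE.
apply: sum_continuous => r; apply: continuousM; last exact: adj_continuous.
rewrite (_ : (fun _ => _) = fun y => pairing (om (enum_val r)) (x1 - y) *
    pairing (al (enum_val r)) x2); last by apply/funext => y; rewrite mxE.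
by apply: continuousM; [exact: oc|exact: cst_continuous].
Qed.

End FacetMatching.

End CellChange.

(** * Root data of split semisimple Lie algebras *)

Section Trace.
Context {R : realType} {g : vectType R}.
Local Notation n := (\dim {:g}).
Implicit Types (phi psi : 'End(g)) (X Y : n.-tuple g).

Definition lftrace (X : n.-tuple g) phi : R := \tr (passmx.mxof X X phi).

Lemma lftraceE X phi : basis_of {:g} X ->
  lftrace X phi = \sum_i coord X i (phi X`_i).
Proof.
move=> bX; rewrite /lftrace /mxtrace; apply: eq_bigr => i _.
by rewrite !mxE /= passmx.vecof_delta.
Qed.

Lemma lftraceC X phi psi : basis_of {:g} X ->
  lftrace X (phi \o psi)%VF = lftrace X (psi \o phi)%VF.
Proof.
by move=> bX; rewrite /lftrace !(passmx.mxof_comp X X bX) mxtrace_mulC.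
Qed.

(** The change of basis is a composition with the identity. *)
Lemma lftrace_basis X Y phi : basis_of {:g} X -> basis_of {:g} Y ->
  lftrace X phi = lftrace Y phi.
Proof.
move=> bX bY; rewrite /lftrace.
rewrite -{1}[phi]comp_lfun1l (passmx.mxof_comp X X bY) mxtrace_mulC.
by rewrite -(passmx.mxof_comp Y Y bX) comp_lfun1r.
Qed.

Lemma lftraceD X phi psi : basis_of {:g} X ->
  lftrace X (phi + psi) = lftrace X phi + lftrace X psi.
Proof.
move=> bX; rewrite !lftraceE // -big_split; apply: eq_bigr => i _ /=.
by rewrite add_lfunE linearD.
Qed.

Lemma lftraceZ X (k : R) phi : basis_of {:g} X ->
  lftrace X (k *: phi) = k * lftrace X phi.
Proof.
move=> bX; rewrite !lftraceE // big_distrr; apply: eq_bigr => i _ /=.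
by rewrite scale_lfunE linearZ.
Qed.

Lemma lftraceB X phi psi : basis_of {:g} X ->
  lftrace X (phi - psi) = lftrace X phi - lftrace X psi.
Proof. by move=> bX; rewrite lftraceD // -scaleN1r lftraceZ // mulN1r. Qed.

End Trace.

Section Lie.
Context {R : realType} {g : vectType R} (br : {bilinear g -> g -> g}).
Context {l : nat} (iota : {linear 'cV[R]_l -> g}).
Hypothesis br_lie : lie_bracket br.
Hypothesis br_ss : semisimple br.
Hypothesis br_split : split_cartan br iota.
Implicit Types (x y : 'cV[R]_l) (a b c : 'rV[R]_l) (e f u v : g).

Local Notation kil := (killing br).
Local Notation gsp a := (root_space br iota a).

Lemma brxx u : br u u = 0. Proof. by case: br_lie. Qed.

Lemma brC u v : br u v = - br v u.
Proof.
apply/eqP; rewrite -addr_eq0; apply/eqP.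
by have := brxx (u + v); rewrite linearDl !linearDr !brxx add0r addr0.
Qed.

Lemma jacobi u v e : br (br u v) e = br u (br v e) - br v (br u e).
Proof.
have [_ /(_ u v e)] := br_lie; rewrite [br e (br u v)]brC => /eqP.
rewrite subr_eq0 => /eqP <-; rewrite [br e u]brC.
by rewrite linearNr.
Qed.

Lemma adE u v : ad br u v = br u v. Proof. by rewrite lfunE. Qed.

Lemma killingE (X : (\dim {:g}).-tuple g) u v : basis_of {:g} X ->
  kil u v = lftrace X (ad br u \o ad br v)%VF.
Proof. by move=> bX; apply: lftrace_basis => //; exact: vbasisP. Qed.

Lemma killingC u v : kil u v = kil v u.
Proof. exact/lftraceC/vbasisP. Qed.

Lemma killing_inv u v e : kil (br u v) e = kil u (br v e).
Proof.
have adbr u' v' : ad br (br u' v') = ((ad br u' \o ad br v') - (ad br v' \o ad br u'))%VF.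
  apply/lfunP => z.
  by rewrite adE add_lfunE opp_lfunE !comp_lfunE !adE jacobi.
have bX := vbasisP {:g}; rewrite !(killingE _ _ bX) !adbr.
rewrite comp_lfunDl comp_lfunNl comp_lfunDr comp_lfunNr !lftraceB // !comp_lfunA.
congr (_ - _).
by rewrite -!comp_lfunA lftraceC // comp_lfunA.
Qed.

Lemma killingDr u v e : kil u (v + e) = kil u v + kil u e.
Proof.
have bX := vbasisP {:g}; rewrite !(killingE _ _ bX) -lftraceD //.
congr (lftrace _ _); apply/lfunP => z.
by rewrite add_lfunE !comp_lfunE !adE linearDl linearDr.
Qed.

Lemma killingZr u v (k : R) : kil u (k *: v) = k * kil u v.
Proof.
have bX := vbasisP {:g}; rewrite !(killingE _ _ bX) -lftraceZ //.
congr (lftrace _ _); apply/lfunP => z.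
by rewrite scale_lfunE !comp_lfunE !adE linearZl_LR linearZr_LR.
Qed.

Lemma killingZl u v (k : R) : kil (k *: u) v = k * kil u v.
Proof. by rewrite killingC killingZr killingC. Qed.

Lemma killing_sumr u (T : Type) (s : seq T) (F : T -> g) :
  kil u (\sum_(t <- s) F t) = \sum_(t <- s) kil u (F t).
Proof.
elim/big_rec2: _ => [|t y z _ <-]; last by rewrite killingDr.
by rewrite -(scale0r (0 : g)) killingZr mul0r.
Qed.

Lemma ex_weight_basis : exists (X : (\dim {:g}).-tuple g)
    (wt : 'I_(\dim {:g}) -> 'rV[R]_l),
  basis_of {:g} X /\ forall i, gsp (wt i) X`_i.
Proof.
case: br_split => _ _ _ [X bX Xw].
have sX : size X == \dim {:g} by rewrite (size_basis (X := in_tuple X) bX).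
have wX (i : 'I_(\dim {:g})) : exists a, gsp a X`_i.
  by apply: Xw; rewrite mem_nth // (eqP sX).
have [wt hwt] := choice wX.
by exists (Tuple sX), wt.
Qed.

Section WeightBasis.
Variables (X : (\dim {:g}).-tuple g) (wt : 'I_(\dim {:g}) -> 'rV[R]_l).
Hypothesis bX : basis_of {:g} X.
Hypothesis hwt : forall i, gsp (wt i) X`_i.

(** A basis vector on which the vector has a nonzero coordinate has the same
    weight. *)
Lemma weight_in a e : gsp a e -> e != 0 -> a \in codom wt.
Proof.
move=> ea e0; have eX := coord_basis bX (memvf e).
have [i ci] : exists i, coord X i e != 0.
  apply: contrapT => /forallNP c0; move/eqP: e0; apply; rewrite eX big1 // => i _.
  by have /negP := c0 i; rewrite negbK => /eqP ->; rewrite scale0r.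
suff -> : a = wt i by exact: codom_f.
apply: trmx_inj; apply/colP => m; apply/eqP.
have fX := basis_free bX.
have h1 := ea (delta_mx m 0); rewrite {1}eX linear_sumr in h1.
move/(congr1 (coord X i)): h1.
under eq_bigr do rewrite linearZr_LR hwt /= scalerA.
rewrite coord_sum_free // linearZ /= mulrC => /(mulIf ci).
by rewrite /pairing -!colE !mxE => ->.
Qed.
Lemma killing_cartan x y : kil (iota x) (iota y) =
  \sum_i pairing (wt i) x * pairing (wt i) y.
Proof.
rewrite (killingE _ _ bX) lftraceE //; apply: eq_bigr => i _.
rewrite comp_lfunE !adE hwt linearZr_LR hwt /= !linearZ /=.
by rewrite coord_free ?(basis_free bX) // eqxx mulr1 mulrC.
Qed.

End WeightBasis.

(** All weights are real, so that the Killing form is a sum of squares on the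
    split Cartan subalgebra. *)
Lemma ex_cartan_gram : exists (G : 'M[R]_l) (wts : seq 'rV[R]_l),
  [/\ G^T = G, forall x, x != 0 -> 0 < (x^T *m G *m x) 0 0,
      forall x y, kil (iota x) (iota y) = (x^T *m G *m y) 0 0,
      forall a e, gsp a e -> e != 0 -> a \in wts
    & forall a, a \in wts -> exists2 e, gsp a e & e != 0].
Proof.
have [X [wt [bX hwt]]] := ex_weight_basis.
pose G := \sum_i (wt i)^T *m wt i.
have GE x y : (x^T *m G *m y) 0 0 = \sum_i pairing (wt i) x * pairing (wt i) y.
  rewrite mulmx_sumr mulmx_suml summxE; apply: eq_bigr => i _.
  rewrite mulmxA -trmx_mul -mulmxA mxE big_ord1 mxE; congr (_ * _).
exists G, (codom wt); split.
- by rewrite raddf_sum; apply: eq_bigr => i _; rewrite /= trmx_mul trmxK.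
- move=> x x0; rewrite GE lt_neqAle; apply/andP; split; last first.
    by apply: sumr_ge0 => i _; rewrite -expr2 sqr_ge0.
  apply: contraNneq x0 => /esym/eqP; rewrite psumr_eq0; last first.
    by move=> i _; rewrite -expr2 sqr_ge0.
  move=> /allP w0; have wx i : pairing (wt i) x = 0.
    have := w0 i (mem_index_enum _); rewrite mulf_eq0 orbb => /eqP; exact.
  have ad0 : ad br (iota x) = 0.
    apply/lfunP => e; rewrite adE zero_lfunE (coord_basis bX (memvf e)).
    by rewrite linear_sumr big1 // => i _; rewrite linearZr_LR hwt wx scale0r scaler0.
  case: br_split => inj_iota _ _ _; apply/eqP/inj_iota; rewrite linear0.
  apply: br_ss => y; rewrite (killingE _ _ bX) ad0 comp_lfun0l lftraceE //.
  by rewrite big1 // => i _; rewrite zero_lfunE linear0.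
- by move=> x y; rewrite (killing_cartan bX hwt) GE.
- by move=> a e; exact: (weight_in bX hwt).
- move=> a /codomP[i ->]; exists X`_i; first exact: hwt.
  apply/negP => /eqP Xi0; have := coord_free i i (basis_free bX).
  by rewrite Xi0 linear0 eqxx => /eqP; rewrite eq_sym oner_eq0.
Qed.

Lemma root_space_br a b e f : gsp a e -> gsp b f -> gsp (a + b) (br e f).
Proof.
move=> ea fb x; have := jacobi (iota x) e f.
rewrite ea fb linearZl_LR linearZr_LR /= => /eqP; rewrite eq_sym subr_eq => /eqP ->.
by rewrite pairingDl scalerDl.
Qed.

Lemma root_spaceZ a e (k : R) : gsp a e -> gsp a (k *: e).
Proof. by move=> ea x; rewrite linearZr_LR ea /= !scalerA mulrC. Qed.

Lemma root_space0P e : gsp 0 e -> exists y, e = iota y.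
Proof.
case: br_split => _ _ cent _ e0; apply: cent => x.
by rewrite e0 pairing0l scale0r.
Qed.

(** Root spaces for weights that are not opposite are orthogonal, so
    nondegeneracy provides a partner of opposite weight. *)
Lemma ex_opposite a e : gsp a e -> e != 0 ->
  exists2 f, gsp (- a) f & kil e f = 1.
Proof.
move=> ea e0; have [X [wt [bX hwt]]] := ex_weight_basis.
have [i ki] : exists i : 'I_(\dim {:g}), kil e X`_i != 0.
  apply: contrapT => /forallNP k0; move/eqP: e0; apply; apply: br_ss => y.
  rewrite (coord_basis bX (memvf y)) killing_sumr big1 // => i _.
  by rewrite killingZr; have /negP := k0 i; rewrite negbK => /eqP ->; rewrite mulr0.
have wi : wt i = - a.
  apply/eqP; rewrite -addr_eq0; apply/eqP/trmx_inj/colP => m.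
  have := killing_inv e (iota (delta_mx m 0)) X`_i.
  rewrite brC ea -scaleNr killingZl hwt killingZr => /(mulIf ki) em.
  move: em; rewrite /pairing -!colE !mxE => <-; exact: addNr.
exists ((kil e X`_i)^-1 *: X`_i); last by rewrite killingZr mulVf.
by rewrite -wi; apply: root_spaceZ.
Qed.

Lemma coroot_gram (G : 'M[R]_l) a (hh : 'cV[R]_l) :
  (forall x y, kil (iota x) (iota y) = (x^T *m G *m y) 0 0) ->
  is_coroot br iota a hh ->
  hh^T *m G = ((hh^T *m G *m hh) 0 0 / 2) *: a.
Proof.
move=> GE [a2 ah]; apply: trmx_inj; apply/colP => m.
pose x : 'cV[R]_l := delta_mx m 0.
have := ah (x - (pairing a x / 2) *: hh).
rewrite pairingBr pairingZr a2 divfK ?pnatr_eq0 // subrr GE => /(_ erefl).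
rewrite -/(pairing (hh^T *m G) _) pairingBr pairingZr => /eqP.
have px (b : 'rV[R]_l) : pairing b x = b 0 m by rewrite /pairing -colE mxE.
rewrite subr_eq0 !px => /eqP e1; rewrite mxE e1 [RHS]mxE [RHS]mxE.
by rewrite -[(_ *m hh) 0 0]/(pairing _ hh) mulrC mulrA mulrAC.
Qed.

(** The bracket of opposite root vectors is dual to the root for the Killing
    form, hence proportional to the coroot. *)
Lemma ex_sl2 a (hh : 'cV[R]_l) e : gsp a e -> e != 0 -> is_coroot br iota a hh ->
  exists2 f, gsp (- a) f & br e f = iota hh.
Proof.
move=> ea e0 ch; have [G [wts [Gs G0 GE _ _]]] := ex_cartan_gram.
have [f fa kf] := ex_opposite ea e0.
have := root_space_br ea fa; rewrite subrr => /root_space0P[y ey].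
have Ginj (z : 'cV[R]_l) : z^T *m G = 0 -> z = 0.
  move=> z0; apply/eqP; apply: contraT => {}/G0; by rewrite z0 mul0mx mxE ltxx.
have yG : y^T *m G = a.
  apply: trmx_inj; apply/colP => m.
  have := GE y (delta_mx m 0); rewrite -ey killing_inv brC fa -scaleNr.
  rewrite pairingNl opprK killingZr kf mulr1 -colE mxE => e1.
  by rewrite mxE -e1 /pairing -colE !mxE.
pose s := (hh^T *m G *m hh) 0 0 / 2.
exists (s *: f); first exact: root_spaceZ.
rewrite linearZr_LR ey /= -linearZ; congr (iota _); apply/eqP.
rewrite -subr_eq0; apply/eqP/Ginj.
rewrite linearB /= trmx_scale mulmxBl -scalemxAl yG (coroot_gram GE ch).
exact: subrr.
Qed.

Section Sl2.
Variables (a : 'rV[R]_l) (hh : 'cV[R]_l) (e f : g).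
Hypothesis ea : gsp a e.
Hypothesis fa : gsp (- a) f.
Hypothesis ef : br e f = iota hh.
Hypothesis a2 : pairing a hh = 2.

Lemma iter_weight b c u v n : gsp b u -> gsp c v -> gsp (c + b *+ n) (iter n (br u) v).
Proof.
move=> bu cv; elim: n => [|n IH]; first by rewrite mulr0n addr0.
by rewrite mulrS addrCA; apply: root_space_br.
Qed.

Lemma sl2_string c u n : gsp c u -> br e u = 0 ->
  br e (iter n.+1 (br f) u) =
    (n.+1%:R * (pairing c hh - n%:R)) *: iter n (br f) u.
Proof.
move=> cu eu; elim: n => [|n IH].
  have := jacobi e f u; rewrite ef eu linear0r subr0 cu /= => <-.
  by rewrite mul1r subr0.
have := jacobi e f (iter n.+1 (br f) u).
rewrite ef (iter_weight n.+1 fa cu) IH => /eqP.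
rewrite linearZr_LR /= eq_sym subr_eq => /eqP ->.
rewrite -scalerDl; congr (_ *: _).
rewrite pairingDl -[_ *+ n.+1]scaler_nat pairingZl pairingNl a2.
rewrite -[n.+2%:R]natr1 -[n.+1%:R]natr1; ring.
Qed.

(** The iterates have pairwise distinct weights, of which there are finitely
    many. *)
Lemma iter_zero b c u v : gsp b u -> gsp c v -> b != 0 -> v != 0 ->
  exists k, iter k (br u) v != 0 /\ iter k.+1 (br u) v = 0.
Proof.
move=> bu cv b0 v0; have [G [wts [_ _ _ wtsP _]]] := ex_cartan_gram.
have [n n0] : exists n, iter n (br u) v == 0.
  apply: contrapT => /forallNP no0.
  pose s := [seq c + b *+ k | k <- seq.iota 0 (size wts).+1].
  have /uniq_leq_size : uniq s.
    rewrite map_inj_uniq ?iota_uniq // => j k /addrI.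
    move=> ejk; have : j%:R *: b == k%:R *: b by rewrite !scaler_nat ejk.
    rewrite -subr_eq0 -scalerBl scaler_eq0.
    by rewrite (negPf b0) orbF subr_eq0 eqr_nat => /eqP.
  move=> /(_ wts); rewrite size_map size_iota ltnn => h; suff : false by [].
  apply: h => _ /mapP[k _ ->]; apply: wtsP (iter_weight k bu cv) _.
  exact/negP/no0.
case: (@ex_minnP (fun n => iter n (br u) v == 0)) => [|[|m] m0 mmin].
- by exists n.
- by rewrite m0 in v0.
by exists m; split; [apply/negP => /mmin; rewrite ltnn | exact/eqP].
Qed.

(** Raise the vector by e to a highest vector u, of weight b + k a. Lowering u
    by f annihilates it after exactly p + 1 steps with p = b(h) + 2 k, so the
    weight b - b(h) a = b + k a - (p - k) a occurs on the way. *)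
Lemma sl2_reflection_pos b : 0 <= pairing b hh -> a != 0 ->
  (exists2 v, gsp b v & v != 0) ->
  exists2 v, gsp (b - pairing b hh *: a) v & v != 0.
Proof.
move=> bh a0 [v bv v0].
have [k [u0 eu]] := iter_zero ea bv a0 v0.
have ub := iter_weight k ea bv; set u := iter k _ _ in u0 ub.
have {}eu : br e u = 0 by [].
have na0 : - a != 0 by rewrite oppr_eq0.
have [p [fp fp1]] := iter_zero fa ub na0 u0.
have := sl2_string p ub eu; rewrite fp1 linear0r => /esym/eqP.
rewrite scaler_eq0 (negPf fp) orbF mulf_eq0 pnatr_eq0 /= subr_eq0 => /eqP.
rewrite pairingDl -[a *+ k]scaler_nat pairingZl a2 => ep.
have kp : (k <= p)%N.
  rewrite -(ler_nat R) -ep -[leLHS]mulr1 -[leLHS]add0r lerD //.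
  by rewrite ler_wpM2l ?ler0n // ler1n.
exists (iter (p - k) (br f) u).
  have -> : b - pairing b hh *: a = b + a *+ k + - a *+ (p - k).
    have -> : - a *+ (p - k) = - ((p%:R - k%:R) *: a).
      by rewrite -natrB // scaler_nat mulNrn.
    have -> : a *+ k = k%:R *: a by rewrite scaler_nat.
    rewrite -addrA; congr (b + _).
    rewrite -!scaleNr -scalerDl; congr (_ *: _).
    by rewrite -ep; ring.
  exact: iter_weight.
apply: contraNneq fp => fz; have -> : p = (k + (p - k))%N by rewrite subnKC.
by rewrite iterD fz; elim: (k) => [|j /eqP IH] //=; rewrite IH linear0r.
Qed.
End Sl2.

(** When b is negative on the coroot, the roles of e and f are exchanged. *)
Lemma reflection_root a (hh : 'cV[R]_l) b : is_root br iota a ->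
  is_coroot br iota a hh -> is_root br iota b ->
  is_root br iota (b - pairing b hh *: a).
Proof.
move=> [a0 [e ea e0]] ch [b0 bv]; have [f fa ef] := ex_sl2 ea e0 ch.
have [a2 _] := ch; split.
  apply: contraNneq b0 => /eqP; rewrite subr_eq0 => /eqP eb.
  have := congr1 (fun c => pairing c hh) eb; rewrite /= pairingZl a2 => e2.
  have b2 : pairing b hh = 0 by lra.
  by rewrite eb b2 scale0r.
have [bh|/ltW bh] := leP 0 (pairing b hh).
  exact: (sl2_reflection_pos ea fa ef).
have fa' : gsp (- - a) e by rewrite opprK.
have ef' : br f e = iota (- hh) by rewrite brC ef linearN.
have a2' : pairing (- a) (- hh) = 2 by rewrite pairingNl pairingNr opprK.
have := sl2_reflection_pos fa fa' ef' a2' (b := b).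
rewrite pairingNr oppr_ge0 oppr_eq0 scalerN scaleNr opprK; exact.
Qed.

End Lie.

Section LieDatum.
Context {R : realType} {g : vectType R} (br : {bilinear g -> g -> g}).
Context {l : nat} (iota : {linear 'cV[R]_l -> g}).
Context (alpha : 'I_l -> 'rV[R]_l) (delta : 'I_l -> 'I_l -> bool).
Local Notation D := (lie_data br iota alpha delta).

(** The form is the Killing form and the roots are the nonzero weights, which
    the simple reflections permute by the representation theory of sl2. The
    given action of the Weyl group has the exponents of the marks on the edges
    and even exponents elsewhere, so it is the action by twists. *)
Lemma lie_root_datum : lie_bracket br -> semisimple br ->
  split_cartan br iota -> simple_roots br iota alpha ->
  marked_dynkin D -> marks_act D -> inhabited (root_datum D).
Proof.
move=> Hl Hs Hc [alf alr alc] [mk0 _ _] [m [act [[m0 m1 act1 actM actr] mk]]].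
have [G [wts [Gs G0 GE wtsP wtsE]]] := ex_cartan_gram Hs Hc.
have Gunit : G \in unitmx.
  rewrite -row_free_unit -kermx_eq0; apply/eqP/row_matrixP => i.
  rewrite row0; apply: trmx_inj; rewrite trmx0; apply/eqP; apply: contraT => {}/G0.
  by rewrite trmxK -row_mul mulmx_ker row0 mul0mx mxE ltxx.
have exh i : exists hh, is_coroot br iota (alpha i) hh.
  pose t := invmx G *m (alpha i)^T.
  have tG : t^T *m G = alpha i.
    by rewrite trmx_mul trmxK trmx_inv Gs mulmxKV.
  have t0 : t != 0.
    case: (alr i) => a0 _; apply: contraNneq a0 => t0.
    by rewrite -tG t0 trmx0 mul0mx.
  have tt : 0 < pairing (alpha i) t by rewrite -tG; exact: G0.
  exists ((2 / pairing (alpha i) t) *: t); split.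
    by rewrite pairingZr divfK // gt_eqF.
  move=> x ax; rewrite GE trmx_scale -!scalemxAl mxE tG.
  by rewrite -/(pairing _ _) ax mulr0.
have hP i : is_coroot br iota (alpha i) (coroot br iota (alpha i)).
  by rewrite /coroot; case: xgetP => [hh _ //|]; have [hh chh] := exh i => /(_ hh).
pose h i := coroot br iota (alpha i).
have h2 i : pairing (alpha i) (h i) = 2 by case: (hP i).
have h0 i : h i != 0.
  by apply/eqP => hi; have := h2 i; rewrite hi pairing0r => /eqP; rewrite eq_sym pnatr_eq0.
pose s i := 2 / ((h i)^T *m G *m h i) 0 0.
have s0 i : 0 < s i by rewrite divr_gt0 // G0.
have sG i : alpha i = s i *: ((h i)^T *m G).
  rewrite (coroot_gram GE (hP i)) scalerA /s mulrA divfK; last by rewrite gt_eqF // G0.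
  by rewrite divff ?pnatr_eq0 // scale1r.
pose C := \matrix_(p < l, b < l) h b p 0.
have CT : C^T *m G = diag_mx (\row_i (s i)^-1) *m \matrix_i alpha i.
  apply/row_matrixP => i; rewrite !row_mul row_diag_mx -scalemxAl -rowE rowK mxE.
  rewrite sG scalerA mulVf ?gt_eqF // scale1r; congr (_ *m _).
  by apply/rowP => j; rewrite !mxE.
have Cunit : C \in unitmx.
  have : C^T *m G \in unitmx.
    rewrite CT unitmx_mul -[X in _ && X]row_free_unit alf andbT unitmxE det_diag.
    rewrite unitfE; apply/prodf_neq0 => i _.
    by rewrite mxE invr_eq0 gt_eqF.
  by rewrite unitmx_mul Gunit andbT unitmx_tr.
pose rts := [seq a <- wts | a != 0].
have rtsP a : a \in rts <-> is_root br iota a.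
  rewrite mem_filter; split => [/andP[a0 /wtsE]|[a0 [e ea e0]]]; first by split.
  by rewrite a0 (wtsP _ _ ea e0).
constructor; apply: (@RootDatum _ _ _ D G s rts act) => //.
- move=> i j; have -> : scoroot D j = col j C by apply/colP => p; rewrite !mxE.
  have -> : pairing (fweight D i) (col j C) = (row i (invmx C) *m col j C) 0 0 by [].
  by rewrite colE mulmxA -row_mul mulVmx // -colE !mxE.
- by move=> i; apply/rtsP; exact: alr.
- move=> i a /rtsP ar; apply/rtsP; rewrite refl_mull.
  exact: (reflection_root Hl Hs Hc).
- move=> a /rtsP /alc[c ac]; exists (fun i => (c i)%:R); split => [i|]; first exact: ler0n.
  by case: ac => ->; [left|right]; under [in RHS]eq_bigr do rewrite scaler_nat.
- move=> i e; rewrite actr; apply/ffunP => j; rewrite !ffunE /sign_pow; congr (_ (+) (_ && _)).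
  have [ij|nij] := boolP (joined D i j); first exact: mk.
  rewrite (mk0 _ _ nij); apply/negbTE; rewrite -dvdn2.
  have ev : (2 %| m j i)%Z; last by rewrite dvdzE in ev.
  have [->|ji] := eqVneq j i; first exact: m0.
  apply: m1 => //; move: nij; rewrite /joined ji eq_sym ji /= !negbK.
  rewrite /cartan_entry /= -/(h j) -/(h i) => /eqP aij.
  have : pairing ((h i)^T *m G) (h j) = 0.
    by apply: (mulfI (lt0r_neq0 (s0 i))); rewrite -pairingZl -sG aij mulr0.
  have -> : pairing ((h i)^T *m G) (h j) = pairing ((h j)^T *m G) (h i).
    have e1 : (h i)^T *m G *m h j = ((h j)^T *m G *m h i)^T.
      by rewrite !trmx_mul trmxK Gs mulmxA.
    by rewrite /pairing e1 mxE.
  by move=> hij; rewrite sG pairingZl hij mulr0.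
Qed.

End LieDatum.

(** * The closure of an unstable manifold *)

Lemma hausdorff_set_type (T : topologicalType) (A : set T) :
  hausdorff_space T -> hausdorff_space (set_type A).
Proof.
move=> hT x y xy; apply: val_inj; apply: hT => U V nU nV.
have nx := @initial_continuous _ _ (set_val : set_type A -> _) x U nU.
have ny := @initial_continuous _ _ (set_val : set_type A -> _) y V nV.
by have [z [zU zV]] := xy _ _ nx ny; exists (set_val z).
Qed.

Section MapsToPieces.
Context {R : realType} {l : nat} {I : finType} {D : tomei_data R l I}.
Context {xo : 'cV[R]_l}.

(** The pieces are open in their disjoint union, so continuity may be checked
    on the point once the index is locally constant. *)
Lemma pieces_map_continuous (T : topologicalType) (f : T -> pieces D xo) :
  (forall Q : @signs I -> 'M[R]_l -> Prop,
     open [set t | Q (piece_sign (f t)) (piece_weyl (f t))]) ->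
  continuous (fun t => piece_pt (f t)) -> continuous f.
Proof.
move=> fi fx t U nU; have := fx t; have := fi.
case E : (f t) nU => [ew x]; rewrite /nbhs /= /sigT_nbhs /= => nU.
move=> /(_ (fun e v => e = ew.1 /\ v = val ew.2)) oI.
have nI : \near t, piece_sign (f t) = ew.1 /\ piece_weyl (f t) = val ew.2.
  by apply: (open_nbhs_nbhs (conj oI _)); rewrite /= E.
have [V' [[V oV <-] /= Vx] VU] := nU.
rewrite /prop_for /continuous_at E => /(_ V (open_nbhs_nbhs (conj oV Vx))) nV.
rewrite /nbhs /=; apply: filterS2 nI nV => s [].
rewrite /preimage /=; case: (f s) => [[e v] y].
case: (ew) x Vx VU {E nU oI} => [e' v'] x Vx VU.
rewrite /piece_sign /piece_weyl /piece_pt /= => e1 /val_inj e2.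
by move: y; rewrite e1 e2 => y Vy; exact: (VU y).
Qed.

End MapsToPieces.

Section LeviFace.
Context {R : realType} {l : nat} {I : finType} {D : tomei_data R l I}.
Variable H : root_datum D.
Context {xo : 'cV[R]_l}.
Hypothesis xo_reg : regular_dominant D xo.
Variable B : {set I}.
Local Notation IB := {i : I | i \in B}.
Local Notation DB := (levi B D).
Local Notation HB := (levi_root_datum H B).
Local Notation al := (sroot D).
Local Notation h := (scoroot D).
Local Notation om := (fweight D).

Lemma levi_regular : regular_dominant DB xo.
Proof. by move=> i; exact: xo_reg. Qed.

Lemma levi_hspan x : hspan (D := DB) x <->
  hspan (D := D) x /\ forall j, j \notin B -> pairing (om j) x = 0.
Proof.
split=> [hx|[hx xB]]; last first.
  rewrite /hspan [LHS]hx (bigID (mem B)) /= [X in _ + X]big1 ?addr0.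
    by rewrite (levi_sum _ (fun k => pairing (om k) x *: h k)).
  by move=> j /xB ->; rewrite scale0r.
have e : x = \sum_(k in B) pairing (om k) x *: h k.
  by rewrite -levi_sum; exact: hx.
split=> [|j jB]; rewrite e.
  by rewrite big_mkcond; apply: hspan_sum => k _; case: ifP => _;
    [apply: hspanZ; exact: hspan_coroot|exact: hspan0].
rewrite pairing_sumr big1 // => k kB; rewrite pairingZr (fweight_coroot H).
by case: eqVneq jB => [->|_]; rewrite ?kB // mulr0.
Qed.

(** The fundamental cell of the Levi factor is a face of the fundamental cell,
    because the simple roots outside the Levi factor can only grow along the
    negatives of its coroots. *)
Lemma levi_cell0 z : cell0 DB xo z <->
  cell0 D xo z /\ forall j, j \notin B -> pairing (om j) (xo - z) = 0.
Proof.
rewrite (cell0P HB _ (xo_dominant levi_regular)) (cell0P H _ (xo_dominant xo_reg)).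
split=> [[dz /levi_hspan[hz zB] oz]|[[dz hz oz] zB]]; last first.
  by split=> [i||k]; [exact: dz|exact/levi_hspan|exact: oz].
have {}oz k : 0 <= pairing (om k) (xo - z).
  have [kB|/zB -> //] := boolP (k \in B); exact: (oz (exist _ k kB)).
split=> //; split=> // j.
have [jB|jB] := boolP (j \in B); first exact: (dz (exist _ j jB)).
have -> : z = xo - (xo - z) by rewrite opprB addrC subrK.
rewrite [X in xo - X]hz pairingBr subr_ge0; apply: le_trans (ltW (xo_reg j)).
rewrite pairing_sumr; apply: sumr_le0 => k _; rewrite pairingZr.
have [->|kj] := eqVneq k j; first by rewrite zB // mul0r.
by rewrite mulr_ge0_le0 // (cartan_le0 H) // eq_sym.
Qed.

Variable w : 'M[R]_l.
Hypothesis Ww : weyl D w.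

(** The closure of the unstable manifold of w is the instance in which B
    consists of the simple roots whose reflection increases the length of w. *)
Definition levi_face : set (tomei D xo) := [set X | exists q : pieces D xo,
  [/\ X = to_tomei q, weyl DB (w * piece_weyl q)
    & forall j, j \notin B -> pairing (om j) (xo - local_pt q) = 0]].

Lemma levi_faceE : \bigcup_(sigma in weyl DB)
    \bigcup_(A in [set A : {set I} | (~: B)%SET \subset A])
    [set to_tomei p | p in [set p : pieces D xo |
       piece_weyl p = invmx (sigma *m w) /\
       walls_out D xo A (piece_weyl p) (piece_pt p)]] = levi_face.
Proof.
apply/seteqP; split=> [_ [s Ws [A /= BA [q [qw [_ qA]] <-]]]|_ [q [-> Wq qB]]].
  have Us := weyl_unit HB Ws; have Uw := weyl_unit H Ww.
  exists q; split=> // [|j jB].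
    have -> : w * piece_weyl q = invmx s; last exact: (weylV HB).
    rewrite qw -mulmxE -[LHS]mul1mx -(mulVmx Us) -!mulmxA (mulmxA s).
    by rewrite mulmxV ?mulmx1 // unitmx_mul Us.
  apply/(wall_outE H); apply: qA; apply: (fintype.subsetP BA).
  by rewrite finset.in_setC.
exists (invmx (w * piece_weyl q)); first exact: (weylV HB).
exists (~: B)%SET; first exact: fintype.subxx.
exists q => //; split.
  have Wwq : weyl D (w * piece_weyl q) := weylM Ww (piece_weylP q).
  by rewrite mulmxE (weyl_cancel H Wwq Ww) mulrA (weyl_Vmul H Ww) mul1r.
split; first by rewrite (piece_ptE H); exists (local_pt q) => //; exact: local_cell.
by move=> i; rewrite finset.in_setC => iB; apply/(wall_outE H); exact: qB.
Qed.

Section Parametrization.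
Context {y : 'cV[R]_l}.
Hypothesis y_reg : regular_dominant DB y.
Local Notation mp := (match_pt (D := DB) y xo).

Lemma face_pieces : exists f : pieces DB y -> pieces D xo, forall p,
  [/\ piece_sign (f p) = sext (piece_sign p),
      piece_weyl (f p) = invmx w * piece_weyl p,
      piece_pt (f p) = (invmx w * piece_weyl p) *m mp (local_pt p)
    & local_pt (f p) = mp (local_pt p)].
Proof.
suff : forall p : pieces DB y, exists q : pieces D xo,
    [/\ piece_sign q = sext (piece_sign p),
      piece_weyl q = invmx w * piece_weyl p,
      piece_pt q = (invmx w * piece_weyl p) *m mp (local_pt p)
    & local_pt q = mp (local_pt p)] by case/choice => f fP; exists f.
move=> p; apply: (ex_piece H).
  apply: weylM; first exact: (weylV H).
  by have /levi_weylP/parabolic_weyl := piece_weylP p.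
have := match_cell HB y_reg levi_regular (local_cell HB p).
by case/levi_cell0.
Qed.

(** A Weyl group element fixes a point of one cell exactly when it fixes the
    matched point of the other one, and the external walls through two matched
    points have the same indices; so the two closed forms of the gluing
    relation agree. *)
Lemma face_map_glued (f : pieces DB y -> pieces D xo) p q : (forall p,
  [/\ piece_sign (f p) = sext (piece_sign p),
      piece_weyl (f p) = invmx w * piece_weyl p,
      piece_pt (f p) = (invmx w * piece_weyl p) *m mp (local_pt p)
    & local_pt (f p) = mp (local_pt p)]) ->
  glued H (f p) (f q) <-> glued HB p q.
Proof.
move=> fP; have [fs fw fx fl] := fP p; have [gs gw gx gl] := fP q.
have cp := local_cell HB p; have cq := local_cell HB q.
have mpP := match_ptP HB xo y_reg cp; have mqP := match_ptP HB xo y_reg cq.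
have Wp : weyl D (piece_weyl p).
  by have /levi_weylP/parabolic_weyl := piece_weylP p.
have Wq : weyl D (piece_weyl q).
  by have /levi_weylP/parabolic_weyl := piece_weylP q.
have Uw := weyl_unit H Ww; have Uq := weyl_unit H Wq.
have Wu : weyl DB (invmx (piece_weyl q) * piece_weyl p).
  by apply: weylM; [apply: (weylV HB)|]; exact: piece_weylP.
have ptE (z z' : 'cV[R]_l) : (invmx (piece_weyl q) * piece_weyl p) *m z = z' <->
    piece_weyl p *m z = piece_weyl q *m z'.
  rewrite -mulmxE -mulmxA; split=> [<-|->]; first by rewrite mulKVmx.
  by rewrite mulKmx.
have uE : invmx (piece_weyl (f q)) * piece_weyl (f p) =
    invmx (piece_weyl q) * piece_weyl p.
  rewrite fw gw (weyl_cancel H Ww Wq) -mulrA (mulrA w) (weyl_mulV H Ww).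
  by rewrite mul1r.
have cmp := match_cell HB y_reg levi_regular cp.
have cmq := match_cell HB y_reg levi_regular cq.
have ptP : piece_pt (f p) = piece_pt (f q) <-> piece_pt p = piece_pt q.
  split=> E.
    have [lE par] := same_pt H xo_reg E; rewrite fl gl in lE.
    have zE : local_pt p = local_pt q.
      apply: (matched_uniq HB levi_regular cmp (local_hspan HB y_reg p)
        (local_hspan HB y_reg q) (matched_sym mpP)).
      by rewrite lE; exact: matched_sym.
    rewrite (piece_ptE HB p) (piece_ptE HB q); apply/ptE; rewrite -zE.
    apply: (matched_stab HB levi_regular cmp (matched_sym mpP) Wu).
    have Uw' : invmx w \in unitmx by rewrite unitmx_inv.
    apply/ptE; rewrite lE; move: E; rewrite fx gx lE -!mulmxE -!mulmxA.
    exact: (can_inj (mulKmx Uw')).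
  have [zE par] := same_pt HB y_reg E.
  suff mE : piece_weyl p *m mp (local_pt p) = piece_weyl q *m mp (local_pt q).
    by rewrite fx gx -!mulmxE -!mulmxA mE.
  apply/ptE; rewrite -zE; apply: (matched_stab HB y_reg cp mpP Wu).
  by apply/ptE; rewrite [in RHS]zE -!(piece_ptE HB).
rewrite /glued ptP uE fs gs fl; split=> -[E es]; split=> // j.
  move=> cj; have := es (val j); rewrite sext_val => ->; first by rewrite ffunE.
  apply: contraNneq cj => cj; apply/eqP.
  by apply: (matched_out HB levi_regular cmp (matched_sym mpP)).
have [jB|jB] := boolP (j \in B); last by case/levi_cell0: cmp => _ ->; rewrite ?eqxx.
move=> cj; have := es (exist _ j jB); rewrite -sext_val /= => ->.
  by rewrite ffunE.
apply: contraNneq cj => cj; apply/eqP.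
exact: (matched_out HB y_reg cp mpP (i := exist _ j jB)).
Qed.

(** The Tomei manifold of the Levi factor maps onto the face: a piece is
    translated by the inverse of w, its cell is mapped to the cell of the Levi
    factor through xo, and its signs are extended by +1. *)
Lemma levi_face_param : exists pr : pieces DB y -> set_type levi_face,
  (forall p q, pr p = pr q <-> glued HB p q) /\ quotient_map pr.
Proof.
have [f fP] := face_pieces.
have fin p : levi_face (to_tomei (f p)).
  have [fs fw fx fl] := fP p; exists (f p); split=> // [|j jB].
    by rewrite fw mulrA (weyl_mulV H Ww) mul1r; exact: piece_weylP.
  rewrite fl.
  by have /levi_cell0[_ ->] := match_cell HB y_reg levi_regular (local_cell HB p).
exists (fun p => exist _ (to_tomei (f p)) (mem_set (fin p))); split=> [p q|].
  rewrite -(face_map_glued p q fP) -(to_tomeiP H xo_reg); split=> [/(congr1 val) //|e].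
  exact: val_inj.
apply: compact_quotient_map.
- exact: (pieces_compact HB y_reg).
- exact/hausdorff_set_type/(tomei_hausdorff H xo_reg).
- apply: continuous_comp_initial => p.
  apply: (@continuous_comp _ _ _ f); last first.
    exact: (quotient_map_continuous to_tomei_quotient).
  apply: pieces_map_continuous => [Q|].
    rewrite (_ : [set _ | _] = [set t : pieces DB y |
        Q (sext (piece_sign t)) (invmx w * piece_weyl t)]).
      exact: (@open_index _ _ _ _ _ (fun e v => Q (sext e) (invmx w * v))).
    by apply/seteqP; split=> t /=; have [-> -> _ _] := fP t.
  rewrite (_ : (fun _ => _) = fun t : pieces DB y =>
      (invmx w * piece_weyl t) *m mp (local_pt t)); last first.
    by apply/funext => t; have [_ _ -> _] := fP t.
  apply: (@piece_fun_continuous _ _ _ _ _ _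
    (fun _ v x => (invmx w * v) *m mp (invmx v *m x))) => t.
  apply: (@continuous_comp _ _ _ (fun x => mp (invmx (piece_weyl t) *m x))); last first.
    exact: mulmx_continuous.
  apply: (@continuous_comp _ _ _ (mulmx (invmx (piece_weyl t)))).
    exact: mulmx_continuous.
  by apply: (match_pt_continuous HB y_reg); exact: (local_cell HB t).
- move=> [X XF]; have [q [XE Wq qB]] := set_mem XF.
  have cq : cell0 DB xo (local_pt q).
    by apply/levi_cell0; split=> //; exact: (local_cell H q).
  have cz := match_cell HB levi_regular y_reg cq.
  have [p [ps pw px pl]] := ex_piece HB ([ffun i => piece_sign q (val i)]) Wq cz.
  have [fs fw fx fl] := fP p.
  have fw' : piece_weyl (f p) = piece_weyl q.
    by rewrite fw pw mulrA (weyl_Vmul H Ww) mul1r.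
  have fl' : local_pt (f p) = local_pt q.
    have cp := local_cell HB p; rewrite fl.
    apply: (matched_uniq HB y_reg cp _ _ (match_ptP HB xo y_reg cp)).
    + by have /(cell0P HB _ (xo_dominant levi_regular))[] :=
        match_cell HB y_reg levi_regular cp.
    + by have /(cell0P HB _ (xo_dominant levi_regular))[] := cq.
    + rewrite pl; apply: matched_sym.
      exact: (match_ptP HB y levi_regular cq).
  exists p; apply: val_inj; rewrite /= XE; apply/(to_tomeiP H xo_reg); split.
    by rewrite (piece_ptE H) fw' fl' -piece_ptE.
  move=> j; rewrite fl' fw' (weyl_Vmul H (piece_weylP q)) (sact1 H) fs ps => cj.
  have jB : j \in B by apply: contraNT cj => /qB ->.
  by rewrite -[j]/(val (exist (fun k => k \in B) j jB)) sext_val ffunE.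
Qed.

Lemma levi_face_homeomorphic : homeomorphic (set_type levi_face) (tomei DB y).
Proof.
have [pr [prP prq]] := levi_face_param.
apply: (quotient_homeomorphic prq to_tomei_quotient) => p q.
by rewrite prP (to_tomeiP HB y_reg).
Qed.

End Parametrization.

Lemma levi_face_smooth : smooth_manifold R #|B| (set_type levi_face).
Proof.
have [pr [prP prq]] := levi_face_param levi_regular.
have cx : cell0 DB xo xo.
  apply/(cell0P HB _ (xo_dominant levi_regular)); rewrite subrr.
  split=> [i||k]; [exact/ltW/levi_regular|exact: hspan0|by rewrite pairing0r].
have [p0 _] := ex_piece HB [ffun=> false] (weyl1 (D := DB)) cx.
have := quotient_smooth_manifold levi_regular prP p0 prq.
by rewrite card_sig.
Qed.

End LeviFace.

Theorem proposition4p2 (R : realType) (g : vectType R)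
    (br : {bilinear g -> g -> g}) (l : nat) (iota : {linear 'cV[R]_l -> g})
    (alpha : 'I_l -> 'rV[R]_l) (delta : 'I_l -> 'I_l -> bool)
    (xo : 'cV[R]_l) (w : 'M[R]_l) :
  lie_bracket br ->
  semisimple br ->
  split_cartan br iota ->
  simple_roots br iota alpha ->
  let D := lie_data br iota alpha delta in
  marked_dynkin D ->
  marks_act D ->
  regular_dominant D xo ->
  weyl D w ->
  smooth_manifold R #|Pi_u D w| (set_type (unstable_closure D xo w)) /\
  forall y : 'cV[R]_l,
    regular_dominant (levi (Pi_u D w) D) y ->
    homeomorphic (set_type (unstable_closure D xo w))
                 (tomei (levi (Pi_u D w) D) y).
Proof.
move=> hb hs hc hr D hm ha xo_reg Ww.
have [H] := lie_root_datum hb hs hc hr hm ha.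
have -> : unstable_closure D xo w = levi_face (xo := xo) (Pi_u D w) w.
  exact: (levi_faceE H (Pi_u D w) Ww).
split=> [|y y_reg]; first exact: (levi_face_smooth H).
exact: (levi_face_homeomorphic H).
Qed.
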